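(* Let $\xi=\sum_{j=1}^N\delta_{X_j}$ be an almost surely locally finite point process on $\mathbb{R}$ and let $(V_u)_{u\in\mathcal I}$ be the branching random walk with increment point process $\xi$ started from $0$ (see context). Assume (A1)–(A4) with $p>2$. Fix $a>\sqrt{p-2}$ and a sequence $(t_n)_{n\in\mathbb N}$ with $t_n\ge a\sigma\sqrt{n\log n}$ for all $n\in\mathbb N$. Suppose further that one of the following holds: (I) there are $\delta\in(0,\gamma-1)$, $q\in(1+\delta,\gamma)$ (with $\gamma\in(1,2)$ from (A3)) and a sequence $(r(n))_{n\in\mathbb N}$ of reals with $r(n)\in o(n)\cap o(t_n)$ such that $$\limsup_{n\to\infty}\mathrm e^{-(1+\delta)r(n)}\sum_{j=1}^{n-1}\mathrm e^{r(j)}<\infty\quad\text{and}\quad \limsup_{n\to\infty}\frac{\mathrm e^{-r(n)(1-(1+\delta)/q)}}{n\overline F(t_n)}<\infty;$$ (II) (A5) holds. Then $$\frac{\overline Z_n(nc+t_n)}{n\,\mathbf P(S_1>t_n)}\longrightarrow W\quad\text{in }L^1\text{ as }n\to\infty,$$ where $W$ is the almost sure limit of Biggins' martingale $W_n$. Moreover, in case (II) the convergence holds in $L^{q}$ for every $q<2-\gamma^{-1}$, where $\gamma\in(1,2)$ is such that both (A3) and (A5) hold with this $\gamma$.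
   Context: Ulam–Harris tree: $\mathcal I=\bigcup_{n\ge0}\mathbb N^n$ ($\mathbb N^0=\{\varnothing\}$), $|u|=n$ for $u\in\mathbb N^n$, $uj$ denotes concatenation, $v\le u$ means $v$ is a prefix (ancestor) of $u$, $v<u$ means $v\le u$, $v\neq u$. Branching random walk: let $(\xi_u)_{u\in\mathcal I}$ be i.i.d. copies of $\xi=\sum_{j=1}^N\delta_{X_j}$ ($N\in\mathbb N_0\cup\{\infty\}$), $\xi_u=\sum_{j=1}^{N(u)}\delta_{X_j(u)}$; set $V_\varnothing=0$ and $V_{uj}=V_u+X_j(u)$ if $j\le N(u)$, $V_{uj}=\infty$ otherwise. Let $\mu(B)=\mathbb E[\xi(B)]$, $m(\theta)=\mathbb E[\sum_{j=1}^N\mathrm e^{-\theta X_j}]$, $m'(\theta)=-\int x\mathrm e^{-\theta x}\mu(\mathrm dx)$. Biggins' martingale: $W_n=\sum_{|u|=n}\mathrm e^{-V_u}$, with a.s. limit $W$. $Z_n=\sum_{|u|=n}\mathrm e^{-V_u}\delta_{V_u}$, $\overline Z_n(t)=Z_n((t,\infty))$. $F(\mathrm dx)=\mathrm e^{-x}\mu(\mathrm dx)$ (a probability measure under (A1)), $\overline F(t)=F((t,\infty))$; $(S_n)$ is a random walk started at $0$ with increment law $F$ (under $\mathbf P$), $c=\int xF(\mathrm dx)$, $\sigma^2=\int(x-c)^2F(\mathrm dx)$. Assumptions: (A1) $m(1)=1$ and $m(\theta)=\infty$ for all $\theta<1$. (A2) $m'(1)\in(-\infty,0)$. (A3) there is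 $\gamma\in(1,2)$ with $\mathbb E[W_1^\gamma]<\infty$ and $m(\gamma)<1$. (A4) $\overline F(t)\sim t^{-p}\ell(t)$ as $t\to\infty$ for some $p>0$ and $\ell$ slowly varying at $\infty$. (A5) there is $\gamma>1$ with $\mathbb E[\overline Z_1(t)^\gamma]=O(\overline F(t)^\gamma)$ as $t\to\infty$. *)

(* Defs.v *)
From HB Require Import structures.
From mathcomp Require Import all_boot all_order all_algebra.
From mathcomp Require Import all_classical all_reals all_analysis.
From mathcomp Require Import measurable_realfun.
Set Implicit Arguments. Unset Strict Implicit. Unset Printing Implicit Defensive.
Import Order.TTheory GRing.Theory Num.Theory.
Import numFieldNormedType.Exports.
Local Open Scope classical_set_scope.
Local Open Scope ring_scope.

(* Ulam-Harris vertices.  A vertex u = j_1 j_2 ... j_n is stored as the list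
   [:: j_n; ...; j_1] (most recent generation first), with 0-based child
   labels: label j stands for the (j+1)-st child.  The child "u j" of u is
   therefore [j :: u]. *)
Definition vertex := seq nat.

Section BRW.
Context {d : measure_display} {T : measurableType d} {R : realType}.
Variable P : probability T R.

(* X u j : T -> \bar R is the position X_{j+1}(u) of the (j+1)-st atom of the
   point process xi_u; the value +oo encodes "j+1 > N(u)" (no such atom). *)
Variable X : vertex -> nat -> T -> \bar R.

Definition cyl (Y : nat -> T -> \bar R) (k : nat) (B : nat -> set (\bar R))
  : set T := \bigcap_(j in [set j | (j < k)%N]) (Y j @^-1` B j).

(* (xi_u)_u are i.i.d. copies of xi = xi_[::]: each atom position is a random
   variable, all xi_u have the law of xi (equality of all finite-dimensional
   distributions of the atom sequences), and the family is mutually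
   independent (product rule on the generating pi-system of cylinder events,
   for every finite family of distinct vertices). *)
Definition iid_copies : Prop :=
  [/\ (forall u j, measurable_fun setT (X u j)),
      (forall u k (B : nat -> set (\bar R)), (forall j, measurable (B j)) ->
          P (cyl (X u) k B) = P (cyl (X [::]) k B)) &
      (forall (us : seq vertex) k (B : vertex -> nat -> set (\bar R)),
          uniq us -> (forall u j, measurable (B u j)) ->
          P (\bigcap_(u in [set u | u \in us]) cyl (X u) k (B u))
          = (\prod_(u <- us) P (cyl (X u) k (B u)))%E)].

(* xi_u = sum_{j=1}^{N(u)} delta_{X_j(u)}: atoms are real for j <= N(u) and
   +oo afterwards (N(u) in N_0 \cup {oo}). *)
Definition point_process_encoding : Prop :=
  forall u j w, X u j w != -oo%E /\ (X u j w = +oo%E -> X u j.+1 w = +oo%E).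

Definition as_locally_finite : Prop :=
  {ae P, forall w, forall K : R,
      finite_set [set j | exists x : R, X [::] j w = x%:E /\ `|x| <= K]}.

Fixpoint V (u : vertex) (w : T) : \bar R :=
  match u with
  | [::] => 0%E
  | j :: u' => (V u' w + X u' j w)%E
  end.

Definition wgt (v : \bar R) : \bar R :=
  match v with x%:E => (expR (- x))%:E | _ => 0%E end.

Definition tailwgt (t : R) (v : \bar R) : \bar R :=
  match v with x%:E => if t < x then (expR (- x))%:E else 0%E | _ => 0%E end.

Definition Wn (n : nat) (w : T) : \bar R :=
  \esum_(u in [set u : vertex | size u = n]) wgt (V u w).

Definition Zbar (n : nat) (t : R) (w : T) : \bar R :=
  \esum_(u in [set u : vertex | size u = n]) tailwgt t (V u w).

Definition mfun (theta : R) : \bar R :=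
  (\int[P]_w \esum_(j in [set: nat])
     match X [::] j w with x%:E => (expR (- (theta * x)))%:E | _ => 0%E end)%E.

(* positive and negative parts of  int x e^{-x} mu(dx) = -m'(1) *)
Definition mder_pos : \bar R :=
  (\int[P]_w \esum_(j in [set: nat])
     match X [::] j w with x%:E => (Num.max x 0 * expR (- x))%:E | _ => 0%E end)%E.
Definition mder_neg : \bar R :=
  (\int[P]_w \esum_(j in [set: nat])
     match X [::] j w with x%:E => (Num.max (- x) 0 * expR (- x))%:E | _ => 0%E end)%E.

Definition cmean : R := fine mder_pos - fine mder_neg.

Definition sigma2 : \bar R :=
  (\int[P]_w \esum_(j in [set: nat])
     match X [::] j w with x%:E => ((x - cmean) ^+ 2 * expR (- x))%:E | _ => 0%E end)%E.
Definition sigma : R := Num.sqrt (fine sigma2).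

(* Fbar(t) = F((t,oo)) = int_{(t,oo)} e^{-x} mu(dx) = P(S_1 > t) *)
Definition Fbar (t : R) : R :=
  fine (\int[P]_w \esum_(j in [set: nat]) tailwgt t (X [::] j w))%E.

Definition A1 : Prop := mfun 1 = 1%E /\ (forall theta, theta < 1 -> mfun theta = +oo%E).

(* m'(1) = -(mder_pos - mder_neg) is well defined and lies in (-oo, 0) *)
Definition A2 : Prop :=
  [/\ (mder_pos < +oo)%E, (mder_neg < +oo)%E & (mder_neg < mder_pos)%E].

Definition A3 (gamma : R) : Prop :=
  [/\ 1 < gamma, gamma < 2,
      (\int[P]_w (Wn 1 w) `^ gamma < +oo)%E & (mfun gamma < 1)%E].

Definition slowly_varying (l : R -> R) : Prop :=
  [/\ measurable_fun setT l,
      (\forall t \near +oo, 0 < l t) &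
      (forall lam, 0 < lam -> l (lam * t) / l t @[t --> +oo%R] --> (1 : R))].

Definition A4 (p : R) : Prop :=
  0 < p /\ exists l, slowly_varying l /\
    Fbar t / (t `^ (- p) * l t) @[t --> +oo%R] --> (1 : R).

Definition A5 (gamma : R) : Prop :=
  1 < gamma /\ exists C : R,
    \forall t \near +oo,
      (\int[P]_w (Zbar 1 t w) `^ gamma <= (C * Fbar t `^ gamma)%:E)%E.

Definition condI (gamma delta q : R) (r t : nat -> R) : Prop :=
  [/\ 0 < delta, delta < gamma - 1, 1 + delta < q & q < gamma] /\
  [/\ r =o_\oo (fun n : nat => n%:R : R),
      r =o_\oo t,
      (limn_esup (fun n : nat =>
          (expR (- ((1 + delta) * r n)) * \sum_(1 <= j < n) expR (r j))%:E)
         < +oo)%E &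
      (limn_esup (fun n : nat =>
          (expR (- (r n * (1 - (1 + delta) / q))) / (n%:R * Fbar (t n)))%:E)
         < +oo)%E].

Definition normZ (t : nat -> R) (n : nat) (w : T) : \bar R :=
  (Zbar n (n%:R * cmean + t n) w * ((n%:R * Fbar (t n))^-1)%:E)%E.

Definition Lq_conv (q : R) (Y : nat -> T -> \bar R) (W : T -> R) : Prop :=
  (\int[P]_w (`| Y n w - (W w)%:E |) `^ q)%E @[n --> \oo] --> 0%E.

End BRW.

(* Main.v *)
(** Let F(dx) = e^{-x} mu(dx) with mean c, let H_m(x) = P(S_m > x) for the random
    walk with step law F, and write N = n Fbar(t_n).  By the many-to-one identity,
    M_j = sum_{|u| = j} e^{-V_u} H_{n-j}(n c + t_n - V_u), 0 <= j <= n, is a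
    martingale with M_n = Zbar_n(n c + t_n).

    A precise large deviation estimate for H, obtained by splitting off one big
    step and bounding the truncated walk by a Chernoff argument, shows that for
    fixed k, M_k / N is close to W_k in L^1.  It remains to see that
    (M_n - M_k) / N is small for large k.  In M_{j+1} - M_j, children displaced by
    at most eps t_n contribute at most a multiple of N r^j in L^gamma with r < 1, by
    the von Bahr-Esseen inequality.  The contribution of the other children is at
    most 2 Fbar(eps t_n) in L^1 and a multiple of r^j in L^gamma; under (A5) the
    latter improves to a multiple of N r^j.  In case (I), - ln N = o(n), so the L^1
    bound is used for the O(- ln N) first generations and the L^gamma bound for the
    others.  In case (II) the L^gamma bound alone suffices and also bounds M_n / N in
    L^gamma, whence convergence in L^q for every q < gamma, and
    2 - 1 / gamma < gamma. *)
Require Import Defs.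
From HB Require Import structures.
From mathcomp Require Import all_boot all_order all_algebra.
From mathcomp Require Import all_classical all_reals all_analysis.
From mathcomp Require Import measurable_realfun ring lra.
Set Implicit Arguments. Unset Strict Implicit. Unset Printing Implicit Defensive.
Import Order.TTheory GRing.Theory Num.Theory.
Import numFieldNormedType.Exports.
Local Open Scope classical_set_scope.
Local Open Scope ring_scope.

(** * Tails of random walks *)

(** The threshold sqrt(p-2) is where Gaussian and one-jump effects balance: at tau = b sigma sqrt(n
    ln n) the former are about n^(-b^2/2), the latter n tau^(-p), that is n^(1-p/2) up to
    logarithms. As a^2 > p - 2 is strict, a little of a can be spent: a parent at most eps t_n above
    its mean position and a displacement at most eps t_n leave a deviation (1 - 2 eps) t_n to the
    remaining walk, so such a child counts for O(N). Parents further out are paid for by the factor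
    e^(-(g-1)V) that a g-th moment leaves, exponentially small in t_n.

    Neither the walk nor conditional expectations are constructed. Tails of the walk are
    convolutions defined by recursion, and bounds on them are inductions on the first step.
    Conditioning is replaced by independence of one offspring process from the sigma-algebra
    [away u] of all others; as generations may be infinite, the von Bahr-Esseen inequality runs
    vertex by vertex along an enumeration and is closed by Fatou's lemma.

    L^g bounds become L^1 bounds through |x| <= h + h^(1-g)|x|^g with h a small multiple of N, which
    turns order N^g into order N. *)

Section integrable_functions.
Context {d : measure_display} {T : measurableType d} {R : realType}.
Variable mu : probability T R.

Definition rintegrable (f : T -> R) := mu.-integrable setT (EFin \o f).

Lemma rintegrable_bounded (f : T -> R) (M : R) :
  measurable_fun setT f -> (forall x, 0 <= f x <= M) -> rintegrable f.
Proof.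
move=> mf fM; apply: measurable_bounded_integrable => //.
  by rewrite [X in (X < _)%E]probability_setT ltry.
exists M; split; first exact: num_real.
move=> K MK x _; have /andP[f0 fx] := fM x.
by rewrite /= ger0_norm// (le_trans fx)// ltW.
Qed.

Lemma rintegrable_cst (k : R) : rintegrable (fun=> k).
Proof.
apply: measurable_bounded_integrable => //.
  by rewrite [X in (X < _)%E]probability_setT ltry.
exists `|k|; split; first exact: num_real.
by move=> K MK x _; exact: ltW MK.
Qed.

Lemma rintegrableD f g : rintegrable f -> rintegrable g ->
  rintegrable (fun x => f x + g x).
Proof. by move=> fi gi; exact: (integrableD measurableT fi gi). Qed.

Lemma rintegrableB f g : rintegrable f -> rintegrable g ->
  rintegrable (fun x => f x - g x).
Proof. by move=> fi gi; exact: (integrableB measurableT fi gi). Qed.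

Lemma rintegrableZ k f : rintegrable f -> rintegrable (fun x => k * f x).
Proof. by move=> fi; exact: (integrableZl measurableT k fi). Qed.

Lemma rintD f g : rintegrable f -> rintegrable g ->
  \int[mu]_x (f x + g x) = \int[mu]_x f x + \int[mu]_x g x.
Proof. by move=> fi gi; exact: RintegralD. Qed.

Lemma rintB f g : rintegrable f -> rintegrable g ->
  \int[mu]_x (f x - g x) = \int[mu]_x f x - \int[mu]_x g x.
Proof. by move=> fi gi; exact: RintegralB. Qed.

Lemma rintZ k f : rintegrable f -> \int[mu]_x (k * f x) = k * \int[mu]_x f x.
Proof. by move=> fi; exact: RintegralZl. Qed.

Lemma rint_cst (k : R) : \int[mu]_x k = k.
Proof. by rewrite Rintegral_cst// [X in fine X]probability_setT mulr1. Qed.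

Lemma rint_le f g : rintegrable f -> rintegrable g ->
  (forall x, f x <= g x) -> \int[mu]_x f x <= \int[mu]_x g x.
Proof. by move=> fi gi fg; exact: le_Rintegral. Qed.

Lemma rint_ge0 (f : T -> R) : (forall x, 0 <= f x) -> 0 <= \int[mu]_x f x.
Proof. by move=> f0; exact: Rintegral_ge0. Qed.

Lemma rint_EFin f : rintegrable f ->
  (\int[mu]_x (f x)%:E)%E = (\int[mu]_x f x)%:E.
Proof. by move=> fi; rewrite /Rintegral fineK//; exact: integrable_fin_num. Qed.

Lemma rintegrable_ge0 (f : T -> R) : measurable_fun setT f ->
  (forall x, 0 <= f x) -> (\int[mu]_x (f x)%:E < +oo)%E -> rintegrable f.
Proof.
move=> mf f0 fi; apply/integrableP; split; first exact/measurable_EFinP.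
apply: le_lt_trans fi; apply: ge0_le_integral => //.
- by apply: measurableT_comp => //; exact/measurable_EFinP.
- exact/measurable_EFinP.
- by move=> x _; rewrite /= ger0_norm.
Qed.

End integrable_functions.

Ltac rint_tac := repeat first [exact: rintegrable_cst | assumption
  | apply: rintegrableB | apply: rintegrableD | apply: rintegrableZ ].

Section walk_tail.
Context {R : realType}.
Variable F : probability R R.

Definition tail (t : R) : R := \int[F]_y (t < y)%R%:R.

(* the probability that a random walk with step law F exceeds x at time n,
   each step y being weighted by g y *)
Fixpoint wtail (g : R -> R) (n : nat) (x : R) : R :=
  if n is m.+1 then \int[F]_y (g y * wtail g m (x - y)) else (x < 0)%R%:R.

Definition walk_tail := wtail (fun=> 1).
Definition trunc_tail (b : R) := wtail (fun y => (y <= b)%R%:R).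

Lemma measurable_gt_ind (b : R) : measurable_fun setT (fun y : R => (b < y)%R%:R : R).
Proof.
apply: nondecreasing_measurable => // x y xy.
by case: (ltP b x) => // bx; rewrite (lt_le_trans bx xy).
Qed.

Lemma measurable_le_ind (b : R) : measurable_fun setT (fun y : R => (y <= b)%R%:R : R).
Proof.
apply: nonincreasing_measurable => // x y xy.
by case: (leP y b) => // yb; rewrite (le_trans xy yb).
Qed.

Lemma ind_01 (b : bool) : 0 <= (b%:R : R) <= 1.
Proof. by case: b; rewrite ?lexx ler01. Qed.

Lemma rintegrable_gt_ind b : rintegrable F (fun y => (b < y)%R%:R).
Proof.
by apply: (@rintegrable_bounded _ _ _ _ _ 1) => [|x]; [exact: measurable_gt_ind|exact: ind_01].
Qed.

Lemma tail_01 t : 0 <= tail t <= 1.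
Proof.
apply/andP; split; first by apply: rint_ge0 => x; rewrite ler0n.
rewrite -[leRHS](rint_cst F); apply: rint_le => [||x].
- exact: rintegrable_gt_ind.
- exact: rintegrable_cst.
- by case: (_ < _); rewrite // ler01.
Qed.

Lemma tail_ge0 t : 0 <= tail t. Proof. by have /andP[] := tail_01 t. Qed.

Lemma tail_le s t : s <= t -> tail t <= tail s.
Proof.
move=> st; apply: rint_le => [||x]; try exact: rintegrable_gt_ind.
by case: (ltP t x) => // tx; rewrite (le_lt_trans st tx).
Qed.

Section weighted.
Variable g : R -> R.
Hypotheses (mg : measurable_fun setT g) (g01 : forall y, 0 <= g y <= 1).

Let wtail_spec n : nonincreasing_fun (wtail g n) /\ forall x, 0 <= wtail g n x <= 1.
Proof.
elim: n => [|n [IHm IH]] /=.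
  split=> [x y xy|x]; last exact: ind_01.
  by case: (ltP y 0) => // y0; rewrite (le_lt_trans xy y0).
have gw x y : 0 <= g y * wtail g n (x - y) <= 1.
  have /andP[g0 g1] := g01 y; have /andP[w0 w1] := IH (x - y).
  by rewrite mulr_ge0//= mulr_ile1.
have ib x : rintegrable F (fun y => g y * wtail g n (x - y)).
  apply: (@rintegrable_bounded _ _ _ _ _ 1) => //.
  apply: measurable_funM => //.
  apply: (@measurableT_comp _ _ _ _ _ _ (wtail g n)); last exact: measurable_funB.
  exact: nonincreasing_measurable.
split=> [x y xy|x].
  apply: rint_le => // z; have /andP[g0 _] := g01 z.
  by rewrite ler_wpM2l// IHm// lerB.
apply/andP; split; first by apply: rint_ge0 => y; have /andP[] := gw x y.
rewrite -[leRHS](rint_cst F); apply: rint_le => [//||y].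
  exact: rintegrable_cst.
by have /andP[] := gw x y.
Qed.

Lemma wtail_le n x y : x <= y -> wtail g n y <= wtail g n x.
Proof. by have [/(_ x y)] := wtail_spec n. Qed.

Lemma wtail_01 n x : 0 <= wtail g n x <= 1.
Proof. by have [_] := wtail_spec n. Qed.

Lemma measurable_wtail n : measurable_fun setT (wtail g n).
Proof. by apply: nonincreasing_measurable => // x y; exact: wtail_le. Qed.

Lemma measurable_wtailB n x : measurable_fun setT (fun y : R => wtail g n (x - y)).
Proof.
by apply: (measurableT_comp (measurable_wtail n)); exact: measurable_funB.
Qed.

Lemma rintegrable_wtail n x : rintegrable F (fun y => wtail g n (x - y)).
Proof.
by apply: (@rintegrable_bounded _ _ _ _ _ 1) => [|y]; [exact: measurable_wtailB|exact: wtail_01].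
Qed.

Lemma rintegrable_gwtail (h : R -> R) n x : measurable_fun setT h ->
  (forall y, 0 <= h y <= 1) -> rintegrable F (fun y => h y * wtail g n (x - y)).
Proof.
move=> mh h01; apply: (@rintegrable_bounded _ _ _ _ _ 1) => [|y].
  by apply: measurable_funM => //; exact: measurable_wtailB.
have /andP[h0 h1] := h01 y; have /andP[w0 w1] := wtail_01 n (x - y).
by rewrite mulr_ge0//= mulr_ile1.
Qed.

End weighted.

Let m1 : measurable_fun setT (fun=> 1 : R) := @measurable_cst _ _ R R setT 1.

Let one01 (y : R) : 0 <= (1 : R) <= 1. Proof. by rewrite ler01 lexx. Qed.
Lemma walk_tail_01 n x : 0 <= walk_tail n x <= 1. Proof. exact: wtail_01. Qed.
Lemma walk_tail_ge0 n x : 0 <= walk_tail n x.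
Proof. by have /andP[] := walk_tail_01 n x. Qed.
Lemma walk_tail_le1 n x : walk_tail n x <= 1.
Proof. by have /andP[] := walk_tail_01 n x. Qed.
Lemma walk_tail_le n x y : x <= y -> walk_tail n y <= walk_tail n x.
Proof. exact: wtail_le. Qed.
Lemma measurable_walk_tail n : measurable_fun setT (walk_tail n).
Proof. exact: measurable_wtail. Qed.
Lemma rintegrable_walk_tail n x : rintegrable F (fun y => walk_tail n (x - y)).
Proof. exact: rintegrable_wtail. Qed.

Lemma walk_tailS n x : walk_tail n.+1 x = \int[F]_y walk_tail n (x - y).
Proof. by rewrite /walk_tail/=; apply: eq_Rintegral => y _; rewrite mul1r. Qed.

Lemma trunc_tail_01 b n x : 0 <= trunc_tail b n x <= 1.
Proof. by apply: wtail_01 => [|y]; [exact: measurable_le_ind|exact: ind_01]. Qed.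

Lemma rintegrable_trunc_tail b n x :
  rintegrable F (fun y => (y <= b)%R%:R * trunc_tail b n (x - y)).
Proof.
by apply: rintegrable_gwtail => *; first [exact: measurable_le_ind | exact: ind_01].
Qed.

(* Either a step exceeds b1, or all steps are at most b0, or some step lies in
   (b0, b1] and the others sum to more than x - b1. *)
Lemma walk_tail_ub (b0 b1 : R) n x :
  walk_tail n x <= n%:R * tail b1 + trunc_tail b0 n x
                   + n%:R * tail b0 * walk_tail n.-1 (x - b1).
Proof.
elim: n x => [|n IH] x; first by rewrite !mul0r add0r addr0.
set K := n%:R * tail b0.
(* For [n = 0] the predecessor [n.-1] is a default value, harmless because [K] is 0; for a successor
   this is one convolution step. *)
have EK : K * walk_tail n (x - b1) = \int[F]_y (K * walk_tail n.-1 (x - b1 - y)).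
  rewrite /K; case: n {IH K} => [|n]; last by rewrite (rintZ (mu:=F))//; [rewrite walk_tailS|exact: rintegrable_walk_tail].
  rewrite /= !mul0r; under eq_Rintegral do rewrite mul0r.
  by rewrite rint_cst.
have i1 := rintegrable_gt_ind b1; have i2 := rintegrable_gt_ind b0.
have i3 := rintegrable_trunc_tail b0 n x.
have i4 := rintegrable_walk_tail n.-1 (x - b1).
have i5 := rintegrable_walk_tail n x.
(* Pointwise bound in the first step [y]: the first indicator pays for [y > b1], the second for [y]
   in (b0, b1], where monotonicity puts [x - b1] in place of [x - y], and the induction hypothesis
   covers [y <= b0]. The second and the last summand integrate to n+1 copies of
   [tail b0 * walk_tail n (x - b1)]. *)
suff : walk_tail n.+1 x <= \int[F]_y ((b1 < y)%R%:R + walk_tail n (x - b1) * (b0 < y)%R%:R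
   + (n%:R * tail b1 + (y <= b0)%R%:R * trunc_tail b0 n (x - y)
      + K * walk_tail n.-1 (x - b1 - y))).
  do 4! (rewrite (rintD (mu:=F)); [|by rint_tac|by rint_tac]).
  rewrite -EK rintZ// rint_cst -/(tail b1) -/(tail b0).
  have -> : \int[F]_y ((y <= b0)%R%:R * trunc_tail b0 n (x - y)) = trunc_tail b0 n.+1 x by [].
  rewrite /K -natr1 [n.+1.-1]/=; lra.
rewrite walk_tailS; apply: rint_le => [//||y]; first by rint_tac.
have := walk_tail_le1 n (x - y); have := walk_tail_ge0 n (x - y).
have := walk_tail_ge0 n (x - b1).
have /andP[t0 _] := trunc_tail_01 b0 n (x - y).
have K0 : 0 <= K by rewrite mulr_ge0// tail_ge0.
have Q0 : 0 <= n%:R * tail b1 by rewrite mulr_ge0// tail_ge0.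
have h0 : 0 <= K * walk_tail n.-1 (x - b1 - y) by rewrite mulr_ge0// walk_tail_ge0.
have := IH (x - y); rewrite -/K (_ : x - y - b1 = x - b1 - y); last by lra.
case: (ltP b1 y) => b1y; case: (ltP b0 y) => b0y /=; rewrite ?mulr0 ?mulr1 ?mul0r ?mul1r; try lra.
by have := @walk_tail_le n (x - b1) (x - y); rewrite lerB// => /(_ isT); lra.
Qed.

(* One step exceeds b while the others reach x - b; the corrections come from
   counting at most once the events in which two steps exceed b. *)
Lemma walk_tail_lb (b : R) n x :
  n%:R * tail b * (walk_tail n.-1 (x - b) - n%:R * tail b) <= walk_tail n x.
Proof.
elim: n x => [|n IH] x; first by rewrite !mul0r walk_tail_ge0.
set K := n%:R * tail b.
have K0 : 0 <= K by rewrite mulr_ge0// tail_ge0.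
have EK : K * walk_tail n (x - b) = \int[F]_y (K * walk_tail n.-1 (x - b - y)).
  rewrite /K; case: n {IH K K0} => [|n]; last by rewrite (rintZ (mu:=F))//; [rewrite walk_tailS|exact: rintegrable_walk_tail].
  rewrite /= !mul0r; under eq_Rintegral do rewrite mul0r.
  by rewrite rint_cst.
have i1 := rintegrable_gt_ind b.
have i4 := rintegrable_walk_tail n.-1 (x - b).
have i5 := rintegrable_walk_tail n x.
(* For [y > b] the induction hypothesis is discarded: the term [- K] outweighs [K * walk_tail], and
   only [walk_tail n (x - b)] is kept. After integration the loss is n(n+1) times the square of
   [tail b], below the factor (n+1)^2 allowed. *)
suff : \int[F]_y (walk_tail n (x - b) * (b < y)%R%:R
   + (K * walk_tail n.-1 (x - b - y) + (- (K * K) + (- K) * (b < y)%R%:R))) <= walk_tail n.+1 x.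
  do 3! (rewrite (rintD (mu:=F)); [|by rint_tac|by rint_tac]).
  rewrite -EK !rintZ// rint_cst -/(tail b) /=.
  rewrite /K -natr1; have := sqr_ge0 (tail b).
  set q := tail b; set h := walk_tail n _; set m := n%:R.
  have m0 : 0 <= m by rewrite /m.
  by move=> qq; have := mulr_ge0 m0 qq; rewrite !expr2; nra.
rewrite walk_tailS; apply: rint_le => [|//|y]; first by rint_tac.
have := walk_tail_ge0 n (x - y).
have := IH (x - y); rewrite -/K (_ : x - y - b = x - b - y); last by lra.
have h1 := walk_tail_le1 n.-1 (x - b - y).
have Kh : K * walk_tail n.-1 (x - b - y) <= K by rewrite ler_piMr.
have KK : 0 <= K * K by rewrite mulr_ge0.
case: (ltP b y) => bY; rewrite ?mulr0 ?mulr1; last by lra.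
by have := @walk_tail_le n _ _ (lerB (lexx x) (ltW bY)); lra.
Qed.

End walk_tail.

Section taylor.
Context {R : realType}.

(** Second-order Taylor expansion with the largest value e^h of the second derivative on (-oo, h].
    The difference of the two sides vanishes at 0, and on (-oo, h] its derivative has the sign of
    its argument; for negative arguments this uses e^h >= 1. *)
Lemma expR_le_taylor (h u : R) : 0 <= h -> u <= h ->
  expR u <= 1 + u + u ^+ 2 * expR h / 2.
Proof.
move=> h0 uh; set K := expR h.
have K1 : 1 <= K by rewrite /K -expR0 ler_expR.
pose f (x : R) : R := 1 + x + x ^+ 2 * (K / 2) - expR x.
pose df (x : R) : R := 1 + x * K - expR x.
have fE (x : R) : is_derive x 1 f (df x).
  rewrite /f; apply: is_derive_eq.
  rewrite /df /GRing.scale/=; by field.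
have cf (i : interval R) : {within [set` i], continuous f}.
  apply: derivable_within_continuous => z zi.
  by have [] := fE z.
have f0 : f 0 = 0 by rewrite /f expR0 expr0n /= mul0r; lra.
suff : 0 <= f u by rewrite /f; lra.
have [u0|u0] := leP 0 u.
  have [x] := MVT_segment u0 (fun x _ => fE x) (cf _).
  rewrite in_itv/= f0 !subr0 => /andP[x0 xu] ->; rewrite mulr_ge0//.
  have : expR x <= K by rewrite ler_expR (le_trans xu).
  have := expR_ge1Dx (- x); have := expR_gt0 x; rewrite expRN => e0.
  rewrite -(ler_pM2r e0) mulVf ?gt_eqF// /df => e1 e2.
  have : x * expR x <= x * K by rewrite ler_wpM2l.
  lra.
have [x] := MVT_segment (ltW u0) (fun x _ => fE x) (cf _).
rewrite in_itv/= f0 !sub0r => /andP[ux x0] fu.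
have -> : f u = (- df x) * (- u) by rewrite mulNr -fu opprK.
rewrite mulr_ge0 ?oppr_ge0 ?(ltW u0)// /df.
have := expR_ge1Dx x.
have : x * K <= x * 1 by rewrite ler_wnM2l.
lra.
Qed.

End taylor.

(** * Chebyshev and Chernoff bounds for the walk *)

Section walk_moments.
Context {R : realType}.
Variable F : probability R R.

Definition rmean : R := \int[F]_y y.
Definition rvar : R := \int[F]_y (y - rmean) ^+ 2.

Hypotheses (i1 : rintegrable F (fun y => y)) (i2 : rintegrable F (fun y => y ^+ 2)).

Lemma rintegrable_dev : rintegrable F (fun y => y - rmean).
Proof. by rint_tac. Qed.

Lemma rintegrable_dev2 : rintegrable F (fun y => (y - rmean) ^+ 2).
Proof.
have h1 := i1; have h2 := i2.
have -> : (fun y => (y - rmean) ^+ 2) =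
  (fun y => y ^+ 2 + ((- (2 * rmean)) * y + rmean ^+ 2)).
  by apply/funext => y; ring.
by rint_tac.
Qed.

Lemma rint_dev : \int[F]_y (y - rmean) = 0.
Proof.
have h1 := i1.
by rewrite (rintD (mu:=F))// ?rint_cst ?subrr//; rint_tac.
Qed.

Lemma rint_quad (a b k : R) :
  \int[F]_y (a + (b * (y - rmean) + k * (y - rmean) ^+ 2)) = a + k * rvar.
Proof.
have h1 := rintegrable_dev; have h2 := rintegrable_dev2.
rewrite (rintD (mu:=F)); [|by rint_tac|by rint_tac].
rewrite (rintD (mu:=F)); [|by rint_tac|by rint_tac].
by rewrite !(rintZ (mu:=F))// rint_cst rint_dev mulr0 add0r.
Qed.

Lemma rintegrable_quad (a b k : R) :
  rintegrable F (fun y => a + (b * (y - rmean) + k * (y - rmean) ^+ 2)).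
Proof.
by have h1 := rintegrable_dev; have h2 := rintegrable_dev2; rint_tac.
Qed.

(** The indicator of S_n > x is dominated by lam^2 (S_n - z)^2, whose expectation is the right-hand
    side. The free centre [z] makes the induction close: a first step [y] moves both [x] and [z] by
    [y]. *)
Lemma walk_tail_chebyshev n (lam x z : R) : 0 <= lam -> 1 <= lam * (x - z) ->
  walk_tail F n x <= lam ^+ 2 * (n%:R * rvar + (n%:R * rmean - z) ^+ 2).
Proof.
move=> l0; elim: n x z => [|n IH] x z lx.
  rewrite /walk_tail /= !mul0r add0r sub0r sqrrN -exprMn.
  case: (ltP x 0) => x0; last exact: sqr_ge0.
  have lx0 : lam * x <= 0 by rewrite mulr_ge0_le0// ltW.
  have h : 1 <= - (lam * z) by lra.
  by rewrite -[leRHS]sqrrN -[leLHS](expr1n _ 2) lerXn2r// nnegrE; lra.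
rewrite walk_tailS.
have -> : lam ^+ 2 * (n.+1%:R * rvar + (n.+1%:R * rmean - z) ^+ 2) =
  lam ^+ 2 * (n%:R * rvar + (n.+1%:R * rmean - z) ^+ 2) + lam ^+ 2 * rvar.
  by rewrite -natr1; ring.
rewrite -(rint_quad _ (lam ^+ 2 * (2 * (n.+1%:R * rmean - z)))).
apply: rint_le => [||y]; [exact: rintegrable_walk_tail|exact: rintegrable_quad|].
have lxy : 1 <= lam * (x - y - (z - y)) by rewrite (_ : _ - _ = x - z)//; lra.
apply: (le_trans (IH _ _ lxy)); rewrite -natr1 le_eqVlt; apply/orP; left.
by apply/eqP; ring.
Qed.

Lemma walk_tail_chebyshev_low n (lam x z : R) : 0 <= lam -> 1 <= lam * (z - x) ->
  1 - walk_tail F n x <= lam ^+ 2 * (n%:R * rvar + (n%:R * rmean - z) ^+ 2).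
Proof.
move=> l0; elim: n x z => [|n IH] x z lx.
  rewrite /walk_tail /= !mul0r add0r sub0r sqrrN -exprMn.
  case: (ltP x 0) => x0; first by rewrite subrr sqr_ge0.
  have lx0 : 0 <= lam * x by rewrite mulr_ge0.
  have h : 1 <= lam * z by lra.
  by rewrite subr0 -[leLHS](expr1n _ 2) lerXn2r// nnegrE; lra.
have iw := rintegrable_walk_tail F n x.
have -> : 1 - walk_tail F n.+1 x = \int[F]_y (1 - walk_tail F n (x - y)).
  rewrite (rintB (mu:=F))//. 2: by rint_tac.
  by rewrite rint_cst walk_tailS.
have -> : lam ^+ 2 * (n.+1%:R * rvar + (n.+1%:R * rmean - z) ^+ 2) =
  lam ^+ 2 * (n%:R * rvar + (n.+1%:R * rmean - z) ^+ 2) + lam ^+ 2 * rvar.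
  by rewrite -natr1; ring.
rewrite -(rint_quad _ (lam ^+ 2 * (2 * (n.+1%:R * rmean - z)))).
apply: rint_le => [||y]; [by rint_tac|exact: rintegrable_quad|].
have lxy : 1 <= lam * (z - y - (x - y)) by rewrite (_ : _ - _ = z - x)//; lra.
apply: (le_trans (IH _ _ lxy)); rewrite -natr1 le_eqVlt; apply/orP; left.
by apply/eqP; ring.
Qed.

Definition trunc_mgf (b l : R) : R := \int[F]_y ((y <= b)%R%:R * expR (l * y)).

Lemma rintegrable_mgf (b l k : R) : 0 <= l ->
  rintegrable F (fun y => (y <= b)%R%:R * expR (l * y + k)).
Proof.
move=> l0; apply: (@rintegrable_bounded _ _ _ _ _ (expR (l * b + k))) => [|y].
  apply: measurable_funM; first exact: measurable_le_ind.
  by apply: measurableT_comp => //; apply: measurable_funD.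
rewrite mulr_ge0 ?ler0n ?expR_ge0//=.
case: (leP y b) => yb; rewrite ?mul1r ?mul0r ?expR_ge0// ler_expR lerD2r.
by rewrite ler_wpM2l.
Qed.

Lemma trunc_mgf_ge0 b l : 0 <= trunc_mgf b l.
Proof. by apply: rint_ge0 => y; rewrite mulr_ge0 ?ler0n ?expR_ge0. Qed.

(** Markov's inequality for e^(l S_n). The truncation at [b] keeps the moment generating function
    finite although [F] is not assumed to have exponential moments on the right. *)
Lemma trunc_tail_chernoff (b l : R) n (x : R) : 0 <= l ->
  trunc_tail F b n x <= expR (- (l * x)) * trunc_mgf b l ^+ n.
Proof.
move=> l0; elim: n x => [|n IH] x.
  rewrite /trunc_tail /= mulr1; case: (ltP x 0) => x0; rewrite ?expR_ge0//.
  by rewrite -expR0 ler_expR oppr_ge0 mulr_ge0_le0// ltW.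
have ie : rintegrable F (fun y => (y <= b)%R%:R * expR (l * y)).
  by have := rintegrable_mgf b 0 l0; under eq_fun do rewrite addr0.
have -> : expR (- (l * x)) * trunc_mgf b l ^+ n.+1 =
    \int[F]_y (expR (- (l * x)) * trunc_mgf b l ^+ n * ((y <= b)%R%:R * expR (l * y))).
  by rewrite (rintZ (mu:=F))// exprSr mulrA.
apply: rint_le => [||y]; [exact: rintegrable_trunc_tail|by rint_tac|].
case: (leP y b) => yb; rewrite ?mul1r ?mul0r ?mulr0//.
have /le_trans := IH (x - y); apply.
rewrite mulrAC -expRD ler_wpM2r// ?exprn_ge0 ?trunc_mgf_ge0// ler_expR; lra.
Qed.

(* Steps beyond h / l carry no exponential moment: they are charged to the tail. *)
Lemma trunc_mgf_le (B h l : R) : 0 < l -> 0 <= h ->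
  trunc_mgf (rmean + B) l <= expR (l * rmean +
    (l ^+ 2 * rvar * expR h / 2 + expR (l * B) * tail F (rmean + h / l))).
Proof.
move=> l0 h0.
set K := l ^+ 2 * expR h / 2.
have K0 : 0 <= K by rewrite /K divr_ge0// mulr_ge0 ?sqr_ge0 ?expR_ge0.
suff : expR (- (l * rmean)) * trunc_mgf (rmean + B) l <=
    1 + (K * rvar + expR (l * B) * tail F (rmean + h / l)).
  move=> /le_trans/(_ (expR_ge1Dx _)); rewrite expRN.
  rewrite ler_pdivrMl ?expR_gt0// -expRD => /le_trans; apply.
  by rewrite ler_expR /K; lra.
have ie : rintegrable F (fun y => (y <= rmean + B)%R%:R * expR (l * y)).
  by have := rintegrable_mgf (rmean + B) 0 (ltW l0); under eq_fun do rewrite addr0.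
have ig := rintegrable_gt_ind F (rmean + h / l).
have iq := rintegrable_quad 1 l K.
have -> : 1 + (K * rvar + expR (l * B) * tail F (rmean + h / l)) =
   \int[F]_y (1 + (l * (y - rmean) + K * (y - rmean) ^+ 2) +
     expR (l * B) * (rmean + h / l < y)%R%:R).
  by rewrite (rintD (mu:=F))//; [rewrite rint_quad rintZ// addrA|rint_tac].
rewrite -(rintZ (mu:=F))//; apply: rint_le => [||y]; [by rint_tac|by rint_tac|].
have -> : expR (- (l * rmean)) * ((y <= rmean + B)%R%:R * expR (l * y)) =
   (y <= rmean + B)%R%:R * expR (l * (y - rmean)).
  by rewrite mulrCA -expRD; congr (_ * expR _); ring.
set u := l * (y - rmean).
have -> : K * (y - rmean) ^+ 2 = u ^+ 2 * expR h / 2 by rewrite /K /u; ring.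
have e1 : 1 <= expR h by rewrite -expR0 ler_expR.
(* Where [y] exceeds the truncation level the left side is 0, so the quadratic alone must be
   nonnegative; it is at least 1 + u + u^2/2 = ((u + 1)^2 + 1)/2. *)
have q0 : 0 <= 1 + (u + u ^+ 2 * expR h / 2).
  have : u ^+ 2 * 1 <= u ^+ 2 * expR h by rewrite ler_wpM2l// sqr_ge0.
  by have := sqr_ge0 (u + 1); rewrite sqrrD expr1n !mulr1; lra.
have [yh|yh] := ltP (rmean + h / l) y; rewrite ?mulr1 ?mulr0 ?addr0.
  case: (leP y (rmean + B)) => yB; rewrite ?mul0r ?mul1r; last first.
    by rewrite addr_ge0// expR_ge0.
  by rewrite ler_wpDl// ler_expR /u ler_wpM2l ?(ltW l0)//; lra.
have uh : u <= h.
  by rewrite /u mulrC -ler_pdivlMr//; lra.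
case: (leP y (rmean + B)) => yB; rewrite ?mul0r ?mul1r//.
by rewrite addrA; exact: expR_le_taylor.
Qed.

End walk_moments.

Section elementary.
Context {R : realType}.

Lemma le_expR_eventually (k eta : R) : 0 < k -> 0 < eta ->
  exists t0, forall t, t0 <= t -> t <= eta * expR (k * t).
Proof.
move=> k0 e0; exists (Num.max 0 (2 / (eta * k ^+ 2))) => t.
rewrite ge_max => /andP[t0 ht].
have := expR_ge1Dxn 1 (mulr_ge0 (ltW k0) t0).
have k2 : 0 < eta * k ^+ 2 by rewrite mulr_gt0// exprn_gt0.
have h : t * (2 / (eta * k ^+ 2)) <= t * t by rewrite ler_wpM2l.
move=> h2; have {h2} : eta * ((k * t) ^+ 2 / 2) <= eta * expR (k * t).
  by rewrite ler_pM2l//; move: h2; rewrite (_ : 2`!%:R = 2 :> R)//; lra.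
apply: le_trans.
have : t * 2 <= t * t * (eta * k ^+ 2) by rewrite -ler_pdivrMr// -mulrA.
by rewrite exprMn; lra.
Qed.

Lemma nat_gt (x : R) : exists n0 : nat, forall n, (n0 <= n)%N -> x < n%:R.
Proof.
exists (Num.truncn (Num.max x 0)).+1 => n hn.
have /truncn_itv/andP[_ h] : 0 <= Num.max x 0 by rewrite le_max lexx orbT.
rewrite (@le_lt_trans _ _ (Num.max x 0))// ?le_max ?lexx//.
by rewrite (lt_le_trans h)// ler_nat.
Qed.

Lemma pow_gt0_inv (s : R) : 0 < s -> expR (- s) < 1.
Proof. by move=> s0; rewrite expR_lt1 oppr_lt0. Qed.

Lemma nneseries_geo_le (u : nat -> \bar R) (a r : R) : 0 <= a -> 0 < r -> r < 1 ->
  (forall k, 0 <= u k)%E -> (forall k, u k <= (a * r ^+ k)%:E)%E ->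
  (\sum_(0 <= k <oo) u k <= (a / (1 - r))%:E)%E.
Proof.
move=> a0 r0 r1 u0 ur.
apply: lime_le; first exact: is_cvg_nneseries.
apply: nearW => n.
apply: (@le_trans _ _ (\sum_(0 <= k < n) a * r ^+ k)%:E).
  by rewrite -sumEFin; apply: lee_sum => k _.
rewrite lee_fin ler_pdivlMr ?subr_gt0//.
elim: n => [|n IH]; first by rewrite big_geq// mul0r.
have -> : \sum_(0 <= k < n.+1) a * r ^+ k = a + r * \sum_(0 <= k < n) a * r ^+ k.
  rewrite big_nat_recl//= expr0 mulr1 mulr_sumr; congr (_ + _).
  by apply: eq_bigr => k _; rewrite exprS; ring.
have : r * ((\sum_(0 <= k < n) a * r ^+ k) * (1 - r)) <= r * a by rewrite ler_pM2l.
lra.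
Qed.

End elementary.

(** * Regularly varying tails between two powers *)

Section regular_variation.
Context {R : realType}.

(** Positivity is asked at every point and not only eventually; a nonincreasing function that is
    eventually positive has it. *)
Definition regvar (Q : R -> R) (p : R) := (forall t, 0 < Q t) /\
  forall lam : R, 0 < lam -> Q (lam * t) / Q t @[t --> +oo] --> lam `^ (- p).

Variables (Q : R -> R) (p : R).
Hypotheses (Qni : forall s t, s <= t -> Q t <= Q s) (Q1 : forall t, Q t <= 1).
Hypothesis rv : regvar Q p.

Lemma regvar_le (lam k : R) : 0 < lam -> lam `^ (- p) < k ->
  exists t0, forall t, t0 <= t -> Q (lam * t) <= k * Q t.
Proof.
have [Q0 Qc] := rv.
move=> l0 lk; move: (Qc _ l0) => /cvgr_le /(_ _ lk) [M [_ HM]].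
exists (M + 1) => t Mt.
by rewrite -ler_pdivrMr// HM// (lt_le_trans _ Mt)// ltrDl.
Qed.

Lemma regvar_ge (lam k : R) : 0 < lam -> k < lam `^ (- p) ->
  exists t0, forall t, t0 <= t -> k * Q t <= Q (lam * t).
Proof.
have [Q0 Qc] := rv.
move=> l0 lk; move: (Qc _ l0) => /cvgr_ge /(_ _ lk) [M [_ HM]].
exists (M + 1) => t Mt.
by rewrite -ler_pdivlMr// HM// (lt_le_trans _ Mt)// ltrDl.
Qed.

Let expD (th : R) : expR (th + 1) = expR 1 * expR th.
Proof. by rewrite -expRD addrC. Qed.

Let e1p : expR 1 `^ (- p) = expR (- p). Proof. by rewrite -expRM mul1r. Qed.

Let eventually_exp (P : R -> Prop) : (exists t0, forall t, t0 <= t -> P t) ->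
  exists th0, forall th, th0 <= th -> P (expR th).
Proof.
move=> [t0 H]; exists t0 => th h; apply: H.
by rewrite (le_trans h)// (le_trans _ (expR_ge1Dx th))// lerDr.
Qed.

(** Potter bound on the logarithmic scale: Q(e t) <= e^(-s) Q(t), valid from some point on, is
    iterated along integer steps, and monotonicity fills the gaps. Every [th] is allowed because
    [Q <= 1] settles the range below that point. *)
Lemma tail_exp_ub s : 0 < s -> s < p ->
  exists2 C, 0 < C & forall th, Q (expR th) <= C * expR (- s * th).
Proof.
move=> s0 sp; have [Q0 _] := rv.
have [th0 H] : exists th0, forall th, th0 <= th -> Q (expR (th + 1)) <= expR (- s) * Q (expR th).
  have [|th0 H] := eventually_exp (@regvar_le (expR 1) (expR (- s)) (expR_gt0 _) _).
    by rewrite e1p ltr_expR ltrN2.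
  by exists th0 => th /H; rewrite expD.
have {}H k : Q (expR (th0 + k%:R)) <= expR (- s * k%:R).
  elim: k => [|k IH]; first by rewrite mulr0 expR0 Q1.
  rewrite -natr1 addrA; apply: (le_trans (H _ _)); first by rewrite lerDl.
  by rewrite mulrDr mulr1 [leRHS]expRD mulrC ler_pM2r ?expR_gt0.
(* The factor absorbs both the range below [th0] and the loss of one unit when [th - th0] is rounded
   down. *)
exists (expR (s * (`|th0| + 1))); first exact: expR_gt0.
move=> th; rewrite -expRD.
have t0 := ler_norm th0.
have [th1|th1] := leP th th0.
  rewrite (le_trans (Q1 _))// -[leLHS]expR0 ler_expR.
  have : s * th <= s * (`|th0| + 1) by rewrite ler_wpM2l ?(ltW s0)//; lra.
  lra.
have /truncn_itv/andP[k1 k2] : 0 <= th - th0 by rewrite subr_ge0 ltW.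
set k := Num.truncn _ in k1 k2.
rewrite (@le_trans _ _ (Q (expR (th0 + k%:R))))//.
  by apply: Qni; rewrite ler_expR; lra.
apply: (le_trans (H k)); rewrite ler_expR.
rewrite -natr1 in k2.
have : s * (th - th0 - 1) <= s * k%:R by rewrite ler_wpM2l ?(ltW s0)//; lra.
have : s * th0 <= s * `|th0| by rewrite ler_wpM2l// ltW.
lra.
Qed.

Lemma tail_exp_lb u : 0 < u -> p < u ->
  exists2 c, 0 < c & exists th0, forall th, th0 <= th ->
    c * expR (- u * th) <= Q (expR th).
Proof.
move=> u0 pu; have [Q0 _] := rv.
have [th0 H] : exists th0, forall th, th0 <= th -> expR (- u) * Q (expR th) <= Q (expR (th + 1)).
  have [|th0 H] := eventually_exp (@regvar_ge (expR 1) (expR (- u)) (expR_gt0 _) _).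
    by rewrite e1p ltr_expR ltrN2.
  by exists th0 => th /H; rewrite expD.
have {}H k : expR (- u * k%:R) * Q (expR th0) <= Q (expR (th0 + k%:R)).
  elim: k => [|k IH]; first by rewrite mulr0 expR0 mul1r addr0.
  rewrite -natr1 addrA; apply: (le_trans _ (H _ _)); last by rewrite lerDl.
  by rewrite mulrDr mulr1 [X in X * _ <= _]expRD mulrAC mulrC ler_pM2l ?expR_gt0.
exists (expR (- u * (1 - th0)) * Q (expR th0)); first by rewrite mulr_gt0// expR_gt0.
exists th0 => th th1.
have /truncn_itv/andP[k1 k2] : 0 <= th - th0 by rewrite subr_ge0.
set k := Num.truncn _ in k1 k2.
rewrite -natr1 in k2.
(* Rounding up this time: a lower bound for a nonincreasing function has to be taken to the right of
   [th]. *)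
rewrite (@le_trans _ _ (Q (expR (th0 + k.+1%:R))))//; last first.
  by apply: Qni; rewrite ler_expR -natr1; lra.
apply: (le_trans _ (H k.+1)); rewrite mulrAC -expRD ler_pM2r// ler_expR -natr1.
have : u * k%:R <= u * (th - th0) by rewrite ler_wpM2l ?(ltW u0)//; lra.
lra.
Qed.

End regular_variation.

Section second_moment.
Context {R : realType}.
Variable F : probability R R.

(** Only the right half of the second moment is governed by the regular variation of the tail; the
    left half will come from the exponential moment m(g). *)
Definition pos_sqr (y : R) : R := Num.max y 0 ^+ 2.

Lemma pos_sqr_integral_lty (p : R) : 2 < p -> regvar (tail F) p ->
  (\int[F]_y (pos_sqr y)%:E < +oo)%E.
Proof.
move=> p2 rv; set s := (2 + p) / 2.
have s2 : 2 < s by rewrite /s; lra.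
have [||C C0 QC] := tail_exp_ub (@tail_le _ F) (fun t => proj2 (andP (tail_01 F t))) rv (s := s).
  by lra.
  by rewrite /s; lra.
(* On the shell where ln y lies in [k, k+1), y^2 <= e^(2(k+1)). The indicator starts one unit lower,
   at e^(k-1), so that its strict inequality also holds at the left end of the shell. *)
pose u (k : nat) : R -> \bar R := fun y =>
  (expR (2 * (k%:R + 1)) * (expR (k%:R - 1) < y)%R%:R)%:E.
have u0 k y : (0 <= u k y)%E by rewrite lee_fin mulr_ge0 ?expR_ge0.
have mu k : measurable_fun setT (u k).
  by apply/measurable_EFinP; apply: measurable_funM => //; exact: measurable_gt_ind.
have pw (y : R) : ((pos_sqr y)%:E <= 1 + \sum_(0 <= k <oo) u k y)%E.
  have s0 : (0 <= \sum_(0 <= k <oo) u k y)%E by apply: nneseries_ge0.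
  have [y1|y1] := leP y 1.
    apply: (@le_trans _ _ 1%R%:E); last by rewrite leeDl.
    suff : pos_sqr y <= 1 by [].
    rewrite /pos_sqr -[leRHS](expr1n _ 2) lerXn2r// ?nnegrE ?le_max ?lexx ?orbT//.
    by rewrite ge_max y1 ler01.
  have y0 : 0 < y by rewrite (lt_trans _ y1).
  have /truncn_itv/andP[k1 k2] : 0 <= ln y by apply: ln_ge0; exact: ltW.
  set k := Num.truncn _ in k1 k2.
  have le1 : ((pos_sqr y)%:E <= u k y)%E.
    have ey : expR (ln y) = y by rewrite lnK// posrE.
    rewrite /u -{2}ey ltr_expR (_ : _ < _ = true) ?mulr1; last by apply/idP; lra.
    rewrite /pos_sqr max_l ?(ltW y0)// -{1}ey lee_fin -expRM_natl ler_expR ler_pM2l// natr1.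
    exact: ltW.
  apply: (le_trans le1); apply: (@le_trans _ _ (\sum_(0 <= k <oo) u k y)%E); last first.
    by rewrite leeDr// lee_fin ler01.
  apply: (le_trans _ (nneseries_lim_ge k.+1 _)) => //.
  by rewrite big_nat_recr//= leeDr// sume_ge0.
apply: (@le_lt_trans _ _ (\int[F]_y (1 + \sum_(0 <= k <oo) u k y))%E).
  apply: ge0_le_integral => //.
  - by move=> y _; rewrite lee_fin sqr_ge0.
  - apply/measurable_EFinP; apply: measurable_funX; exact: measurable_maxr.
  - by apply: emeasurable_funD => //; apply: ge0_emeasurable_sum.
rewrite ge0_integralD//; last 2 first.
- by move=> y _; exact: nneseries_ge0.
- exact: ge0_emeasurable_sum.
rewrite integral_cst// mul1e [X in (X + _)%E]probability_setT.
rewrite integral_nneseries//.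
have r1 := @pow_gt0_inv R (s - 2).
have Iu k : (\int[F]_y u k y = (expR (2 * (k%:R + 1)) * tail F (expR (k%:R - 1)))%:E)%E.
  rewrite /u rint_EFin; last by apply: rintegrableZ; exact: rintegrable_gt_ind.
  by rewrite rintZ//; exact: rintegrable_gt_ind.
apply: (@le_lt_trans _ _ (1 + (C * expR (2 + s) / (1 - expR (- (s - 2))))%:E)%E); last first.
  by rewrite -EFinD ltry.
rewrite leeD2l//; apply: nneseries_geo_le.
- by rewrite mulr_ge0 ?expR_ge0// ltW.
- exact: expR_gt0.
- by apply: r1; lra.
- by move=> k; apply: integral_ge0 => y _.
- move=> k; rewrite Iu lee_fin.
  apply: (le_trans (ler_wpM2l (expR_ge0 _) (QC _))).
  rewrite mulrCA -!mulrA ler_pM2l// -expRM_natl -!expRD ler_expR; lra.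
Qed.

End second_moment.

(** * Precise large deviations *)

Section large_deviations.
Context {R : realType}.
Variables (F : probability R R) (p b : R).
Hypotheses (i1 : rintegrable F (fun y => y)) (i2 : rintegrable F (fun y => y ^+ 2)).
Hypotheses (p2 : 2 < p) (rv : regvar (tail F) p) (c0 : 0 <= rmean F).
Hypotheses (b0 : 0 < b) (bp : p - 2 < b ^+ 2).

Let c := rmean F.
Let v := rvar F.
Let Q := tail F.

Let Q0 t : 0 < Q t. Proof. by have [h _] := rv; exact: h. Qed.

(** [F] charges (c + 1, oo), where the squared deviation is at least 1. *)
Lemma rvar_gt0 : 0 < v.
Proof.
apply: lt_le_trans (Q0 (c + 1)) _.
apply: rint_le => [||y]; [exact: rintegrable_gt_ind|exact: rintegrable_dev2|].
case: ltP => yc; last exact: sqr_ge0.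
rewrite -[leLHS](expr1n _ 2) lerXn2r// ?nnegrE// -/c; lra.
Qed.

Definition ldscale (n : nat) : R := b * Num.sqrt v * Num.sqrt (n%:R * ln n%:R).

Lemma ldscale_large (A : R) : exists n0 : nat, forall n (tau : R), (n0 <= n)%N ->
  ldscale n <= tau -> [/\ A <= ln tau, 0 < tau, n%:R <= tau ^+ 2,
    b ^+ 2 * v * (n%:R * ln n%:R) <= tau ^+ 2 & (0 < n)%N].
Proof.
have v0 := rvar_gt0; have h0 := b0.
have bv0 : 0 < b ^+ 2 * v by rewrite mulr_gt0// exprn_gt0.
(* The second exponential gives b^2 v ln n >= 1, hence n <= tau^2; then n > e^(2|A|) gives ln tau >=
   A. The last 1 ensures n >= 1. *)
have [n0 H] := @nat_gt R (expR (2 * `|A|) + expR (b ^+ 2 * v)^-1 + 1).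
exists n0 => n tau /H hn st.
have e1 := expR_gt0 (2 * `|A|); have e2 := expR_gt0 (b ^+ 2 * v)^-1.
have n1 : 1 <= n%:R :> R by lra.
have n00 : 0 < n%:R :> R by lra.
have ln0 : 0 <= ln n%:R :> R := ln_ge0 n1.
have nl0 : 0 <= n%:R * ln n%:R :> R by rewrite mulr_ge0.
have s0 : 0 <= ldscale n by rewrite !mulr_ge0// ?sqrtr_ge0// ltW.
have t2 : b ^+ 2 * v * (n%:R * ln n%:R) <= tau ^+ 2.
  have -> : b ^+ 2 * v * (n%:R * ln n%:R) = ldscale n ^+ 2.
    by rewrite /ldscale !exprMn !sqr_sqrtr// ltW.
  by rewrite lerXn2r// nnegrE// (le_trans s0).
have tn : n%:R <= tau ^+ 2.
  apply: le_trans t2.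
  have : (b ^+ 2 * v)^-1 <= ln n%:R.
    by rewrite -ler_expR lnK ?posrE//; lra.
  rewrite -(ler_pM2l bv0) divff ?gt_eqF// => h.
  by have := ler_wpM2l (ltW n00) h; lra.
have t0 : 0 < tau.
  rewrite lt_neqAle (le_trans s0)// andbT; apply: contraTneq tn => <-.
  by rewrite expr0n /= -ltNge.
split=> //; last by rewrite -(ltr_nat R).
rewrite (le_trans (ler_norm A))// -ler_expR lnK ?posrE//.
rewrite -(@ler_pXn2r _ 2) ?nnegrE ?expR_ge0 ?(ltW t0)// -expRM_natl; lra.
Qed.

(** Chernoff with parameter l = L th e^(-th), where th = ln tau, so that l tau = L ln tau and the
    main factor is tau^(-L). What remains in the exponent is the variance term and a constant [K]
    bounding the contribution of the steps beyond h / l. *)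
Lemma trunc_tail_exp (L h del s : R) :
  0 < L -> 0 < h -> 2 < s -> s < p -> del * L < s - 2 ->
  exists K, exists th0, forall th, th0 <= th -> forall n m : nat, (m <= n)%N ->
    n%:R <= expR (2 * th) ->
    trunc_tail F (c + del * expR th) m (m%:R * c + expR th) <=
    expR (- (L * th) + (n%:R * (L * th * expR (- th)) ^+ 2 * v * expR h / 2 + K)).
Proof.
move=> L0 h0 s2 sp dL.
have [||C C0 QC] := tail_exp_ub (@tail_le _ F) (fun t => proj2 (andP (tail_01 F t))) rv (s := s) => //.
  by lra.
(* [k] makes the exponents in n e^(l del tau) Q(h / l) <= C e^((2 + del L - s(1 - k)) th) cancel
   exactly; [del * L < s - 2] makes it positive. *)
set k := (s - 2 - del * L) / s.
have k0 : 0 < k by rewrite divr_gt0//; lra.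
have [t1 H1] := le_expR_eventually k0 (divr_gt0 h0 L0).
exists C, (Num.max 1 t1) => th; rewrite ge_max => /andP[th1 /H1 tht1] n m mn nth.
have th0 : 0 < th by lra.
set l := L * th * expR (- th).
have l0 : 0 < l by rewrite !mulr_gt0// expR_gt0.
have lt : l * expR th = L * th.
  by rewrite /l -mulrA -expRD addNr expR0 mulr1.
apply: (le_trans (trunc_tail_chernoff _ _ _ _ (ltW l0))).
set rho := l ^+ 2 * v * expR h / 2 + expR (l * (del * expR th)) * Q (c + h / l).
have phi : trunc_mgf F (c + del * expR th) l ^+ m <= expR (m%:R * (l * c + rho)).
  rewrite expRM_natl lerXn2r ?nnegrE ?trunc_mgf_ge0 ?expR_ge0//.
  by apply: trunc_mgf_le => //; exact: ltW.
apply: (le_trans (ler_wpM2l (expR_ge0 _) phi)); rewrite -expRD ler_expR.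
have rho0 : 0 <= rho.
  rewrite /rho; apply: addr_ge0; last by rewrite mulr_ge0 ?expR_ge0// ltW.
  by rewrite divr_ge0// mulr_ge0 ?expR_ge0// mulr_ge0 ?sqr_ge0// (ltW rvar_gt0).
have mrho : m%:R * rho <= n%:R * rho by rewrite ler_wpM2r// ler_nat.
have -> : - (l * (m%:R * c + expR th)) + m%:R * (l * c + rho) = - (L * th) + m%:R * rho.
  by rewrite -lt; ring.
rewrite lerD2l (le_trans mrho)// /rho mulrDr !mulrA lerD2l.
have Qh : Q (c + h / l) <= C * expR (- s * ((1 - k) * th)).
  apply: le_trans (QC _); apply: tail_le.
  apply: (@le_trans _ _ (h / l)); last by rewrite lerDr.
  rewrite ler_pdivlMr// /l mulrCA -expRD.
  have -> : (1 - k) * th - th = - (k * th) by ring.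
  rewrite expRN ler_pdivrMr ?expR_gt0//; apply: (le_trans (ler_wpM2l (ltW L0) tht1)).
  by rewrite !mulrA (mulrC L h) mulfK ?gt_eqF.
have -> : l * del * expR th = del * L * th by rewrite mulrAC lt; ring.
apply: (@le_trans _ _ (expR (2 * th) * expR (del * L * th) * (C * expR (- s * ((1 - k) * th))))).
  apply: ler_pM => //; rewrite ?mulr_ge0 ?expR_ge0// ?(ltW (Q0 _))//.
  by rewrite ler_wpM2r ?expR_ge0.
rewrite mulrCA -!expRD.
have -> : 2 * th + del * L * th + - s * ((1 - k) * th) = 0.
  by rewrite /k; field; lra.
by rewrite expR0 mulr1.
Qed.

(** Arithmetic of the regime n < tau^(2-e): the main factor tau^(-(q+2)) beats the target
    tau^(-(q+e)) by a positive power of tau, which absorbs the bounded variance term and the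
    constants. *)
Lemma short_exponent (e th V X k1 k2 lq q : R) : e <= 1 -> 0 <= th ->
  V + `|k1| + `|k2| + `|lq| <= th -> X <= 2 * V ->
  - ((q + 2) * th) + (X / 2 + k1) <= (0 - (q + e)) * th + lq.
Proof.
move=> e1 th0 h X0; have [l1 l2] := (ler_norm k1, normr_ge0 k2).
have l3 := ler_norm (- lq); rewrite normrN in l3.
have : 0 <= (1 - e) * th by rewrite mulr_ge0//; lra.
lra.
Qed.

(** Arithmetic of the regime n >= tau^(2-e): half of the exponent [L] is lost to the variance term,
    and L/2 > q - 2 + 2e leaves a positive power of tau for the constants. The summand 2 - e is the
    power of tau contained in n. *)
Lemma long_exponent (e th V X L k1 k2 lq q : R) : 0 <= V ->
  V + `|k1| + `|k2| + `|lq| <= (L / 2 - (q - 2 + 2 * e)) * th -> X <= L * th ->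
  - (L * th) + (X / 2 + k2) <= ((2 - e) - (q + e)) * th + lq.
Proof.
move=> V0 h X0; have [l1 l2] := (normr_ge0 k1, ler_norm k2).
have l3 := ler_norm (- lq); rewrite normrN in l3.
lra.
Qed.

Lemma norm_sum_le (t1 t2 t3 t4 k x : R) : 0 <= k ->
  `|t1| + `|t2| + `|t3| + `|t4| + 1 + k <= x ->
  [/\ t1 <= x, t2 <= x, t3 <= x, t4 <= x & 1 <= x /\ k <= x].
Proof.
move=> k0 h; have [[[a1 a2] a3] a4] := (ler_norm t1, ler_norm t2, ler_norm t3, ler_norm t4).
have [[[A1 A2] A3] A4] := (normr_ge0 t1, normr_ge0 t2, normr_ge0 t3, normr_ge0 t4).
by split; [lra..|split; lra].
Qed.

(** The factor e^(-2 th) beats x by e^(-e th), which is enough to absorb the square of th. *)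
Lemma short_variance (e th x L : R) : 0 <= x -> x <= expR ((2 - e) * th) -> 0 <= th ->
  th <= expR (e / 2 * th) -> x * (L * th * expR (- th)) ^+ 2 <= L ^+ 2.
Proof.
move=> x0 xe th0 the; rewrite !exprMn mulrCA -mulrA ler_piMr ?sqr_ge0//.
apply: (@le_trans _ _ (expR (e / 2 * th) ^+ 2 * (expR ((2 - e) * th) * expR (- th) ^+ 2))).
  apply: ler_pM; rewrite ?sqr_ge0 ?mulr_ge0 ?sqr_ge0//.
    by rewrite lerXn2r ?nnegrE ?expR_ge0.
  by rewrite ler_wpM2r ?sqr_ge0.
rewrite -!expRM_natl -!expRD -[leRHS]expR0 ler_expR; lra.
Qed.

(** This exponent is the Chernoff optimum: its factor e^(-e) cancels the Taylor factor e^h at h = e,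
    and tau^2 >= bb w x ln x with ln x >= (2 - e) th does the rest. *)
Lemma long_variance (bb w e th x : R) : 0 < bb -> 0 < w -> 0 < x -> 0 <= th -> e <= 2 ->
  (2 - e) * th <= ln x -> bb * w * (x * ln x) <= expR th ^+ 2 ->
  x * (bb * (2 - e) * expR (- e) * th * expR (- th)) ^+ 2 * w * expR e <=
    bb * (2 - e) * expR (- e) * th.
Proof.
move=> bb0 w0 x0 th0 e2 lx hx.
have nv : x * w * (bb * (2 - e)) * th <= expR th ^+ 2.
  apply: le_trans hx.
  have := ler_wpM2l (ltW (mulr_gt0 (mulr_gt0 bb0 w0) x0)) lx; lra.
set L := bb * (2 - e) * expR (- e).
have L0 : 0 <= L by rewrite !mulr_ge0 ?expR_ge0 ?(ltW bb0)//; lra.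
have -> : x * (L * th * expR (- th)) ^+ 2 * w * expR e =
   (x * w * (bb * (2 - e)) * th * expR (- th) ^+ 2) * (expR (- e) * expR e) * (L * th).
  by rewrite /L; ring.
rewrite -expRD addNr expR0 mulr1 ler_piMl//; first exact: mulr_ge0.
by rewrite expRN exprVn ler_pdivrMr ?mul1r// exprn_gt0// expR_gt0.
Qed.

(* When n <= tau^(2-e) the variance term of the Chernoff bound vanishes and the
   exponent L = p + 2 suffices; otherwise tau^2 >= b^2 v n log n makes
   L = b^2 (2-e) e^-h the optimal exponent. *)
Lemma trunc_tail_small : exists2 del : R, 0 < del <= 1 &
  forall eps, 0 < eps -> exists n0 : nat, forall n m (tau : R), (n0 <= n)%N ->
    (m <= n)%N -> ldscale n <= tau ->
    trunc_tail F (c + del * tau) m (m%:R * c + tau) <= eps * (n%:R * Q tau).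
Proof.
have v0 := rvar_gt0; have hb := b0; have hbp := bp; have hp := p2.
have bb0 : 0 < b ^+ 2 by rewrite exprn_gt0.
(* Small enough that b^2 (2 - e)(1 - e) / 2 still exceeds p - 2 + 2e; this is where b^2 > p - 2
   enters. *)
set e := (b ^+ 2 - (p - 2)) / (2 * (2 * b ^+ 2 + 3)).
have e0 : 0 < e by rewrite divr_gt0//; lra.
have eE : e * (2 * (2 * b ^+ 2 + 3)) = b ^+ 2 - (p - 2) by rewrite divfK//; lra.
have e1 : e < 1 / 2 by nra.
have e12 : e <= 1 by lra.
have e2 : e <= 2 by lra.
set L2 := b ^+ 2 * (2 - e) * expR (- e).
have L20 : 0 < L2 by rewrite !mulr_gt0 ?expR_gt0//; lra.
have L2p : p - 2 + 2 * e < L2 / 2.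
  have : b ^+ 2 * (2 - e) * (1 - e) <= L2.
    by rewrite ler_wpM2l ?expR_ge1Dx// mulr_ge0//; lra.
  nra.
set L1 := p + 2.
have L10 : 0 < L1 by rewrite /L1; lra.
set s := (p + 2) / 2.
have s2 : 2 < s by rewrite /s; lra.
(* One truncation level has to serve both exponents [L1] and [L2]. *)
set del := Num.min 1 ((s - 2) / (2 * (L1 + L2))).
have del0 : 0 < del by rewrite lt_min ltr01/= divr_gt0//; lra.
have del1 : del <= 1 by rewrite ge_min lexx.
have dL : del * (L1 + L2) < s - 2.
  have : del <= (s - 2) / (2 * (L1 + L2)) by rewrite ge_min lexx orbT.
  rewrite ler_pdivlMr; last by lra.
  lra.
have dL10 : 0 < del * L1 by rewrite mulr_gt0.
have dL20 : 0 < del * L2 by rewrite mulr_gt0.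
exists del; first by rewrite del0.
move=> eps eps0.
have sp : s < p by rewrite /s; lra.
have dL1 : del * L1 < s - 2 by lra.
have dL2 : del * L2 < s - 2 by lra.
have [K1 [t1 H1]] := trunc_tail_exp L10 e0 s2 sp dL1.
have [K2 [t2 H2]] := trunc_tail_exp L20 e0 s2 sp dL2.
have [||q0 q00 [t3 H3]] := @tail_exp_lb _ _ _ (@tail_le _ F) rv (p + e).
- by lra.
- by lra.
have [|t4 H4] := @le_expR_eventually R (e / 2) 1 _ ltr01; first by lra.
set K := L1 ^+ 2 * v * expR e / 2 + `|K1| + `|K2| + `|ln (eps * q0)|.
set g := Num.min 1 (L2 / 2 - (p - 2 + 2 * e)).
have g0 : 0 < g by rewrite lt_min ltr01/=; lra.
have [n0 Hn] := ldscale_large (`|t1| + `|t2| + `|t3| + `|t4| + 1 + K / g).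
exists n0 => n m tau /Hn{}Hn mn /Hn[At tau0 nt bt n1].
set th := ln tau.
have tE : tau = expR th by rewrite /th lnK ?posrE.
have V0 : 0 <= L1 ^+ 2 * v * expR e / 2.
  by rewrite divr_ge0// mulr_ge0 ?expR_ge0// mulr_ge0 ?sqr_ge0// ltW.
have K0 : 0 <= K by rewrite /K !addr_ge0.
have KG : 0 <= K / g by rewrite divr_ge0// ltW.
have [th_1 th_2 th_3 th_4 [th1 thK]] := norm_sum_le KG At; rewrite -/th in th_1 th_2 th_3 th_4 th1 thK.
have th0 : 0 <= th by exact: le_trans th1.
have Kg : K <= g * th by rewrite mulrC -ler_pdivrMr.
have nt2 : n%:R <= expR (2 * th) by rewrite expRM_natl -tE.
have Ql : q0 * expR (- (p + e) * th) <= Q (expR th) by exact: H3.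
have nR1 : 1 <= n%:R :> R by rewrite ler1n.
have lnq : eps * q0 = expR (ln (eps * q0)) by rewrite lnK// posrE mulr_gt0.
rewrite tE.
(* Since Q(tau) >= q0 tau^(-(p+e)), a lower bound tau^x <= n turns the claim into a comparison of
   powers of tau. The choice is x = 0 for n < tau^(2-e) and x = 2 - e otherwise. *)
suff [x [xn Hx]] : exists x, expR (x * th) <= n%:R /\
   trunc_tail F (c + del * expR th) m (m%:R * c + expR th) <=
     expR ((x - (p + e)) * th + ln (eps * q0)).
  apply: (le_trans Hx).
  have -> : expR ((x - (p + e)) * th + ln (eps * q0)) =
     eps * (expR (x * th) * (q0 * expR (- (p + e) * th))).
    by rewrite expRD -lnq mulrBl expRD mulNr; ring.
  rewrite ler_pM2l//; by apply: ler_pM => //; rewrite ?mulr_ge0 ?expR_ge0 ?(ltW q00).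
have [ne|ne] := leP (expR ((2 - e) * th)) n%:R; last first.
  exists 0; split; first by rewrite mul0r expR0.
  apply: (le_trans (H1 _ _ n m mn nt2)); first exact: th_1.
  rewrite ler_expR.
  have t4th : th <= expR (e / 2 * th) by rewrite -[leRHS]mul1r; exact: H4.
  have := short_variance L1 (ler0n _ n) (ltW ne) th0 t4th.
  move=> /(ler_wpM2r (ltW v0)) /(ler_wpM2r (expR_ge0 e)).
  have gth : g * th <= th by rewrite ler_piMl// ge_min lexx.
  move=> hX; apply: (short_exponent (V := L1 ^+ 2 * v * expR e / 2) (k2 := K2) p e12 th0 (le_trans Kg gth)).
  by rewrite [2 * _]mulrC divfK// pnatr_eq0.
exists (2 - e); split => //.
apply: (le_trans (H2 _ _ n m mn nt2)); first exact: th_2.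
rewrite ler_expR.
have n0R : 0 < n%:R :> R by exact: lt_le_trans nR1.
have lnn : (2 - e) * th <= ln n%:R by rewrite -ler_expR lnK ?posrE.
rewrite tE in bt.
have := long_variance bb0 v0 n0R th0 e2 lnn bt; rewrite -/L2.
have gth : g * th <= (L2 / 2 - (p - 2 + 2 * e)) * th by rewrite ler_wpM2r// ge_min lexx orbT.
move=> hX; exact: (long_exponent (V := L1 ^+ 2 * v * expR e / 2) (k1 := K1) V0 (le_trans Kg gth)).
Qed.

End large_deviations.

(** * One-big-jump asymptotics of the walk *)

Section walk_tail_asymptotics.
Context {R : realType}.
Variables (F : probability R R) (p b : R).
Hypotheses (i1 : rintegrable F (fun y => y)) (i2 : rintegrable F (fun y => y ^+ 2)).
Hypotheses (p2 : 2 < p) (rv : regvar (tail F) p) (c0 : 0 <= rmean F).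
Hypotheses (b0 : 0 < b) (bp : p - 2 < b ^+ 2).

Local Notation c := (rmean F).
Local Notation v := (rvar F).
Local Notation Q := (tail F).
Local Notation scale := (ldscale F b).
Let v0 : 0 < v := rvar_gt0 i1 i2 rv.

Let Q0 t : 0 < Q t. Proof. by have [h _] := rv; exact: h. Qed.

(** The constant is crude, but the bound is uniform over m <= n. Both levels of [walk_tail_ub] are
    taken equal, so that its last factor can be bounded by 1. *)
Lemma walk_tail_unif : exists2 C, 0 < C &
  exists n0 : nat, forall n m (tau : R), (n0 <= n)%N -> (m <= n)%N ->
    scale n <= tau -> walk_tail F m (m%:R * c + tau) <= C * (n%:R * Q tau).
Proof.
have [del /andP[d0 d1] H] := trunc_tail_small i1 i2 p2 rv c0 b0 bp.
have [n1 H1] := H 1 ltr01.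
have dk : del `^ (- p) < del `^ (- p) + 1 by rewrite ltrDl.
have [t0 Ht] := regvar_le rv d0 dk.
set k := del `^ (- p) + 1 in Ht.
have k0 : 0 < k by rewrite ltr_wpDl// powR_ge0.
have [n2 H2] := ldscale_large i1 i2 rv b0 `|t0|.
exists (2 * k + 1); first by lra.
exists (maxn n1 n2) => n m tau; rewrite geq_max => /andP[h1 h2] mn st.
have [At tau0 _ _ _] := H2 _ _ h2 st.
have tt : t0 <= tau.
  rewrite (le_trans (ler_norm t0))// (le_trans At)//.
  have := expR_ge1Dx (ln tau); rewrite lnK ?posrE//; lra.
have := walk_tail_ub F (c + del * tau) (c + del * tau) m (m%:R * c + tau).
have {H1} := H1 n m tau h1 mn st; rewrite mul1r => h3 h4; apply: (le_trans h4).
have q1 : Q (c + del * tau) <= k * Q tau.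
  by apply: le_trans (Ht _ tt); apply: tail_le; rewrite lerDr.
have q0 := tail_ge0 F (c + del * tau).
have mq : m%:R * Q (c + del * tau) <= k * (n%:R * Q tau).
  by rewrite mulrCA; apply: ler_pM => //; rewrite ler_nat.
have : m%:R * Q (c + del * tau) * walk_tail F m.-1 (m%:R * c + tau - (c + del * tau))
   <= m%:R * Q (c + del * tau).
  by rewrite ler_piMr ?walk_tail_le1// mulr_ge0.
lra.
Qed.

Lemma ln_nat_ge (A : R) : exists n0 : nat, forall n, (n0 <= n)%N -> A <= ln n%:R.
Proof.
have [n0 H] := nat_gt (expR A); exists n0 => n /H h.
by rewrite -ler_expR lnK ?ltW// posrE (lt_trans _ h)// expR_gt0.
Qed.

(** tau^2 >= b^2 v n ln n makes this Chebyshev bound of order 1 / ln n. *)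
Lemma var_small (eps eta : R) : 0 < eps -> 0 < eta ->
  exists n0 : nat, forall n (tau : R), (n0 <= n)%N -> scale n <= tau ->
    0 < tau /\ (eta * tau)^-1 ^+ 2 * (n%:R * v) <= eps.
Proof.
move=> e0 t0; have hb := b0; have hv := v0.
have bb0 : 0 < b ^+ 2 by rewrite exprn_gt0.
have [n1 H1] := ldscale_large i1 i2 rv b0 0.
have [n2 H2] := ln_nat_ge (b ^+ 2 * eta ^+ 2 * eps)^-1.
exists (maxn n1 n2) => n tau; rewrite geq_max => /andP[h1 /H2 h2] st.
have [_ tau0 _ bt n0] := H1 _ _ h1 st; split => //.
have et0 : 0 < eta * tau by rewrite mulr_gt0.
rewrite exprVn ler_pdivrMl ?exprn_gt0// exprMn.
have h0 : 0 < b ^+ 2 * eta ^+ 2 * eps by rewrite !mulr_gt0// exprn_gt0.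
rewrite -(ler_pM2l h0) divff ?gt_eqF// in h2.
have nv0 : 0 <= n%:R * v by rewrite mulr_ge0// ltW.
have := ler_wpM2l nv0 h2.
have k0 : 0 <= eta ^+ 2 * eps by rewrite mulr_ge0 ?sqr_ge0// ltW.
have := ler_wpM2l k0 bt.
lra.
Qed.

(** n <= tau^2, and tau^2 Q(tau) tends to 0 because p > 2. *)
Lemma ntail_small (eps : R) : 0 < eps -> exists n0 : nat, forall n (tau : R),
  (n0 <= n)%N -> scale n <= tau -> n%:R * Q tau <= eps.
Proof.
move=> e0; have hp := p2.
set s := (2 + p) / 2; have s2 : 2 < s by rewrite /s; lra.
have [||C C0 QC] := tail_exp_ub (@tail_le _ F) (fun t => proj2 (andP (tail_01 F t))) rv (s := s).
  by lra.
  by rewrite /s; lra.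
have s20 : 0 < s - 2 by lra.
have [n1 H1] := ldscale_large i1 i2 rv b0 (C / eps / (s - 2)).
exists n1 => n tau h1 st; have [At tau0 nt _ _] := H1 _ _ h1 st.
set th := ln tau in At.
have tE : tau = expR th by rewrite /th lnK ?posrE.
rewrite tE in nt *.
apply: (@le_trans _ _ (expR (2 * th) * (C * expR (- s * th)))).
  by apply: ler_pM; rewrite ?(ltW (Q0 _))// expRM_natl.
rewrite mulrCA -expRD (_ : 2 * th + - s * th = - ((s - 2) * th)); last by ring.
rewrite expRN ler_pdivrMr ?expR_gt0// -ler_pdivrMl// mulrC.
rewrite (le_trans _ (expR_ge1Dx _))//.
rewrite ler_pdivrMr// mulrC in At; lra.
Qed.

(** A step beyond lam tau, with lam < 1 close to 1, accounts for the main term. The other ways to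
    exceed tau are negligible: all steps below about del tau, by the Chernoff bound, or an
    intermediate step together with a deviation of (1 - lam) tau by the others, by Chebyshev. *)
Lemma walk_tail_limsup (eps : R) : 0 < eps ->
  exists n0 : nat, forall n (tau : R), (n0 <= n)%N -> scale n <= tau ->
    walk_tail F n (n%:R * c + tau) <= (1 + eps) * (n%:R * Q tau).
Proof.
move=> e0; have hp := p2; have hc := c0.
have [del /andP[d0 d1] H] := trunc_tail_small i1 i2 p2 rv c0 b0 bp.
have e40 : 0 < eps / 4 by lra.
have [n1 H1] := H (eps / 4) e40.
have dk : del `^ (- p) < del `^ (- p) + 1 by rewrite ltrDl.
have [t0 Ht] := regvar_le rv d0 dk.
set k := del `^ (- p) + 1 in Ht.
have k0 : 0 < k by rewrite ltr_wpDl// powR_ge0.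
set lam := expR (- (ln (1 + eps / 4) / p)).
have ln0 : 0 < ln (1 + eps / 4) by rewrite ln_gt0//; lra.
have lam1 : lam < 1 by rewrite expR_lt1 oppr_lt0 divr_gt0//; lra.
have lam0 : 0 < lam by exact: expR_gt0.
have lamp : lam `^ (- p) < 1 + eps / 2.
  have -> : lam `^ (- p) = 1 + eps / 4.
    rewrite -expRM mulrNN divfK ?lnK//; [rewrite posrE; lra | lra].
  lra.
have [t1 Ht1] := regvar_le rv lam0 lamp.
have eta0 : 0 < 1 - lam by lra.
have [n3 H3] := var_small (divr_gt0 e40 k0) eta0.
have [n2 H2] := ldscale_large i1 i2 rv b0 (`|t0| + `|t1|).
exists (maxn n1 (maxn n2 n3)) => n tau; rewrite !geq_max => /andP[h1 /andP[h2 h3]] st.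
have [At tau0 _ _ n0] := H2 _ _ h2 st.
have [tt tt1] : t0 <= tau /\ t1 <= tau.
  have a1 := ler_norm t0; have a2 := ler_norm t1.
  have a3 := normr_ge0 t0; have a4 := normr_ge0 t1.
  by have := expR_ge1Dx (ln tau); rewrite lnK ?posrE// => ?; split; lra.
have [_ vs] := H3 n tau h3 st.
have := walk_tail_ub F (c + del * tau) (lam * tau) n (n%:R * c + tau).
have {H1} := H1 n n tau h1 (leqnn n) st=> u1 u2; apply: (le_trans u2).
have q1 : Q (c + del * tau) <= k * Q tau.
  by apply: le_trans (Ht _ tt); apply: tail_le; rewrite lerDr.
have q2 : n%:R * Q (lam * tau) <= (1 + eps / 2) * (n%:R * Q tau).
  by rewrite mulrCA ler_wpM2l// Ht1.
have nR0 : 0 < n%:R :> R by rewrite ltr0n.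
have et0 : 0 < (1 - lam) * tau by rewrite mulr_gt0.
have nE : n%:R = n.-1%:R + 1 :> R by rewrite natr1 prednK.
have wt : walk_tail F n.-1 (n%:R * c + tau - lam * tau) <= eps / 4 / k.
  apply: (le_trans _ vs).
  apply: (le_trans (walk_tail_chebyshev i1 i2 _ (lam := ((1 - lam) * tau)^-1) (z := n.-1%:R * c) _ _)).
  - by rewrite invr_ge0 ltW.
  - rewrite mulrC ler_pdivlMr// mul1r nE; lra.
  - rewrite subrr expr0n /= addr0 ler_wpM2l ?sqr_ge0//.
    by rewrite ler_wpM2r ?(ltW v0)// ler_nat leq_pred.
have q3 : n%:R * Q (c + del * tau) <= k * (n%:R * Q tau).
  by rewrite mulrCA ler_wpM2l// ltW.
have : n%:R * Q (c + del * tau) * walk_tail F n.-1 (n%:R * c + tau - lam * tau)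
   <= k * (n%:R * Q tau) * (eps / 4 / k).
  by apply: ler_pM; rewrite ?walk_tail_ge0// mulr_ge0// ?tail_ge0.
have -> : k * (n%:R * Q tau) * (eps / 4 / k) = eps / 4 * (n%:R * Q tau) by field; lra.
lra.
Qed.

(** Origin of eps/5: (1 - e)(1 - 2e)^2 >= 1 - 5e. *)
Lemma second_order_lb (e eps n m Qt Ql h : R) : 0 <= e -> e <= 1 / 2 -> e <= eps / 5 ->
  0 <= n -> 0 <= Qt -> 0 <= m -> 0 <= Ql -> 1 - h <= e -> m * Ql <= e ->
  (1 - e) * n <= m -> (1 - 2 * e) * Qt <= Ql -> (1 - eps) * (n * Qt) <= m * Ql * (h - m * Ql).
Proof.
move=> e0 e1 e5 n0 qt m0 ql he mq mk q1.
have e2 : 0 <= 1 - 2 * e by lra.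
have h5 : ((1 - e) * n) * ((1 - 2 * e) * Qt) <= m * Ql.
  by apply: ler_pM => //; rewrite mulr_ge0//; lra.
have h6 : m * Ql * (1 - 2 * e) <= m * Ql * (h - m * Ql).
  by rewrite ler_wpM2l ?mulr_ge0//; lra.
apply: le_trans h6; apply: le_trans (ler_wpM2r e2 h5).
have -> : (1 - e) * n * ((1 - 2 * e) * Qt) * (1 - 2 * e) =
   ((1 - e) * (1 - 2 * e) * (1 - 2 * e)) * (n * Qt) by ring.
rewrite ler_wpM2r ?mulr_ge0//.
have e3 : 0 <= 2 - e by lra.
have := mulr_ge0 (mulr_ge0 e0 e0) e3; lra.
Qed.

(** One step beyond lam tau, with lam > 1, while the others stay near their mean. The surplus (lam -
    1) tau absorbs the [k] missing steps and the shift [w], both of which are fixed while tau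
    grows. *)
Lemma walk_tail_liminf (eps w : R) (k : nat) : 0 < eps ->
  exists n0 : nat, forall n (tau : R), (n0 <= n)%N -> scale n <= tau ->
    (1 - eps) * (n%:R * Q tau) <= walk_tail F (n - k) (n%:R * c + tau - w).
Proof.
move=> e0; have hp := p2; have hc := c0; have hv := v0.
set e := Num.min (1 / 2) (eps / 5).
have e'0 : 0 < e by rewrite lt_min; apply/andP; split; lra.
have e1 : e <= 1 / 2 by rewrite ge_min lexx.
have e5 : e <= eps / 5 by rewrite ge_min lexx orbT.
set lam := expR (- (ln (1 - e) / p)).
have ln0 : ln (1 - e) < 0 by rewrite -oppr_gt0 -lnV ?posrE ?ln_gt0 ?invf_gt1//; lra.
have lam1 : 1 < lam by rewrite -[ltLHS]expR0 ltr_expR oppr_gt0 pmulr_llt0// invr_gt0; lra.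
have lam0 : 0 < lam by exact: expR_gt0.
have lamp : 1 - 2 * e < lam `^ (- p).
  have -> : lam `^ (- p) = 1 - e.
    rewrite -expRM mulrNN divfK ?lnK//; [rewrite posrE; lra | lra].
  lra.
have [t1 Ht1] := regvar_ge rv lam0 lamp.
have eta0 : 0 < (lam - 1) / 2 by lra.
have [n1 H1] := ntail_small e'0.
have [n3 H3] := var_small e'0 eta0.
(* Beyond this value of tau, half of the surplus covers the [k] missing steps, the mean of the big
   step itself and the shift. *)
set A := 2 * (k.+1%:R * c + `|w|) / (lam - 1).
have [n2 H2] := ldscale_large i1 i2 rv b0 (`|t1| + A).
have [n4 H4] := nat_gt (k.+1%:R / e + 1).
exists (maxn (maxn n1 n4) (maxn n2 n3)) => n tau.
rewrite !geq_max => /andP[/andP[h1 h4] /andP[h2 h3]] st.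
have [At tau0 _ _ n0] := H2 _ _ h2 st.
have A0 : 0 <= A.
  by apply: divr_ge0; [rewrite mulr_ge0// addr_ge0// mulr_ge0|lra].
have [tA tt1] : A <= tau /\ t1 <= tau.
  have a1 := ler_norm t1; have a3 := normr_ge0 t1.
  by have := expR_ge1Dx (ln tau); rewrite lnK ?posrE// => ?; split; lra.
have [_ vs] := H3 n tau h3 st.
have nq := H1 n tau h1 st.
have {H4}h4 := H4 n h4.
have k10 : 0 <= k.+1%:R / e by rewrite divr_ge0// ltW.
have ke : k.+1%:R <= e * n%:R by rewrite mulrC -ler_pdivrMr//; lra.
have kn : (k < n)%N.
  rewrite -(ltr_nat R); rewrite -natr1 in ke.
  have : e * n%:R <= 1 / 2 * n%:R by rewrite ler_wpM2r.
  have : 0 <= n%:R :> R by []. lra.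
set m := (n - k)%N.
have m0 : (0 < m)%N by rewrite subn_gt0.
have mn : (m <= n)%N by rewrite leq_subr.
have mR : n%:R = m%:R + k%:R :> R by rewrite -natrD subnK// ltnW.
have mR1 : m%:R = m.-1%:R + 1 :> R by rewrite natr1 prednK.
apply: le_trans (walk_tail_lb F (lam * tau) m _).
have kE : k.+1%:R = k%:R + 1 :> R by rewrite natr1.
have wt : 1 - walk_tail F m.-1 (n%:R * c + tau - w - lam * tau) <= e.
  apply: (le_trans _ vs).
  apply: (le_trans (walk_tail_chebyshev_low i1 i2 _ (lam := ((lam - 1) / 2 * tau)^-1) (z := m.-1%:R * c) _ _)).
  - by rewrite invr_ge0 mulr_ge0// ltW.
  - rewrite ler_pdivlMl; last by rewrite mulr_gt0.
    rewrite mulr1; have := ler_norm (- w); rewrite normrN => wn.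
    have : 2 * (k.+1%:R * c + `|w|) <= tau * (lam - 1) by rewrite -ler_pdivrMr//; lra.
    rewrite mR mR1 kE; lra.
  - rewrite subrr expr0n /= addr0 ler_wpM2l ?sqr_ge0//.
    by rewrite ler_wpM2r ?(ltW v0)// ler_nat (leq_trans (leq_pred _)).
have q1 : (1 - 2 * e) * Q tau <= Q (lam * tau) := Ht1 _ tt1.
have q2 : Q (lam * tau) <= Q tau by apply: tail_le; rewrite ler_peMl// ltW.
have mq : m%:R * Q (lam * tau) <= e.
  by apply: le_trans nq; apply: ler_pM; rewrite ?(ltW (Q0 _))// ler_nat.
rewrite kE in ke.
apply: (second_order_lb (ltW e'0) e1 e5 (ler0n _ _) (ltW (Q0 _)) (ler0n _ _) (ltW (Q0 _)) wt mq _ q1).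
by lra.
Qed.

End walk_tail_asymptotics.

(** * The law of the offspring and the many-to-one identity *)

Section offspring_independence.
Context {d : measure_display} {T : measurableType d} {R : realType}.
Variables (P : probability T R) (X : vertex -> nat -> T -> \bar R).

Definition seq_cylinder : set (set (nat -> \bar R)) :=
  [set A | exists k (B : nat -> set (\bar R)), [/\ forall j, measurable (B j),
     forall j, (k <= j)%N -> B j = setT & A = [set x | forall j, B j (x j)]]].

Definition atom_seq := g_sigma_algebraType seq_cylinder.

Definition offspring (u : vertex) (w : T) : atom_seq := fun j => X u j w.

Definition away_cylinder (u : vertex) : set (set T) :=
  [set A | exists (us : seq vertex) k (B : vertex -> nat -> set (\bar R)),
     [/\ forall v j, measurable (B v j),
         forall v j, ~~ ((v \in us) && (j < k)%N) -> B v j = setT &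
         A = [set w | forall v, v != u -> forall j, B v j (X v j w)]]].

(* the sigma-algebra generated by all offspring processes except that of u *)
Definition away (u : vertex) := g_sigma_algebraType (away_cylinder u).

Lemma seq_cylinderI : setI_closed seq_cylinder.
Proof.
move=> _ _ [k [B [mB Bk ->]]] [k' [B' [mB' Bk' ->]]].
exists (maxn k k'), (fun j => B j `&` B' j); split.
- by move=> j; exact: measurableI.
- by move=> j; rewrite geq_max => /andP[h h']; rewrite Bk// Bk'// setTI.
- by apply/seteqP; split => x /= => [[h h'] j|h]; [split|split => j; have [] := h j].
Qed.

Lemma seq_cylinderT : seq_cylinder setT.
Proof. by exists 0%N, (fun=> setT); split => //; apply/seteqP; split. Qed.

Lemma away_cylinderI u : setI_closed (away_cylinder u).
Proof.
move=> _ _ [us [k [B [mB Bk ->]]]] [us' [k' [B' [mB' Bk' ->]]]].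
exists (us ++ us'), (maxn k k'), (fun v j => B v j `&` B' v j); split.
- by move=> v j; exact: measurableI.
- move=> v j; rewrite mem_cat leq_max => h.
  rewrite Bk ?Bk' ?setTI//; apply: contra h => /andP[-> ->];
  by rewrite ?orbT.
- apply/seteqP; split => x /= => [[h h'] v vu j|h]; first by split; [exact: h|exact: h'].
  by split => v vu j; have [] := h v vu j.
Qed.

Lemma away_cylinderT u : away_cylinder u setT.
Proof. by exists [::], 0%N, (fun _ _ => setT); split => //; apply/seteqP; split. Qed.

Lemma measurable_away_coord u v j : v != u ->
  measurable_fun setT (X v j : away u -> \bar R).
Proof.
move=> vu _ Y mY; rewrite setTI; apply: sub_sigma_algebra.
exists [:: v], j.+1, (fun v' j' => if (v' == v) && (j' == j) then Y else setT).
split.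
- by move=> v' j'; case: ifP.
- move=> v' j' h; case: ifP => // /andP[/eqP e1 /eqP e2].
  by move: h; rewrite e1 e2 inE eqxx ltnSn.
- apply/seteqP; split => x /= h; last by have := h v vu j; rewrite !eqxx.
  by move=> v' _ j'; case: ifP => // /andP[/eqP -> /eqP ->].
Qed.

Lemma measurable_seq_coord j : measurable_fun setT (fun x : atom_seq => x j).
Proof.
move=> _ Y mY; rewrite setTI; apply: sub_sigma_algebra.
exists j.+1, (fun j' => if j' == j then Y else setT); split.
- by move=> j'; case: ifP.
- by move=> j' h; case: ifP => // /eqP e; move: h; rewrite e ltnn.
- apply/seteqP; split => x /= h; last by have := h j; rewrite !eqxx.
  by move=> j'; case: ifP => // /eqP ->.
Qed.

Hypothesis HX : iid_copies P X.

Let mX u j : measurable_fun setT (X u j). Proof. by have [h _ _] := HX. Qed.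

Lemma measurable_offspring u : measurable_fun setT (offspring u).
Proof.
apply: (@measurability _ _ T atom_seq setT (offspring u) seq_cylinder erefl) => _ [_ [k [B [mB Bk ->]]] <-].
rewrite setTI.
have -> : offspring u @^-1` [set x | forall j, B j (x j)] =
    \bigcap_j (X u j @^-1` B j).
  by apply/seteqP; split => w h j; [move=> _|]; exact: h.
by apply: bigcapT_measurable => j; rewrite -[X in measurable X]setTI; exact: mX.
Qed.

(** [away u] has the points of [T] and a coarser sigma-algebra, so the identity transfers
    measurability to [T]. Measurability on [away u] is how independence from the offspring of [u] is
    expressed throughout. *)
Lemma measurable_to_away u : measurable_fun setT (id : T -> away u).
Proof.
apply: (@measurability _ _ T (away u) setT id (away_cylinder u) erefl) => _ [_ [us [k [B [mB Bk ->]]]] <-].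
rewrite setTI preimage_id.
have -> : [set w | forall v, v != u -> forall j, B v j (X v j w)] =
    \bigcap_n (match unpickle n with Some (v, j) =>
      if v != u then X v j @^-1` B v j else setT | None => setT end).
  apply/seteqP; split => w /= h.
    move=> n _; case: unpickle => // -[v j]; case: ifP => // vu; exact: h.
  move=> v vu j; have := h (pickle (v, j)) I.
  by rewrite pickleK vu.
apply: bigcapT_measurable => n; case: unpickle => // -[v j].
by case: ifP => // vu; rewrite -[X in measurable X]setTI; exact: mX.
Qed.

Lemma measurable_from_away u d' (T' : measurableType d') (f : T -> T') :
  measurable_fun setT (f : away u -> T') -> measurable_fun setT f.
Proof.
move=> mf _ Y mY; have mA := mf measurableT Y mY.
by have := measurable_to_away (u := u) measurableT mA; rewrite !setTI preimage_id.
Qed.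

Definition offspring_mfun u : {mfun T >-> atom_seq} :=
  HB.pack (offspring u) (isMeasurableFun.Build _ _ _ _ (offspring u) (@measurable_offspring u)).

Definition away_mfun u : {mfun T >-> away u} :=
  HB.pack (id : T -> away u) (isMeasurableFun.Build _ _ T (away u) id (@measurable_to_away u)).

Definition law : probability atom_seq R := distribution P (offspring_mfun [::]).

Let cylE u k (B : nat -> set (\bar R)) : (forall j, (k <= j)%N -> B j = setT) ->
  offspring u @^-1` [set x | forall j, B j (x j)] = cyl (X u) k B.
Proof.
move=> Bk; apply/seteqP; split => w /= h; first by move=> j _; exact: h.
by move=> j; have [jk|kj] := ltnP j k; [exact: h|rewrite Bk].
Qed.

Lemma offspring_law u S : measurable S -> P (offspring u @^-1` S) = law S.
Proof.
move=> mS; have [_ H _] := HX.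
apply: (@measure_unique _ R atom_seq seq_cylinder (fun=> setT) _ _ _ _
  (distribution P (offspring_mfun u)) law) => //.
- exact: seq_cylinderI.
- by move=> _; exact: seq_cylinderT.
- by rewrite bigcup_const.
- move=> _ [k [B [mB Bk ->]]].
  suff : P (offspring u @^-1` [set x | forall j, B j (x j)]) =
         P (offspring [::] @^-1` [set x | forall j, B j (x j)]) by [].
  by rewrite !(cylE _ Bk); exact: H.
- by move=> _; rewrite [X in (X < _)%E]probability_setT ltry.
Qed.

(** Two rounds of uniqueness of measures on a pi-system: in the variable [S] for a fixed cylinder,
    then in the variable [A] for a fixed [S]. On cylinders the claim is the product rule of
    [iid_copies]. *)
Lemma away_offspring_indep u (A : set T) (S : set atom_seq) :
  measurable (A : set (away u)) -> measurable S ->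
  P (A `&` offspring u @^-1` S) = (P A * law S)%E.
Proof.
move=> mA mS; have [_ _ H] := HX.
have ltP E : measurable E -> (P E < +oo)%E.
  by move=> mE; rewrite (le_lt_trans (probability_le1 P mE))// ltry.
have mO S' : measurable S' -> measurable (offspring u @^-1` S').
  by move=> mS'; rewrite -[X in measurable X]setTI; exact: measurable_offspring.
have mAw (A' : set T) : measurable (A' : set (away u)) -> measurable A'.
  by move=> mA'; have := measurable_to_away (u := u) measurableT mA'; rewrite setTI preimage_id.
have step1 (A' : set T) (S' : set atom_seq) : away_cylinder u A' -> seq_cylinder S' ->
    P (A' `&` offspring u @^-1` S') = (P A' * law S')%E.
  move=> [us [k [B [mB Bk ->]]]] [k' [C [mC Ck ->]]].
  (* The product rule wants a list without repetitions. [u] is removed so that it can be put back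
     with the constraints [C], and [K] is a common length for both cylinders. *)
  set us' := [seq v <- undup us | v != u].
  set K := maxn k k'.
  pose B' v := if v == u then C else B v.
  have mB' v j : measurable (B' v j) by rewrite /B'; case: ifP.
  have uus : u \notin us' by rewrite mem_filter eqxx.
  have uniq_us' : uniq us' by rewrite filter_uniq// undup_uniq.
  have E1 : [set w | forall v, v != u -> forall j, B v j (X v j w)] =
      \bigcap_(v in [set v | v \in us']) cyl (X v) K (B' v).
    apply/seteqP; split => w /= h.
      move=> v /=; rewrite mem_filter => /andP[vu _] j _; rewrite /B' (negbTE vu).
      exact: h.
    move=> v vu j; have [/andP[vus jk]|h'] := boolP ((v \in us) && (j < k)%N); last by rewrite Bk.
    have := h v; rewrite /= mem_filter vu mem_undup vus => /(_ isT j) /=.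
    by rewrite /B' (negbTE vu); apply; rewrite leq_max jk.
  have Ck' j : (K <= j)%N -> C j = setT.
    by rewrite geq_max => /andP[_]; exact: Ck.
  have E2 : [set w | forall v, v != u -> forall j, B v j (X v j w)] `&`
      offspring u @^-1` [set x | forall j, C j (x j)] =
      \bigcap_(v in [set v | v \in u :: us']) cyl (X v) K (B' v).
    rewrite (cylE _ Ck') E1; apply/seteqP; split => w /=.
      move=> [h1 h2] v /=; rewrite inE => /orP[/eqP ->|/h1//].
      by rewrite /B' eqxx.
    move=> h; split; last by have := h u; rewrite /= inE eqxx => /(_ isT); rewrite /B' eqxx.
    by move=> v vus; apply: h; rewrite /= inE vus orbT.
  rewrite E2 H//=; last by rewrite uus.
  rewrite E1 H// big_cons muleC; congr (_ * _)%E.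
  rewrite -(@offspring_law u); last by apply: sub_sigma_algebra; exists k', C.
  by rewrite (cylE _ Ck') /B' eqxx.
have step2 (A' : set T) (S' : set atom_seq) : away_cylinder u A' -> measurable S' ->
    P (A' `&` offspring u @^-1` S') = (P A' * law S')%E.
  move=> cA mS'.
  have mA' : measurable A' by apply: mAw; exact: sub_sigma_algebra.
  have fA : P A' \is a fin_num by rewrite ge0_fin_numE// ltP.
  (* Both sides are finite measures in [S']: the image of P restricted to [A'], and the offspring
     law scaled by P(A'). *)
  pose r : {nonneg R} := NngNum (fine_ge0 (measure_ge0 P A')).
  pose m1 : {measure set atom_seq -> \bar R} :=
    [the measure _ _ of pushforward (mrestr P mA') (offspring_mfun u)].
  transitivity (m1 (@measurable_offspring u) S'); first by rewrite setIC.
  transitivity (mscale r law S'); last by rewrite /mscale /= fineK.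
  apply: (@measure_unique _ R atom_seq seq_cylinder (fun=> setT)) => //.
  - exact: seq_cylinderI.
  - by move=> _; exact: seq_cylinderT.
  - by rewrite bigcup_const.
  - move=> B cB; suff : m1 (@measurable_offspring u) B = mscale r law B by [].
    rewrite /mscale /= fineK// -step1// setIC; exact: erefl.
  - move=> _; rewrite /m1 /= /pushforward /mrestr ltP//.
    by rewrite preimage_setT setTI.
pose r : {nonneg R} := NngNum (fine_ge0 (measure_ge0 law S)).
have fS : law S \is a fin_num by rewrite fin_num_measure.
pose m1 : {measure set (away u) -> \bar R} :=
  [the measure _ _ of pushforward (mrestr P (mO _ mS)) (away_mfun u)].
transitivity (m1 (@measurable_to_away u) A); first by [].
transitivity (mscale r (distribution P (away_mfun u)) A); last by rewrite /mscale /= fineK// muleC.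
apply: (@measure_unique _ R (away u) (away_cylinder u) (fun=> setT)) => //.
- exact: away_cylinderI.
- by move=> _; exact: away_cylinderT.
- by rewrite bigcup_const.
- move=> B cB.
  suff : m1 (@measurable_to_away u) B = mscale r (distribution P (away_mfun u)) B by [].
  rewrite /mscale /= fineK// muleC; exact: step2.
- move=> _; rewrite /m1 /= /pushforward /mrestr ltP//.
  by rewrite preimage_setT setTI; apply (mO _ mS).
Qed.

(** Replaces conditioning on everything except the offspring of [u]: the joint law of that
    sigma-algebra and of xi_u is a product measure, and Tonelli applies. *)
Lemma decouple u (f : away u * atom_seq -> \bar R) :
  measurable_fun setT f -> (forall z, 0 <= f z)%E ->
  (\int[P]_w f (w, offspring u w) = \int[P]_w \int[law]_x f (w, x))%E.
Proof.
move=> mf f0.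
have mp : measurable_fun setT (fun w => (w, offspring u w) : away u * atom_seq).
  by apply: measurable_fun_pair; [exact: measurable_to_away|exact: measurable_offspring].
pose pm : {mfun T >-> (away u * atom_seq)%type} :=
  HB.pack (fun w => (w, offspring u w) : away u * atom_seq)
    (isMeasurableFun.Build _ _ T _ (fun w => (w, offspring u w) : away u * atom_seq) mp).
have E : (\int[P]_w f (w, offspring u w) = \int[distribution P pm]_z f z)%E.
  by rewrite ge0_integral_pushforward// preimage_setT.
rewrite E.
transitivity (\int[distribution P (away_mfun u) \x law]_z f z)%E.
  apply: eq_measure_integral => A mA _; apply/esym.
  apply: (product_measure_unique (m' := distribution P pm)) => // B C mB mC.
  suff : P (B `&` offspring u @^-1` C) = (P B * law C)%E by [].
  exact: away_offspring_indep.
rewrite fubini_tonelli1// ge0_integral_pushforward// ?preimage_setT//.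
- exact: measurable_fun_fubini_tonelli_F.
- by move=> w _; exact: integral_ge0.
Qed.

End offspring_independence.

(** * Sums over countable types as series *)

Section countable_sums.
Context {R : realType} {U : countType}.

Definition enum_term (A : pred U) (a : U -> \bar R) (k : nat) : \bar R :=
  if pickle_inv k is Some u then (if A u then a u else 0%E) else 0%E.

Lemma enum_term_ge0 (A : pred U) (a : U -> \bar R) k : (forall u, A u -> 0 <= a u)%E -> (0 <= enum_term A a k)%E.
Proof.
by move=> a0; rewrite /enum_term; case: pickle_inv => // u; case: ifPn => // /a0.
Qed.

Lemma esum_series (A : pred U) (a : U -> \bar R) : (forall u, A u -> 0 <= a u)%E ->
  \esum_(u in [set u | A u]) a u = (\sum_(0 <= k <oo) enum_term A a k)%E.
Proof.
move=> a0.
pose N : pred nat := fun k => if pickle_inv k is Some u then A u else false.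
have -> : (\sum_(0 <= k <oo) enum_term A a k =
           \sum_(0 <= k <oo | N k) enum_term A a k)%E.
  rewrite [RHS]eseries_mkcond; apply: eq_eseriesr => k _.
  by rewrite /N /enum_term; case: pickle_inv => // u; case: ifP.
rewrite nneseries_esum; last by move=> k _; exact: enum_term_ge0.
rewrite (@reindex_esum _ _ _ [set u | A u] [set k | N k] (@pickle U)).
  apply: eq_esum => u Au; rewrite /enum_term pickleK_inv.
  by move: Au => /= ->.
split.
- by move=> u /= Au; rewrite /N pickleK_inv.
- by move=> u v _ _ /(pcan_inj (@pickleK_inv U)).
- move=> k /=; rewrite /N; case E: (pickle_inv k) => [u|//] Au.
  by exists u => //; have := @pickle_invK U k; rewrite E.
Qed.

Context {d : measure_display} {S : measurableType d}.

Lemma measurable_enum_term (A : pred U) (a : U -> S -> \bar R) k :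
  (forall u, A u -> measurable_fun setT (a u)) ->
  measurable_fun setT (fun x => enum_term A (a^~ x) k).
Proof.
move=> ma; rewrite /enum_term; case: pickle_inv => [u|]; last exact: measurable_cst.
by case E : (A u); [exact: ma|exact: measurable_cst].
Qed.

Lemma measurable_esum (A : pred U) (a : U -> S -> \bar R) :
  (forall u, A u -> measurable_fun setT (a u)) -> (forall u x, A u -> 0 <= a u x)%E ->
  measurable_fun setT (fun x => \esum_(u in [set u | A u]) a u x).
Proof.
move=> ma a0.
have -> : (fun x => \esum_(u in [set u | A u]) a u x) =
    (fun x => \sum_(0 <= k <oo) enum_term A (a^~ x) k)%E.
  by apply/funext => x; apply: esum_series => u Au; exact: a0.
apply: ge0_emeasurable_sum => [k x _ _|k _]; last exact: measurable_enum_term.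
by apply: enum_term_ge0 => u; exact: a0.
Qed.

Lemma integral_esum (mu : {measure set S -> \bar R}) (A : pred U) (a : U -> S -> \bar R) :
  (forall u, A u -> measurable_fun setT (a u)) -> (forall u x, A u -> 0 <= a u x)%E ->
  (\int[mu]_x (\esum_(u in [set u | A u]) a u x) =
   \esum_(u in [set u | A u]) \int[mu]_x a u x)%E.
Proof.
move=> ma a0.
under eq_integral => x _ do rewrite (esum_series (fun u => a0 u x)).
rewrite integral_nneseries//; last 2 first.
- by move=> k; exact: measurable_enum_term.
- by move=> k x _; apply: enum_term_ge0 => u; exact: a0.
rewrite [RHS]esum_series; last by move=> u Au; apply: integral_ge0 => x _; exact: a0.
apply: eq_eseriesr => k _; rewrite /enum_term; case: pickle_inv => [u|].
  by case: ifP => // _; rewrite integral0.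
by rewrite integral0.
Qed.

End countable_sums.

Lemma esum_nat_series (R : realType) (a : nat -> \bar R) : (forall i, 0 <= a i)%E ->
  \esum_(i in [set: nat]) a i = (\sum_(0 <= i <oo) a i)%E.
Proof. by move=> a0; rewrite nneseries_esumT. Qed.

Section weights.
Context {R : realType}.

Definition rwgt (v : \bar R) : R := fine (wgt v).

Lemma rwgtE v : wgt v = (rwgt v)%:E. Proof. by case: v. Qed.

Lemma rwgt_ge0 v : 0 <= rwgt v. Proof. by case: v => //= r; exact: expR_ge0. Qed.

Lemma wgt_ge0 (v : \bar R) : (0 <= wgt v)%E. Proof. by rewrite rwgtE lee_fin rwgt_ge0. Qed.

Lemma wgtD (v x : \bar R) : v != -oo%E -> x != -oo%E -> wgt (v + x)%E = (wgt v * wgt x)%E.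
Proof.
case: v => [v||//]; case: x => [x||//] _ _ /=; rewrite ?mul0e ?mule0//.
by rewrite opprD expRD.
Qed.

Lemma measurable_wgt : measurable_fun setT (@wgt R).
Proof.
have -> : @wgt R = fun v => if v \is a fin_num then (expR (- fine v))%:E else 0%E.
  by apply/funext => -[v||].
apply: measurable_fun_ifT => //.
  apply: (measurable_fun_bool true) => //=.
  rewrite setTI [X in measurable X](_ : _ = [set v : \bar R | v \is a fin_num]); last first.
    by apply/seteqP; split => v /=; case: (_ \is a _).
  by have := emeasurable_fin_num measurableT (@measurable_id _ (\bar R) setT); rewrite setTI.
apply/measurable_EFinP; apply: measurableT_comp => //.
by apply: measurableT_comp.
Qed.

Definition wgt_nng (v : \bar R) : {nonneg R} := NngNum (rwgt_ge0 v).

(* the point process x tilted by e^{-y}, as a measure on the line *)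
Definition atom_measure (x : atom_seq) : {measure set R -> \bar R} :=
  mseries (fun i => mscale (wgt_nng (x i)) (\d_(fine (x i)))) 0.

(** Integral of [f] against the tilted point process. An absent atom is read at the default
    [fine +oo = 0], harmless because its weight is 0. *)
Definition atom_sum (f : R -> \bar R) (x : nat -> \bar R) : \bar R :=
  (\sum_(0 <= i <oo) wgt (x i) * f (fine (x i)))%E.

Lemma integral_atom_measure (f : R -> \bar R) (x : atom_seq) :
  measurable_fun setT f -> (forall y, 0 <= f y)%E ->
  (\int[atom_measure x]_y f y = atom_sum f x)%E.
Proof.
move=> mf f0; rewrite ge0_integral_measure_series//.
apply: eq_eseriesr => i _; rewrite ge0_integral_mscale// integral_dirac//.
by rewrite diracT mul1e /= -rwgtE.
Qed.

Lemma measurable_atom_sum d (S : measurableType d) (g : S -> atom_seq) (f : S -> R -> \bar R) :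
  measurable_fun setT g -> measurable_fun setT (fun z => f z.1 z.2) ->
  (forall s y, 0 <= f s y)%E -> measurable_fun setT (fun s => atom_sum (f s) (g s)).
Proof.
move=> mg mf f0; apply: ge0_emeasurable_sum => [k s _ _|k _].
  by rewrite mule_ge0 ?wgt_ge0.
have mgk : measurable_fun setT (fun s => g s k).
  exact: (measurableT_comp (measurable_seq_coord k) mg).
apply: emeasurable_funM; first exact: (measurableT_comp measurable_wgt mgk).
apply: (measurableT_comp (f := fun z : S * R => f z.1 z.2)
  (g := fun s => (s, fine (g s k)))) => //.
apply: measurable_fun_pair => //.
exact: (measurableT_comp (@fine_measurable R setT measurableT) mgk).
Qed.

Lemma measurable_atom_measure (A : set R) : measurable A ->
  measurable_fun setT (fun x : atom_seq => atom_measure x A).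
Proof.
move=> mA.
have -> : (fun x : atom_seq => atom_measure x A) =
   (fun x : atom_seq => atom_sum (fun y => (\1_A y)%:E) x).
  apply/funext => x; rewrite -integral_atom_measure//; last exact/measurable_EFinP.
  by rewrite integral_indic// setIT.
apply: (measurable_atom_sum (f := fun _ y => (\1_A y)%:E)) => //.
apply/measurable_EFinP; apply: (measurableT_comp (f := \1_A : R -> R)) => //.
Qed.

End weights.

(** * The tilted step law F *)

Section step_measure.
Context {R : realType} (mu : probability (@atom_seq R) R).

(** The measure F of the theorem, as the expectation of the tilted point process. Here [mu] is the
    law of the atom sequence and not the intensity. *)
Definition step_measure (A : set R) : \bar R := (\int[mu]_x atom_measure x A)%E.

Let step_measure0 : step_measure set0 = 0%E.
Proof. by rewrite /step_measure; under eq_integral do rewrite measure0; rewrite integral0. Qed.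

Let step_measure_ge0 A : (0 <= step_measure A)%E.
Proof. by apply: integral_ge0 => x _; exact: measure_ge0. Qed.

Let step_measure_semi_sigma_additive : semi_sigma_additive step_measure.
Proof.
move=> A mA tA mUA; rewrite [X in _ --> X](_ : _ = \sum_(0 <= n <oo) step_measure (A n))%E.
  by apply: is_cvg_nneseries => n _ _; exact: step_measure_ge0.
rewrite -integral_nneseries//; last by move=> n; exact: measurable_atom_measure.
apply: eq_integral => x _; rewrite measure_bigcup//.
by apply: eq_eseriesl => i; rewrite in_setT.
Qed.

HB.instance Definition _ := isMeasure.Build _ _ _ step_measure
  step_measure0 step_measure_ge0 step_measure_semi_sigma_additive.

Import HBNNSimple.

Let integral_step_measure_nnsfun (f : {nnsfun R >-> R}) :
  (\int[step_measure]_y (f y)%:E = \int[mu]_x \int[atom_measure x]_y (f y)%:E)%E.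
Proof.
under [in LHS]eq_integral do rewrite fimfunE -fsumEFin//.
rewrite ge0_integral_fsum//; last 2 first.
  - by move=> r; exact/measurable_EFinP/measurableT_comp.
  - by move=> r z _; rewrite EFinM nnfun_muleindic_ge0.
under [in RHS]eq_integral.
  move=> y _.
  under eq_integral.
    by move=> z _; rewrite fimfunE -fsumEFin//; over.
  rewrite /= ge0_integral_fsum//; last 2 first.
    - by move=> r; exact/measurable_EFinP/measurableT_comp.
    - by move=> r z _; rewrite EFinM nnfun_muleindic_ge0.
  under eq_fsbigr.
    move=> r _.
    rewrite (integralZl_indic _ (fun r => f @^-1` [set r]))//; last first.
      by move=> r0; rewrite preimage_nnfun0.
    rewrite integral_indic// setIT.
    over.
  over.
rewrite /= ge0_integral_fsum//; last 2 first.
  - move=> r; apply: measurable_funeM.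
    exact: measurable_atom_measure.
  - move=> n y _.
    have := mulemu_ge0 (fun n => f @^-1` [set n]).
    by apply; exact: preimage_nnfun0.
apply: eq_fsbigr => r _.
rewrite (integralZl_indic _ (fun r => f @^-1` [set r]))//; last first.
  exact: preimage_nnfun0.
rewrite /= integral_indic// setIT.
have [r0|r0] := leP 0%R r.
  rewrite ge0_integralZl//.
  exact: measurable_atom_measure.
rewrite preimage_nnfun0// measure0 mule0 integral0_eq// => y _.
by rewrite measure0 mule0.
Qed.

(** One-generation many-to-one identity. Simple functions come first, then monotone convergence
    under three integrals: over F, over each tilted point process and over its law. *)
Lemma integral_step_measure (f : R -> \bar R) : measurable_fun setT f ->
  (forall y, 0 <= f y)%E ->
  (\int[step_measure]_y f y = \int[mu]_x atom_sum f x)%E.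
Proof.
move=> mf f0.
transitivity (\int[mu]_x \int[atom_measure x]_y f y)%E; last first.
  by apply: eq_integral => x _; exact: integral_atom_measure.
pose f_ := nnsfun_approx measurableT mf.
transitivity (\int[step_measure]_z (lim ((f_ n z)%:E @[n --> \oo])))%E.
  by apply/eq_integral => z _; apply/esym/cvg_lim => //=; exact: cvg_nnsfun_approx.
rewrite monotone_convergence//; last 3 first.
  by move=> n; exact/measurable_EFinP.
  by move=> n z _; rewrite lee_fin.
  by move=> z _ a b ab; rewrite lee_fin; exact/lefP/nd_nnsfun_approx.
rewrite (_ : (fun _ => _) =
    (fun n => \int[mu]_y (\int[atom_measure y]_z (f_ n z)%:E)))%E//; last first.
  by apply/funext => n; rewrite integral_step_measure_nnsfun.
transitivity (\int[mu]_y lim ((\int[atom_measure y]_z (f_ n z)%:E) @[n --> \oo]))%E.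
  rewrite -monotone_convergence//; last 3 first.
  - move=> n.
    have -> : (fun y : atom_seq => \int[atom_measure y]_z (f_ n z)%:E)%E =
      (fun y : atom_seq => atom_sum (fun z => (f_ n z)%:E) y).
      apply/funext => y; apply: integral_atom_measure.
        exact/measurable_EFinP.
      by move=> z; rewrite lee_fin.
    apply: (measurable_atom_sum (f := fun _ z => (f_ n z)%:E)) => //.
    + by apply/measurable_EFinP; exact: (measurableT_comp (f := f_ n)).
    + by move=> ? z; rewrite lee_fin.
  - by move=> n y _; apply: integral_ge0 => // z _; rewrite lee_fin.
  - move=> y _ a b ab; apply: ge0_le_integral => //.
    + by move=> z _; rewrite lee_fin.
    + exact/measurable_EFinP.
    + exact/measurable_EFinP.
    + by move=> z _; rewrite lee_fin; exact/lefP/nd_nnsfun_approx.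
apply: eq_integral => y _; rewrite -monotone_convergence//; last 3 first.
  - by move=> n; exact/measurable_EFinP.
  - by move=> n z _; rewrite lee_fin.
  - by move=> z _ a b ab; rewrite lee_fin; exact/lefP/nd_nnsfun_approx.
by apply: eq_integral => z _; apply/cvg_lim => //; exact: cvg_nnsfun_approx.
Qed.

Hypothesis mu1 : (\int[mu]_x atom_sum (fun=> 1%E) x = 1)%E.

Let step_measureT : step_measure setT = 1%E.
Proof.
rewrite -mu1 -integral_step_measure//.
by rewrite integral_cst// mul1e.
Qed.

Definition step_prob : probability R R :=
  HB.pack step_measure (Measure_isProbability.Build _ _ _ step_measure step_measureT).

Lemma integral_step_prob (f : R -> \bar R) : measurable_fun setT f ->
  (forall y, 0 <= f y)%E ->
  (\int[step_prob]_y f y = \int[mu]_x atom_sum f x)%E.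
Proof. exact: integral_step_measure. Qed.

End step_measure.

(** * Generation sums and the many-to-one identity *)

Section generation_sums.
Context {d : measure_display} {T : measurableType d} {R : realType}.
Variables (P : probability T R) (X : vertex -> nat -> T -> \bar R).
Hypotheses (HX : iid_copies P X) (HE : point_process_encoding X).

Lemma V_neq u w : V X u w != -oo%E.
Proof.
elim: u => [//|j u IH] /=; have [Xu _] := HE u j w.
by move: IH Xu; case: (V X u w) => [v||]//; case: (X u j w).
Qed.

Lemma X_neq u j w : X u j w != -oo%E.
Proof. by have [Xu _] := HE u j w. Qed.

(** The position of [v] depends only on the offspring of its strict ancestors, which are shorter
    than [u] and so differ from [u]. *)
Lemma measurable_V_away v u : (size v <= size u)%N ->
  measurable_fun setT (V X v : away X u -> \bar R).
Proof.
elim: v => [|j v IH] /= vu; first exact: measurable_cst.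
apply: emeasurable_funD; first exact: IH (ltnW vu).
by apply: measurable_away_coord; apply: contraTneq vu => ->; rewrite ltnn.
Qed.

Lemma measurable_V u : measurable_fun setT (V X u).
Proof. by have := measurable_from_away HX (measurable_V_away (leqnn (size u))). Qed.

Lemma measurable_offspring_away v u : v != u ->
  measurable_fun setT (offspring X v : away X u -> atom_seq).
Proof.
move=> vu.
apply: (@measurability _ _ (away X u) atom_seq setT (offspring X v) seq_cylinder erefl).
move=> _ [_ [k [B [mB Bk ->]]] <-]; rewrite setTI.
have -> : offspring X v @^-1` [set x | forall j, B j (x j)] =
    \bigcap_j (X v j @^-1` B j).
  by apply/seteqP; split => w h j; [move=> _|]; exact: h.
apply: bigcapT_measurable => j; rewrite -[Y in measurable Y]setTI.
exact: measurable_away_coord vu measurableT _ (mB j).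
Qed.

Definition gsum (n : nat) (h : R -> \bar R) (w : T) : \bar R :=
  \esum_(u in [set u : vertex | size u == n]) (wgt (V X u w) * h (fine (V X u w)))%E.

(** A sum over the children of generation [n] with weight e^(-V) at the child. The kernel sees the
    parent's position and the displacement separately, so that children can be sorted by the size of
    their displacement. *)
Definition gen_sum (n : nat) (chi : R -> R -> \bar R) (w : T) : \bar R :=
  \esum_(u in [set u : vertex | size u == n])
     (wgt (V X u w) * atom_sum (chi (fine (V X u w))) (offspring X u w))%E.

Let genE n : [set u : vertex | size u = n] = [set u : vertex | size u == n].
Proof. by apply/seteqP; split => u /= /eqP. Qed.

Lemma WnE n w : Wn X n w = gsum n (fun=> 1%E) w.
Proof. by rewrite /Wn genE; apply: eq_esum => u _; rewrite mule1. Qed.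

Lemma ZbarE n t w : Zbar X n t w = gsum n (fun v => (t < v)%R%:R%:E) w.
Proof.
rewrite /Zbar genE; apply: eq_esum => u _.
case: (V X u w) => [v||] /=; rewrite ?mul0e//.
by case: ifP => _; rewrite ?mule1 ?mule0.
Qed.

Lemma atom_sum_ge0 (f : R -> \bar R) x : (forall y, 0 <= f y)%E -> (0 <= atom_sum f x)%E.
Proof. by move=> f0; apply: nneseries_ge0 => i _ _; rewrite mule_ge0 ?wgt_ge0. Qed.

Lemma gsumS n (h : R -> \bar R) w : (forall v, 0 <= h v)%E ->
  gsum n.+1 h w = gen_sum n (fun v y => h (v + y)%R) w.
Proof.
move=> h0; rewrite /gen_sum.
pose a (u : vertex) (i : nat) : \bar R :=
  (wgt (V X u w) * (wgt (X u i w) * h (fine (V X u w) + fine (X u i w))%R))%E.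
have a0 u i : (0 <= a u i)%E by rewrite !mule_ge0 ?wgt_ge0.
transitivity (\esum_(u in [set u : vertex | size u == n]) \esum_(i in [set: nat]) a u i).
  rewrite esum_esum//; pose e (k : vertex * nat) : vertex := k.2 :: k.1.
  rewrite /gsum (@reindex_esum _ _ _ ([set u : vertex | size u == n] `*`` (fun=> setT)) _ e).
    apply: eq_esum => -[u i] /= _; rewrite /a wgtD ?V_neq ?X_neq// -muleA.
    have := V_neq u w; have := X_neq u i w.
    by case: (V X u w) => [v||]//; case: (X u i w) => [x||]//=; rewrite !(mul0e, mule0).
  split.
  - by move=> [u i] [/= /eqP <- _].
  - by move=> [u i] [u' i'] _ _ [-> ->].
  - by move=> [|i u]//= un; exists (u, i).
apply: eq_esum => u _; rewrite esum_nat_series//.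
rewrite /a rwgtE nneseriesZl// => i _.
by rewrite mule_ge0 ?wgt_ge0.
Qed.

Lemma eq_gsum n (h f : R -> \bar R) w : (forall v, h v = f v) -> gsum n h w = gsum n f w.
Proof. by move=> hf; apply: eq_esum => u _; rewrite hf. Qed.

Lemma gsum_ge0 n h w : (forall v, 0 <= h v)%E -> (0 <= gsum n h w)%E.
Proof. by move=> h0; apply: esum_ge0 => u _; rewrite mule_ge0 ?wgt_ge0. Qed.

Lemma gen_sum_ge0 n chi w : (forall v y, 0 <= chi v y)%E -> (0 <= gen_sum n chi w)%E.
Proof. by move=> c0; apply: esum_ge0 => u _; rewrite mule_ge0 ?wgt_ge0 ?atom_sum_ge0. Qed.

Lemma measurable_wgtV_away v u : (size v <= size u)%N ->
  measurable_fun setT (fun w : away X u => wgt (V X v w)).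
Proof. by move=> vu; exact: (measurableT_comp measurable_wgt (measurable_V_away vu)). Qed.

Lemma measurable_fineV_away v u : (size v <= size u)%N ->
  measurable_fun setT (fun w : away X u => fine (V X v w)).
Proof.
by move=> vu; exact: (measurableT_comp (@fine_measurable R setT measurableT) (measurable_V_away vu)).
Qed.

Lemma measurable_gterm_away (h : R -> \bar R) v u : (size v <= size u)%N ->
  measurable_fun setT h ->
  measurable_fun setT (fun w : away X u => wgt (V X v w) * h (fine (V X v w)))%E.
Proof.
move=> vu mh; apply: emeasurable_funM; first exact: measurable_wgtV_away.
exact: (measurableT_comp mh (measurable_fineV_away vu)).
Qed.

Lemma measurable_gsum_away n (h : R -> \bar R) u : (n <= size u)%N ->
  measurable_fun setT h -> (forall v, 0 <= h v)%E ->
  measurable_fun setT (gsum n h : away X u -> \bar R).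
Proof.
move=> nu mh h0; apply: measurable_esum => [v /eqP vn|v w _].
  by apply: measurable_gterm_away => //; rewrite vn.
by rewrite mule_ge0 ?wgt_ge0.
Qed.

Lemma measurable_gsum n (h : R -> \bar R) : measurable_fun setT h ->
  (forall v, 0 <= h v)%E -> measurable_fun setT (gsum n h).
Proof.
move=> mh h0.
have nu : (n <= size (nseq n 0%N : vertex))%N by rewrite size_nseq.
by have := measurable_from_away HX (measurable_gsum_away nu mh h0).
Qed.

Let measurable_pair_chi (chi : R -> R -> \bar R) d' (S : measurableType d') (g : S -> R) :
  measurable_fun setT (fun z : R * R => chi z.1 z.2) -> measurable_fun setT g ->
  measurable_fun setT (fun z : S * R => chi (g z.1) z.2).
Proof.
move=> mc mg.
apply: (measurableT_comp (f := fun z : R * R => chi z.1 z.2)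
  (g := fun z : S * R => (g z.1, z.2))) => //.
apply: measurable_fun_pair; last exact: measurable_snd.
by apply: (measurableT_comp mg); exact: measurable_fst.
Qed.

Lemma measurable_gen_term_away (chi : R -> R -> \bar R) v u :
  measurable_fun setT (fun z : R * R => chi z.1 z.2) -> (forall v y, 0 <= chi v y)%E ->
  (size v <= size u)%N -> v != u ->
  measurable_fun setT (fun w : away X u =>
    wgt (V X v w) * atom_sum (chi (fine (V X v w))) (offspring X v w))%E.
Proof.
move=> mc c0 vu v'; apply: emeasurable_funM; first exact: measurable_wgtV_away.
apply: (measurable_atom_sum (S := away X u) (g := offspring X v)
  (f := fun w => chi (fine (V X v w)))) => //.
  exact: measurable_offspring_away.
exact: (measurable_pair_chi (S := away X u) mc (measurable_fineV_away vu)).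
Qed.

Lemma measurable_gen_term_pair (chi : R -> R -> \bar R) u :
  measurable_fun setT (fun z : R * R => chi z.1 z.2) -> (forall v y, 0 <= chi v y)%E ->
  measurable_fun setT (fun z : away X u * atom_seq =>
    atom_sum (chi (fine (V X u z.1))) z.2)%E.
Proof.
move=> mc c0.
apply: (measurable_atom_sum (S := (away X u * atom_seq)%type) (g := snd)
  (f := fun z => chi (fine (V X u z.1)))) => //.
have mg : measurable_fun setT (fun z : away X u * @atom_seq R => fine (V X u z.1)).
  exact: (measurableT_comp (measurable_fineV_away (leqnn (size u))) measurable_fst).
exact: (measurable_pair_chi mc mg).
Qed.

Lemma measurable_gen_term (chi : R -> R -> \bar R) u :
  measurable_fun setT (fun z : R * R => chi z.1 z.2) -> (forall v y, 0 <= chi v y)%E ->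
  measurable_fun setT (fun w =>
    wgt (V X u w) * atom_sum (chi (fine (V X u w))) (offspring X u w))%E.
Proof.
move=> mc c0; apply: emeasurable_funM.
  exact: (measurableT_comp measurable_wgt (measurable_V u)).
apply: (measurable_atom_sum (g := offspring X u)
  (f := fun w => chi (fine (V X u w)))) => //; first exact: (measurable_offspring HX).
have mg : measurable_fun setT (fun w => fine (V X u w)).
  exact: (measurableT_comp (@fine_measurable R setT measurableT) (measurable_V u)).
exact: (measurable_pair_chi mc mg).
Qed.

Lemma measurable_gen_sum n (chi : R -> R -> \bar R) :
  measurable_fun setT (fun z : R * R => chi z.1 z.2) -> (forall v y, 0 <= chi v y)%E ->
  measurable_fun setT (gen_sum n chi).
Proof.
move=> mc c0; apply: measurable_esum => [v _|v w _]; first exact: measurable_gen_term.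
by rewrite mule_ge0 ?wgt_ge0 ?atom_sum_ge0.
Qed.

Hypothesis law1 : (\int[law HX]_x atom_sum (fun=> 1%E) x = 1)%E.

Let F := step_prob law1.

Lemma measurable_chi_mean (chi : R -> R -> \bar R) :
  measurable_fun setT (fun z : R * R => chi z.1 z.2) -> (forall v y, 0 <= chi v y)%E ->
  measurable_fun setT (fun v => \int[F]_y chi v y)%E.
Proof.
by move=> mc c0; exact: (@measurable_fun_fubini_tonelli_F _ _ _ _ _ F (fun z => chi z.1 z.2)).
Qed.

Lemma measurable_chi_section (chi : R -> R -> \bar R) v :
  measurable_fun setT (fun z : R * R => chi z.1 z.2) -> measurable_fun setT (chi v).
Proof.
move=> mc; apply: (measurableT_comp (f := fun z : R * R => chi z.1 z.2)
  (g := fun y => (v, y))) => //.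
exact: measurable_fun_pair.
Qed.

(** Vertex by vertex: the position of [u] is measurable away from [u], so its atoms can be
    integrated out first, which turns their tilted sum into an integral against F. *)
Lemma integral_gen_sum n (chi : R -> R -> \bar R) :
  measurable_fun setT (fun z : R * R => chi z.1 z.2) -> (forall v y, 0 <= chi v y)%E ->
  (\int[P]_w gen_sum n chi w = \int[P]_w gsum n (fun v => \int[F]_y chi v y) w)%E.
Proof.
move=> mc c0.
have i0 v : (0 <= \int[F]_y chi v y)%E by exact: integral_ge0.
rewrite integral_esum => [|v _|v w _]; last 2 first.
- exact: measurable_gen_term.
- by rewrite mule_ge0 ?wgt_ge0 ?atom_sum_ge0.
rewrite integral_esum => [|v _|v w _]; last 2 first.
- exact: (measurable_from_away HX (measurable_gterm_away (leqnn (size v)) (measurable_chi_mean mc c0))).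
- by rewrite mule_ge0 ?wgt_ge0.
apply: eq_esum => u _.
rewrite (decouple HX (u := u) (f := fun z => wgt (V X u z.1) * atom_sum (chi (fine (V X u z.1))) z.2)%E).
- apply: eq_integral => w _ /=.
  have mcs := measurable_chi_section (fine (V X u w)) mc.
  rewrite integral_step_prob// ge0_integralZl ?wgt_ge0//; last by move=> x _; exact: atom_sum_ge0.
  have mz : measurable_fun setT (fun z : @atom_seq R * R => chi (fine (V X u w)) z.2).
    exact: (measurableT_comp mcs measurable_snd).
  exact: (measurable_atom_sum (g := id) (f := fun=> chi (fine (V X u w))) _ mz).
- apply: emeasurable_funM; last exact: measurable_gen_term_pair.
  exact: (measurableT_comp (measurable_wgtV_away (leqnn (size u))) measurable_fst).
- by move=> z; rewrite mule_ge0 ?wgt_ge0 ?atom_sum_ge0.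
Qed.

Let measurable_shift (h : R -> \bar R) : measurable_fun setT h ->
  measurable_fun setT (fun z : R * R => h (z.1 + z.2)).
Proof. by move=> mh; apply: (measurableT_comp mh); exact: measurable_funD. Qed.

Lemma integral_gsumS n (h : R -> \bar R) : measurable_fun setT h -> (forall v, 0 <= h v)%E ->
  (\int[P]_w gsum n.+1 h w = \int[P]_w gsum n (fun v => \int[F]_y h (v + y)%R) w)%E.
Proof.
move=> mh h0; under eq_integral do rewrite gsumS//.
by rewrite (integral_gen_sum _ (chi := fun v y => h (v + y)%R))//; exact: measurable_shift.
Qed.

Lemma gsum0 (h : R -> \bar R) w : (0 <= h 0%R)%E -> gsum 0 h w = h 0%R.
Proof.
move=> h0; rewrite /gsum.
have -> : [set u : vertex | size u == 0%N] = [set [::]].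
  by apply/seteqP; split => [[|]|u ->].
by rewrite esum_set1 /= oppr0 expR0 mul1e.
Qed.

Lemma gsum_le n (h g : R -> \bar R) w : (forall v, h v <= g v)%E -> (gsum n h w <= gsum n g w)%E.
Proof. by move=> hg; apply: le_esum => u _; rewrite lee_wpmul2l ?wgt_ge0. Qed.

Lemma gsumD n (h g : R -> \bar R) w : (forall v, 0 <= h v)%E -> (forall v, 0 <= g v)%E ->
  gsum n (fun v => h v + g v)%E w = (gsum n h w + gsum n g w)%E.
Proof.
move=> h0 g0; rewrite /gsum -esumD; last 2 first.
- by move=> u _; rewrite mule_ge0 ?wgt_ge0.
- by move=> u _; rewrite mule_ge0 ?wgt_ge0.
by apply: eq_esum => u _; rewrite ge0_muleDr.
Qed.

Lemma gsumZ n (k : R) (h : R -> \bar R) w : 0 <= k -> (forall v, 0 <= h v)%E ->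
  gsum n (fun v => k%:E * h v)%E w = (k%:E * gsum n h w)%E.
Proof.
move=> k0 h0; rewrite /gsum !esum_series; first last.
- by move=> u _; rewrite mule_ge0 ?wgt_ge0// mule_ge0// lee_fin.
- by move=> u _; rewrite mule_ge0 ?wgt_ge0.
rewrite -nneseriesZl; last by move=> i _; apply: enum_term_ge0 => u _; rewrite mule_ge0 ?wgt_ge0.
apply: eq_eseriesr => i _; rewrite /enum_term; case: pickle_inv => [u|]; last by rewrite mule0.
by case: ifP => _; rewrite ?mule0// muleCA.
Qed.

End generation_sums.

(** * Moments of martingale increments *)

Section power_inequalities.
Context {R : realType}.
Variable g : R.
Hypotheses (g1 : 1 < g) (g2 : g < 2).

Lemma powR_mono (x y : R) : 0 <= x -> x <= y -> x `^ g <= y `^ g.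
Proof.
move=> x0 xy; have hg := g1; apply: ge0_ler_powR; rewrite ?nnegrE//; first by lra.
exact: le_trans xy.
Qed.

(** Tangent at 1 of a concave power, obtained from e^x >= 1 + x at two points. *)
Lemma powR_le_affine (s y : R) : 0 < s -> s <= 1 -> 0 <= y ->
  y `^ s <= 1 + s * (y - 1).
Proof.
move=> s0 s1; rewrite le_eqVlt => /predU1P[<-|y0].
  by rewrite powR0 ?gt_eqF//; lra.
have -> : y = expR (ln y) by rewrite lnK ?posrE.
rewrite -expRM mulrC; set a := ln y.
have e1 := expR_ge1Dx ((1 - s) * a); have e2 := expR_ge1Dx (- (s * a)).
have e0 := expR_gt0 (s * a).
have h1 : expR (s * a) * (1 + (1 - s) * a) <= expR a.
  have -> : expR a = expR (s * a) * expR ((1 - s) * a) by rewrite -expRD; congr expR; ring.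
  by rewrite ler_pM2l.
have h2 : expR (s * a) * (1 - s * a) <= 1.
  have E : 1 = expR (s * a) * expR (- (s * a)) :> R by rewrite -expRD subrr expR0.
  by rewrite [leRHS]E ler_pM2l.
have h3 := ler_wpM2l (ltW s0) h1.
have s1' : 0 <= 1 - s by lra.
have h4 := ler_wpM2l s1' h2.
lra.
Qed.

Lemma powR_ge_affine (y : R) : 0 <= y -> 1 + g * (y - 1) <= y `^ g.
Proof.
move=> y0; have hg := g1.
have s1 : g^-1 <= 1 by rewrite invf_le1; lra.
have s0 : 0 < g^-1 by rewrite invr_gt0; lra.
have := powR_le_affine s0 s1 (powR_ge0 y g).
rewrite -powRrM divff; last by rewrite gt_eqF//; lra.
rewrite powRr1//.
rewrite -(@ler_pM2l _ g); last by lra.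
by rewrite mulrDr mulrA divff ?gt_eqF//; lra.
Qed.

(** Write y^g = y y^(g-1) and use the tangent bound for the exponent g - 1 in (0, 1). *)
Lemma powR_le_quad (y : R) : 0 <= y -> y `^ g <= 1 + g * (y - 1) + (y - 1) ^+ 2.
Proof.
move=> y0; have hg := g1; have hg2 := g2.
have [yy|yy] := eqVneq y 0.
  by rewrite yy powR0 ?gt_eqF//; lra.
have yp : 0 < y by rewrite lt_neqAle eq_sym yy.
have -> : y `^ g = y * y `^ (g - 1).
  rewrite -{2}(powRr1 y0) -powRD; last by rewrite yy implybT.
  by congr (_ `^ _); lra.
have := @powR_le_affine (g - 1) y => h; have {}h := ler_wpM2l y0 (h _ _ y0).
apply: le_trans (h _ _) _; [lra|lra|].
have : 0 <= (2 - g) * (y - 1) ^+ 2 by rewrite mulr_ge0 ?sqr_ge0//; lra.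
rewrite expr2; lra.
Qed.

(** Case a = 1 of the inequality below. For |t| <= 1, the quadratic bound and t^2 <= |t|^g; for t >
    1, 1 + t <= 2t and 2^g <= 4; for t < -1, |1 + t| <= |t| and the negative g t is recovered from
    |t| <= |t|^g. *)
Let vbe1 (t : R) : `|1 + t| `^ g <= 1 + g * t + 4 * `|t| `^ g.
Proof.
have hg := g1; have hg2 := g2.
have [t1|t1] := leP `|t| 1.
  have := t1; rewrite ler_norml => /andP[ta tb].
  have t0 : 0 <= 1 + t by lra.
  rewrite ger0_norm//; have := powR_le_quad t0.
  have -> : 1 + t - 1 = t by lra.
  have : t ^+ 2 <= `|t| `^ g.
    have [->|tn] := eqVneq t 0; first by rewrite expr0n powR_ge0.
    rewrite -real_normK ?num_real// -powR_mulrn//.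
    by rewrite ger_powR// ?normr_gt0 ?tn//; lra.
  have := powR_ge0 `|t| g; lra.
have two : 2 `^ g <= 4 :> R.
  have -> : 4 = 2 `^ 2 :> R by rewrite powR_mulrn//; lra.
  by rewrite ler_powR//; lra.
have tg : `|t| <= `|t| `^ g.
  by rewrite -[leLHS]powRr1// ler_powR//; lra.
have [t0|t0] := leP 0 t.
  rewrite (ger0_norm t0) in t1 tg *.
  apply: (@le_trans _ _ ((2 * t) `^ g)).
    by apply: powR_mono => //; rewrite ger0_norm; lra.
  rewrite powRM//.
  have := ler_wpM2r (powR_ge0 t g) two.
  have : 0 <= g * t by rewrite mulr_ge0//; lra.
  lra.
rewrite (ltr0_norm t0) in t1 tg *.
apply: (@le_trans _ _ ((- t) `^ g)).
  by apply: powR_mono => //; rewrite ler0_norm; lra.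
have : g * - t <= 2 * (- t) by rewrite ler_wpM2r//; lra.
lra.
Qed.

(* the pointwise von Bahr-Esseen inequality; k is the derivative of [`|.| `^ g] at a *)
Lemma powR_vbe (a : R) : exists k, forall z,
  `|a + z| `^ g <= `|a| `^ g + k * z + 4 * `|z| `^ g.
Proof.
have [->|a0] := eqVneq a 0.
  exists 0 => z; rewrite add0r normr0 powR0 ?mul0r ?add0r ?gt_eqF//; last by have := g1; lra.
  have := powR_ge0 `|z| g; lra.
exists (g * `|a| `^ g / a) => z.
have zE : z = a * (z / a) by rewrite mulrC divfK.
have -> : a + z = a * (1 + z / a) by rewrite mulrDr mulr1 -zE.
rewrite normrM powRM//.
have -> : `|z| `^ g = `|a| `^ g * `|z / a| `^ g by rewrite {1}zE normrM powRM.
have := ler_wpM2l (powR_ge0 `|a| g) (vbe1 (z / a)); lra.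
Qed.

Lemma powR_dist_le (r h : R) : 0 <= r -> 0 <= h -> `|r - h| `^ g <= r `^ g + h `^ g.
Proof.
have hg := g1.
wlog rh : r h / h <= r.
  move=> H r0 h0; have [hr|/ltW hr] := leP h r; first exact: H.
  by rewrite distrC [leRHS]addrC; exact: H.
move=> r0 h0; rewrite ger0_norm; last by lra.
have : (r - h) `^ g <= r `^ g by apply: powR_mono; lra.
have := powR_ge0 h g; lra.
Qed.

Context {d : measure_display} {S : measurableType d} (mu : probability S R).

Lemma powR_jensen (r : S -> R) : (forall x, 0 <= r x) -> rintegrable mu r ->
  rintegrable mu (fun x => r x `^ g) ->
  (\int[mu]_x r x) `^ g <= \int[mu]_x r x `^ g.
Proof.
move=> r0 ir irg; set h := \int[mu]_x r x.
have hg := g1.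
have [->|hn] := eqVneq h 0.
  by rewrite powR0 ?gt_eqF//; [apply: rint_ge0 => x; exact: powR_ge0|lra].
have h0 : 0 < h by rewrite lt_neqAle eq_sym hn rint_ge0.
have -> : h `^ g = \int[mu]_x (h `^ g * (1 - g) + h `^ g * g / h * r x).
  rewrite (rintD (mu:=mu)); [|by rint_tac|by rint_tac].
  by rewrite rint_cst rintZ// -/h; field.
apply: rint_le => // [|x]; first by rint_tac.
have -> : r x `^ g = h `^ g * (r x / h) `^ g.
  by rewrite -powRM ?divr_ge0 ?(ltW h0)// mulrC divfK.
have rh : 0 <= r x / h by rewrite divr_ge0// ltW.
have := ler_wpM2l (powR_ge0 h g) (powR_ge_affine rh); lra.
Qed.

Lemma measurable_powR_comp (f : S -> R) : measurable_fun setT f ->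
  measurable_fun setT (fun x => f x `^ g).
Proof. by move=> mf; exact: (measurableT_comp (measurable_powR g)). Qed.

(** The linear term of the pointwise inequality integrates to 0 by centring. In the constant 8, a
    factor 4 comes from that inequality and 2 from |y - E y|^g <= y^g + (E y)^g followed by
    Jensen. *)
Lemma centered_powR_integral (y : S -> \bar R) (a b : R) :
  measurable_fun setT y -> (forall x, 0 <= y x)%E -> (\int[mu]_x y x < +oo)%E -> 0 <= b ->
  (\int[mu]_x (`|a + b * (fine (y x) - fine (\int[mu]_x y x))| `^ g)%:E <=
   (`|a| `^ g)%:E + (8 * b `^ g)%:E * \int[mu]_x (y x) `^ g)%E.
Proof.
move=> my y0 iy b0; set h := fine _.
have hg := g1.
have ih0 : (0 <= \int[mu]_x y x)%E by exact: integral_ge0.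
have [->|bn] := eqVneq b 0.
  under eq_integral do rewrite mul0r addr0.
  rewrite integral_cst//= [X in (_ * X)%E]probability_setT mule1.
  by rewrite powR0 ?gt_eqF//; [rewrite mulr0 mul0e adde0|lra].
have bp : 0 < b by rewrite lt_neqAle eq_sym bn.
have b8 : 0 < 8 * b `^ g by rewrite mulr_gt0// powR_gt0.
have [->|fin] := eqVneq (\int[mu]_x (y x) `^ g)%E +oo%E.
  by rewrite gt0_muley ?lte_fin// addeC; apply: leey.
set r := fun x => fine (y x).
have r0 x : 0 <= r x by rewrite fine_ge0.
have mr : measurable_fun setT r.
  exact: (measurableT_comp (@fine_measurable R setT measurableT) my).
have yr : {ae mu, forall x, y x = (r x)%:E}.
  have iy' : mu.-integrable setT y.
    apply/integrableP; split => //.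
    by under eq_integral do rewrite gee0_abs//.
  have := integrable_ae measurableT iy'.
  by apply: filterS => x /(_ I) fy; rewrite /r fineK.
have Ey : (\int[mu]_x y x = \int[mu]_x (r x)%:E)%E.
  apply: ge0_ae_eq_integral => //; first by apply/measurable_EFinP.
    by move=> x _; rewrite lee_fin.
  by apply: (filterS _ yr) => x ->.
have ir : rintegrable mu r by apply: rintegrable_ge0 => //; rewrite -Ey.
have hE : h = \int[mu]_x r x by rewrite /h Ey.
have h0 : 0 <= h by rewrite fine_ge0.
have mrg := measurable_powR_comp mr.
have Eg : (\int[mu]_x (y x) `^ g = \int[mu]_x (r x `^ g)%:E)%E.
  apply: ge0_ae_eq_integral => //.
  - exact: (measurableT_comp (measurable_poweR g) my).
  - exact/measurable_EFinP.
  - by move=> x _; exact: poweR_ge0.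
  - by move=> x _; rewrite lee_fin powR_ge0.
  - by apply: (filterS _ yr) => x ->.
have irg : rintegrable mu (fun x => r x `^ g).
  apply: rintegrable_ge0 => //; first by move=> x; exact: powR_ge0.
  by rewrite -Eg ltey.
have J := powR_jensen r0 ir irg; rewrite -hE in J.
have [k Hk] := powR_vbe a.
rewrite Eg (rint_EFin irg).
pose up x := `|a| `^ g + (k * b * (r x - h) + 4 * b `^ g * (r x `^ g + h `^ g)).
have iup : rintegrable mu up by rewrite /up; rint_tac.
apply: (@le_trans _ _ (\int[mu]_x (up x)%:E)%E).
  apply: ge0_le_integral => //.
  - apply/measurable_EFinP; apply: measurable_powR_comp; apply: measurableT_comp => //.
    apply: measurable_funD => //; apply: measurable_funM => //; exact: measurable_funB.
  - exact: (measurable_int mu iup).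
  - move=> x _; rewrite lee_fin; apply: (le_trans (Hk _)); rewrite /up -addrA lerD2l -/(r x).
    have := powR_dist_le (r0 x) h0.
    rewrite normrM (ger0_norm b0) powRM// => hd.
    have := ler_wpM2l (powR_ge0 b g) hd; lra.
rewrite (rint_EFin iup) -EFinM -EFinD lee_fin /up.
do 2! (rewrite (rintD (mu:=mu)); [|by rint_tac|by rint_tac]).
rewrite rint_cst rintZ; last by rint_tac.
rewrite (rintB (mu:=mu))//; last by rint_tac.
rewrite rint_cst -hE subrr mulr0 add0r lerD2l.
rewrite rintZ; last by rint_tac.
rewrite (rintD (mu:=mu))//; last by rint_tac.
rewrite rint_cst.
have := ler_wpM2l (powR_ge0 b g) J; lra.
Qed.

End power_inequalities.

Section fatou_ae.
Context {d : measure_display} {T : measurableType d} {R : realType}.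
Variable mu : {measure set T -> \bar R}.

Lemma fatou_ae (f : nat -> T -> \bar R) (h : T -> \bar R) (C : \bar R) :
  (forall n, measurable_fun setT (f n)) -> (forall n x, 0 <= f n x)%E ->
  measurable_fun setT h -> (forall x, 0 <= h x)%E ->
  {ae mu, forall x, f n x @[n --> \oo] --> h x} ->
  (forall n, \int[mu]_x f n x <= C)%E -> (\int[mu]_x h x <= C)%E.
Proof.
move=> mf f0 mh h0 fh fC.
apply: (@le_trans _ _ (\int[mu]_x limn_einf (f^~ x))%E).
  apply: ae_ge0_le_integral => //.
  - move=> x _; rewrite limn_einf_lim; apply: lime_ge; first exact: is_cvg_einfs.
    by apply: nearW => n; apply: le_ereal_inf_tmp => _ [m /= nm <-].
  - rewrite /limn_einf; apply: measurableT_comp => //.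
    apply: measurable_fun_limn_esup => n; by apply: measurableT_comp.
  - by apply: (filterS _ fh) => x fx _; rewrite (cvg_limn_einf_sup fx).1.
apply: le_trans (fatou mu measurableT mf (fun n x _ => f0 n x)) _.
apply: le_trans (limn_einf_sup _) _.
rewrite limn_esup_lim; apply: lime_le; first exact: is_cvg_esups.
by apply: nearW => n; rewrite /esups ge_ereal_sup => //= _ [m /= nm <-].
Qed.

End fatou_ae.

Lemma fineZ (R : realType) (r : R) (y : \bar R) : 0 <= r -> fine (r%:E * y)%E = r * fine y.
Proof.
rewrite le_eqVlt => /predU1P[<-|r0]; first by rewrite mul0e mul0r.
by case: y => [y||] //=; rewrite ?gt0_muley ?gt0_muleNy ?lte_fin//= mulr0.
Qed.

Lemma cvg_fine_nneseries (R : realType) (c : nat -> \bar R) : (forall i, 0 <= c i)%E ->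
  (\sum_(0 <= i <oo) c i < +oo)%E ->
  (\sum_(0 <= i < n) fine (c i)) @[n --> \oo] --> fine (\sum_(0 <= i <oo) c i)%E.
Proof.
move=> c0 cfin.
have s0 : (0 <= \sum_(0 <= i <oo) c i)%E by apply: nneseries_ge0 => n _ _.
have cf i : c i \is a fin_num.
  rewrite ge0_fin_numE//; apply: le_lt_trans cfin.
  apply: le_trans (nneseries_lim_ge i.+1 _); last by move=> *.
  by rewrite big_nat_recr//= leeDr// sume_ge0.
have h : (\sum_(0 <= i < n) c i)%E @[n --> \oo] --> (fine (\sum_(0 <= i <oo) c i)%E)%:E.
  by rewrite fineK ?ge0_fin_numE//; apply: is_cvg_nneseries => n _ _; exact: c0.
suff -> : (fun n => \sum_(0 <= i < n) fine (c i)) =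
    fine \o (fun n => \sum_(0 <= i < n) c i)%E by exact: fine_cvg h.
by apply/funext => n /=; rewrite sum_fine.
Qed.

Lemma cvg_norm_powR (R : realType) (g : R) (u : nat -> R) (l : R) : 1 < g ->
  u n @[n --> \oo] --> l -> `|u n| `^ g @[n --> \oo] --> `|l| `^ g.
Proof.
move=> g1 ul; have g0 : g != 0 by rewrite gt_eqF//; lra.
have nul : `|u n| @[n --> \oo] --> `|l| by exact: cvg_norm.
(* The power is an exponential of a logarithm only away from 0; for the limit 0 it is squeezed by
   |u|. *)
have [l0|l0] := eqVneq l 0.
  rewrite l0 normr0 powR0//.
  apply: (@squeeze_cvgr _ _ _ _ (fun=> 0) (fun n => `|u n|)); last 2 first.
  - exact: cvg_cst.
  - by move: nul; rewrite l0 normr0.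
  have h1 : \forall n \near \oo, `|u n| <= 1.
    by move/cvgr_le : nul; apply; rewrite l0 normr0 ltr01.
  near=> n; rewrite powR_ge0/=.
  have un1 : `|u n| <= 1 by near: n.
  have [u0|u0] := eqVneq (u n) 0; first by rewrite u0 normr0 powR0.
  by rewrite -[leRHS]powRr1// ger_powR ?normr_gt0 ?u0//; lra.
have l0' : 0 < `|l| by rewrite normr_gt0.
have -> : `|l| `^ g = expR (g * ln `|l|) by rewrite /powR gt_eqF.
have h : expR (g * ln `|u n|) @[n --> \oo] --> expR (g * ln `|l|).
  apply: (continuous_cvg _ (@continuous_expR R _)).
  apply: cvgMr; apply: continuous_cvg nul; exact: continuous_ln.
have h1 : \forall n \near \oo, 0 < `|u n| by move/cvgr_gt : nul; apply.
apply: cvg_trans h; apply: near_eq_cvg; near=> n.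
by rewrite /powR gt_eqF//; near: n.
Unshelve. all: by end_near. Qed.

(** * Centred sums over one generation *)

Section generation_deviation.
Context {d : measure_display} {T : measurableType d} {R : realType}.
Variables (P : probability T R) (X : vertex -> nat -> T -> \bar R).
Hypotheses (HX : iid_copies P X) (HE : point_process_encoding X).
Hypothesis law1 : (\int[law HX]_x atom_sum (fun=> 1%E) x = 1)%E.

Local Notation F := (step_prob law1).

Lemma integral_gsum1 n : (\int[P]_w gsum X n (fun=> 1%E) w = 1)%E.
Proof.
elim: n => [|n IH].
  under eq_integral do rewrite gsum0//.
  by rewrite integral_cst// mul1e; exact: probability_setT.
rewrite (integral_gsumS HE law1)// -[RHS]IH; apply: eq_integral => w _; apply: eq_gsum => v.
by rewrite integral_cst// mul1e; exact: probability_setT.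
Qed.

Variable g : R.
Hypotheses (g1 : 1 < g) (g2 : g < 2).
Variable chi : R -> R -> R.
Hypotheses (mchi : measurable_fun setT (fun z : R * R => chi z.1 z.2))
  (chi01 : forall v y, 0 <= chi v y <= 1).

Local Notation chiE := (fun v y => (chi v y)%:E).

Let mchiE : measurable_fun setT (fun z : R * R => chiE z.1 z.2).
Proof. exact/measurable_EFinP. Qed.

Let chiE0 v y : (0 <= chiE v y)%E.
Proof. by rewrite lee_fin; have /andP[] := chi01 v y. Qed.

Definition offspring_moment (v : R) : \bar R :=
  (\int[law HX]_x (atom_sum (chiE v) x) `^ g)%E.

Let mat : measurable_fun setT (fun z : R * @atom_seq R => atom_sum (chiE z.1) z.2).
Proof.
have mz : measurable_fun setT (fun z : (R * @atom_seq R) * R => chiE z.1.1 z.2).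
  apply: (measurableT_comp (f := fun z : R * R => chiE z.1 z.2)
    (g := fun z : (R * @atom_seq R) * R => (z.1.1, z.2))) => //.
  apply: measurable_fun_pair; last exact: measurable_snd.
  exact: (measurableT_comp measurable_fst measurable_fst).
exact: (measurable_atom_sum (S := (R * @atom_seq R)%type) (g := snd)
  (f := fun z => chiE z.1) measurable_snd mz (fun z y => chiE0 z.1 y)).
Qed.

Let matv v : measurable_fun setT (fun x : @atom_seq R => atom_sum (chiE v) x).
Proof.
apply: (measurableT_comp (f := fun z : R * @atom_seq R => atom_sum (chiE z.1) z.2)
  (g := fun x => (v, x))) => //.
exact: measurable_fun_pair.
Qed.

Lemma offspring_moment_ge0 v : (0 <= offspring_moment v)%E.
Proof. by apply: integral_ge0 => x _; exact: poweR_ge0. Qed.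

Lemma measurable_offspring_moment : measurable_fun setT offspring_moment.
Proof.
have mp : measurable_fun setT (fun z : R * @atom_seq R => (atom_sum (chiE z.1) z.2) `^ g)%E.
  exact: (measurableT_comp (measurable_poweR g) mat).
by apply: (@measurable_fun_fubini_tonelli_F _ _ _ _ _ (law HX) _ mp) => z; exact: poweR_ge0.
Qed.

Local Notation mean v := (\int[F]_y chiE v y)%E.

Let meanE v : (mean v = \int[law HX]_x atom_sum (chiE v) x)%E.
Proof. by rewrite integral_step_prob//; exact: (measurable_chi_section _ mchiE). Qed.

Let mean_ge0 v : (0 <= mean v)%E. Proof. by apply: integral_ge0 => y _. Qed.

Let mean_le1 v : (mean v <= 1)%E.
Proof.
apply: (@le_trans _ _ (\int[F]_y 1)%E).
  apply: ge0_le_integral => //; first exact: (measurable_chi_section _ mchiE).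
  by move=> y _; rewrite lee_fin; have /andP[] := chi01 v y.
by rewrite integral_cst// mul1e [leLHS]probability_setT.
Qed.

Let mmean : measurable_fun setT (fun v => mean v).
Proof. exact: (measurable_chi_mean law1 mchiE). Qed.

(** Share of one vertex in the centred generation sum. It has mean 0 given everything but the
    offspring of [u], hence is a martingale difference in whatever order the vertices are taken. *)
Definition vertex_dev (u : vertex) (w : T) : R :=
  rwgt (V X u w) * (fine (atom_sum (chiE (fine (V X u w))) (offspring X u w))
                    - fine (mean (fine (V X u w)))).

Lemma measurable_vertex_dev_away v u : (size v <= size u)%N -> v != u ->
  measurable_fun setT (vertex_dev v : away X u -> R).
Proof.
move=> vu vnu.
have mf (f : away X u -> \bar R) : measurable_fun setT f ->
    measurable_fun setT (fun w => fine (f w)).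
  by move=> mf; exact: (measurableT_comp (@fine_measurable R setT measurableT) mf).
apply: measurable_funM; first exact: mf (measurable_wgtV_away vu).
apply: measurable_funB; last first.
  have h := mf _ (measurableT_comp mmean (measurable_fineV_away vu (X := X))).
  exact h.
apply: mf.
apply: (measurable_atom_sum (S := away X u) (g := offspring X v)
  (f := fun w => chiE (fine (V X v w)))) => //.
  exact: measurable_offspring_away.
apply: (measurableT_comp (f := fun z : R * R => chiE z.1 z.2)
  (g := fun z : away X u * R => (fine (V X v z.1), z.2))) => //.
have h := measurableT_comp (measurable_fineV_away vu (X := X)) (@measurable_fst _ _ (away X u) R).
apply: measurable_fun_pair; last exact: measurable_snd.
exact h.
Qed.

(** Given everything but the offspring of [u], both [f] and the weight are constants, and
    [centered_powR_integral] applies to the remaining integral. *)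
Lemma vertex_dev_step (f : T -> R) u : measurable_fun setT (f : away X u -> R) ->
  (\int[P]_w (`|f w + vertex_dev u w| `^ g)%:E <=
   \int[P]_w (`|f w| `^ g)%:E +
   \int[P]_w ((8 * rwgt (V X u w) `^ g)%:E * offspring_moment (fine (V X u w))))%E.
Proof.
move=> mf.
have mV := measurable_fineV_away (leqnn (size u)) (X := X).
have mW : measurable_fun setT (fun w : away X u => rwgt (V X u w)).
  have h := measurableT_comp (@fine_measurable R setT measurableT)
    (measurable_wgtV_away (leqnn (size u)) (X := X)).
  exact h.
have mfT := measurable_from_away HX mf.
have mVT := measurable_from_away HX mV.
have mWT := measurable_from_away HX mW.
have mpow (S : measurableType _) (h : S -> R) : measurable_fun setT h ->
    measurable_fun setT (fun x => (`|h x| `^ g)%:E).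
  move=> mh; apply/measurable_EFinP; apply: measurable_powR_comp.
  exact: measurableT_comp.
pose G (z : away X u * @atom_seq R) := (`|f z.1 + rwgt (V X u z.1) *
   (fine (atom_sum (chiE (fine (V X u z.1))) z.2) - fine (mean (fine (V X u z.1))))| `^ g)%:E.
have G0 z : (0 <= G z)%E by rewrite lee_fin powR_ge0.
have mG : measurable_fun setT G.
  apply/measurable_EFinP; apply: measurable_powR_comp; apply: measurableT_comp => //.
  apply: measurable_funD; first exact: (measurableT_comp mf measurable_fst).
  apply: measurable_funM; first exact: (measurableT_comp mW measurable_fst).
  have h1 := measurable_gen_term_pair (X := X) (u := u) mchiE chiE0.
  have h2 := measurableT_comp mmean (measurableT_comp mV (@measurable_fst _ _ (away X u) (@atom_seq R))).
  have h3 := measurableT_comp (@fine_measurable R setT measurableT) h1.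
  have h4 := measurableT_comp (@fine_measurable R setT measurableT) h2.
  exact: (measurable_funB h3 h4).
have mI := measurable_from_away HX (measurable_fun_fubini_tonelli_F (m2 := law HX) G mG G0).
rewrite (decouple HX mG G0).
rewrite -ge0_integralD//; last 3 first.
- exact: mpow.
- by move=> w _; rewrite mule_ge0 ?offspring_moment_ge0// lee_fin mulr_ge0// powR_ge0.
- apply: emeasurable_funM; last exact: (measurableT_comp measurable_offspring_moment mVT).
  apply/measurable_EFinP; apply: measurable_funM => //.
  exact: measurable_powR_comp.
apply: ge0_le_integral => //.
- by move=> w _; apply: integral_ge0 => x _; rewrite lee_fin powR_ge0.
- apply: emeasurable_funD; first exact: mpow.
  apply: emeasurable_funM; last exact: (measurableT_comp measurable_offspring_moment mVT).
  apply/measurable_EFinP; apply: measurable_funM => //.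
  exact: measurable_powR_comp.
- move=> w _; set v := fine (V X u w).
  have fin : (\int[law HX]_x atom_sum (chiE v) x < +oo)%E.
    by rewrite -meanE (le_lt_trans (mean_le1 _))// ltry.
  have := centered_powR_integral g1 g2 (f w) (matv v)
    (fun x => atom_sum_ge0 x (chiE0 v)) fin (rwgt_ge0 (V X u w)).
  by rewrite -meanE; apply.
Qed.

(** A generation may be infinite, so its vertices are added one by one in the order of their codes;
    codes of other vertices contribute 0. *)
Definition dev_term (j i : nat) (w : T) : R :=
  if pickle_inv i is Some u then (if size (u : vertex) == j then vertex_dev u w else 0) else 0.

Definition dev_bound (u : vertex) (w : T) : \bar R :=
  ((8 * rwgt (V X u w) `^ g)%:E * offspring_moment (fine (V X u w)))%E.

Let gensize (j : nat) : pred vertex := fun u => size u == j.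

Lemma dev_bound_ge0 u w : (0 <= dev_bound u w)%E.
Proof. by rewrite mule_ge0 ?offspring_moment_ge0// lee_fin mulr_ge0// powR_ge0. Qed.

Lemma measurable_dev_bound u : measurable_fun setT (dev_bound u).
Proof.
have mV := measurable_from_away HX (measurable_fineV_away (leqnn (size u)) (X := X)).
have mW := measurable_from_away HX (measurableT_comp (@fine_measurable R setT measurableT)
    (measurable_wgtV_away (leqnn (size u)) (X := X))).
apply: emeasurable_funM; last exact: (measurableT_comp measurable_offspring_moment mV).
by apply/measurable_EFinP; apply: measurable_funM => //; exact: measurable_powR_comp.
Qed.

Lemma measurable_dev_term_away j i u : size u = j -> (i != pickle u) ->
  measurable_fun setT (dev_term j i : away X u -> R).
Proof.
move=> uj iu; rewrite /dev_term; case E : (pickle_inv i) => [v|]; last exact: measurable_cst.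
have [vj|] := eqVneq (size v) j; last by move=> _; exact: measurable_cst.
apply: measurable_vertex_dev_away; first by rewrite vj uj.
by apply: contra iu => /eqP <-; have := @pickle_invK vertex i; rewrite E /= => ->.
Qed.

Lemma measurable_dev_term j i : measurable_fun setT (dev_term j i).
Proof.
rewrite /dev_term; case: pickle_inv => [u|]; last exact: measurable_cst.
case: eqP => _; last exact: measurable_cst.
have -> : vertex_dev u = fun w =>
    fine (wgt (V X u w) * atom_sum (chiE (fine (V X u w))) (offspring X u w))%E -
    fine (wgt (V X u w) * mean (fine (V X u w)))%E.
  by apply/funext => w; rewrite rwgtE !fineZ ?rwgt_ge0// -mulrBr.
have h1 := measurable_gen_term HX u mchiE chiE0.
have h2 := measurable_from_away HX (measurable_gterm_away (leqnn (size u)) (X := X) mmean).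
have fm := @fine_measurable R setT measurableT.
exact: (measurable_funB (measurableT_comp fm h1) (measurableT_comp fm h2)).
Qed.

(** Each new vertex [u] is added by [vertex_dev_step]: the earlier terms belong to other vertices of
    the same generation and are therefore measurable away from [u]. *)
Lemma dev_partial j (f : T -> R) k : measurable_fun setT f ->
  (forall u, size u = j -> measurable_fun setT (f : away X u -> R)) ->
  (\int[P]_w (`|f w + \sum_(0 <= i < k) dev_term j i w| `^ g)%:E <=
   \int[P]_w (`|f w| `^ g)%:E +
   \sum_(0 <= i < k) enum_term (gensize j) (fun u => \int[P]_w dev_bound u w) i)%E.
Proof.
move=> mfT mf; elim: k => [|k IH].
  by rewrite big_geq// adde0; under eq_integral do rewrite big_geq// addr0.
rewrite big_nat_recr//= addeA.
under eq_integral do rewrite big_nat_recr//= addrA.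
apply: (@le_trans _ _ (\int[P]_w (`|f w + \sum_(0 <= i < k) dev_term j i w| `^ g)%:E +
   enum_term (gensize j) (fun u => \int[P]_w dev_bound u w) k)%E); last by rewrite leeD2r.
rewrite /enum_term /dev_term; case E : (pickle_inv k) => [u|]; last first.
  by rewrite adde0; under eq_integral do rewrite addr0.
rewrite /gensize; have [uj|_] := eqVneq (size u) j; last first.
  by rewrite adde0; under eq_integral do rewrite addr0.
apply: (vertex_dev_step (f := fun w => f w + \sum_(0 <= i < k) dev_term j i w)).
apply: measurable_funD; first exact: mf.
have ku : k = pickle u by have := @pickle_invK vertex k; rewrite E /= => ->.
rewrite (_ : (fun w => _) = (fun w : away X u => \sum_(i <- index_iota 0 k) dev_term j i w))//.
have H : forall i, i \in index_iota 0 k ->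
    measurable_fun setT (dev_term j i : away X u -> R).
  move=> i; rewrite mem_index_iota => /andP[_ ik].
  by apply: measurable_dev_term_away => //; rewrite -ku ltn_eqF.
elim: (index_iota 0 k) H => [|i s IHs] H.
  by under eq_fun do rewrite big_nil; exact: measurable_cst.
under eq_fun do rewrite big_cons.
apply: measurable_funD; first by apply: H; rewrite inE eqxx.
by apply: IHs => i' i's; apply: H; rewrite inE i's orbT.
Qed.

Let gm v := mean v.

Lemma gsum_mean_lty (j : nat) : {ae P, forall w, (gsum X j gm w < +oo)%E}.
Proof.
have gm0 v : (0 <= gm v)%E by exact: mean_ge0.
have mg := measurable_gsum HX j mmean gm0.
have ig : P.-integrable setT (gsum X j gm).
  apply/integrableP; split => //.
  under eq_integral do rewrite gee0_abs ?gsum_ge0//.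
  apply: (@le_lt_trans _ _ (\int[P]_w gsum X j (fun=> 1%E) w)%E).
    apply: ge0_le_integral => //.
    - by move=> w _; exact: gsum_ge0.
    - exact: (measurable_gsum HX).
    - by move=> w _; apply: gsum_le => v; exact: mean_le1.
  by rewrite integral_gsum1 ltry.
have := integrable_ae measurableT ig.
by apply: filterS => w /(_ I); rewrite ge0_fin_numE// gsum_ge0.
Qed.

Lemma gen_sum_lty (j : nat) : {ae P, forall w, (gen_sum X j chiE w < +oo)%E}.
Proof.
have mg := measurable_gen_sum HX j mchiE chiE0.
have ig : P.-integrable setT (gen_sum X j chiE).
  apply/integrableP; split => //.
  under eq_integral do rewrite gee0_abs ?gen_sum_ge0//.
  rewrite (integral_gen_sum law1)//.
  apply: (@le_lt_trans _ _ (\int[P]_w gsum X j (fun=> 1%E) w)%E).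
    apply: ge0_le_integral => //.
    - by move=> w _; apply: gsum_ge0 => v; exact: mean_ge0.
    - by apply: (measurable_gsum HX) => // v; exact: mean_ge0.
    - exact: (measurable_gsum HX).
    - by move=> w _; apply: gsum_le => v; exact: mean_le1.
  by rewrite integral_gsum1 ltry.
have := integrable_ae measurableT ig.
by apply: filterS => w /(_ I); rewrite ge0_fin_numE// gen_sum_ge0.
Qed.

Lemma dev_sum_cvg j w : (gen_sum X j chiE w < +oo)%E -> (gsum X j gm w < +oo)%E ->
  (\sum_(0 <= i < k) dev_term j i w) @[k --> \oo] -->
    fine (gen_sum X j chiE w) - fine (gsum X j gm w).
Proof.
pose ca i := enum_term (gensize j) (fun u : vertex => wgt (V X u w) *
   atom_sum (chiE (fine (V X u w))) (offspring X u w))%E i.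
pose cb i := enum_term (gensize j) (fun u : vertex => wgt (V X u w) * gm (fine (V X u w)))%E i.
have a0 (u : vertex) : (0 <= wgt (V X u w) *
   atom_sum (chiE (fine (V X u w))) (offspring X u w))%E.
  by rewrite mule_ge0 ?wgt_ge0 ?atom_sum_ge0.
have b0 (u : vertex) : (0 <= wgt (V X u w) * gm (fine (V X u w)))%E.
  by rewrite mule_ge0 ?wgt_ge0// mean_ge0.
have -> : gen_sum X j chiE w = (\sum_(0 <= i <oo) ca i)%E by exact: esum_series.
have -> : gsum X j gm w = (\sum_(0 <= i <oo) cb i)%E by exact: esum_series.
move=> fa fb.
have -> : (fun k => \sum_(0 <= i < k) dev_term j i w) =
    (fun k => \sum_(0 <= i < k) fine (ca i) - \sum_(0 <= i < k) fine (cb i)).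
  apply/funext => k; rewrite -sumrB; apply: eq_bigr => i _.
  rewrite /dev_term /ca /cb /enum_term; case: pickle_inv => [u|]; last by rewrite subr0.
  rewrite /gensize; case: ifP => _; last by rewrite subr0.
  by rewrite /vertex_dev !rwgtE !fineZ ?rwgt_ge0// mulrBr.
by apply: cvgB; apply: cvg_fine_nneseries => // i; exact: enum_term_ge0.
Qed.

(** Fatou's lemma along the partial sums. The weight e^(-gV) of the g-th moments splits as e^(-V)
    e^(-(g-1)V), which makes the total bound again a generation sum. *)
Lemma gen_dev j (f : T -> R) : measurable_fun setT f ->
  (forall u, size u = j -> measurable_fun setT (f : away X u -> R)) ->
  (\int[P]_w (`|f w + (fine (gen_sum X j chiE w) - fine (gsum X j (fun v => mean v) w))| `^ g)%:E <=
   \int[P]_w (`|f w| `^ g)%:E +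
   8%:E * \int[P]_w gsum X j (fun v => (expR (- ((g - 1) * v)))%:E * offspring_moment v) w)%E.
Proof.
move=> mf mfu.
have hg := g1.
have -> : (8%:E * \int[P]_w gsum X j (fun v => (expR (- ((g - 1) * v)))%:E * offspring_moment v) w =
   \sum_(0 <= i <oo) enum_term (gensize j) (fun u => \int[P]_w dev_bound u w) i)%E.
  rewrite -esum_series; last by move=> u _; apply: integral_ge0 => w _; exact: dev_bound_ge0.
  have h0 v : (0 <= (expR (- ((g - 1) * v)))%:E * offspring_moment v)%E.
    by rewrite mule_ge0 ?offspring_moment_ge0// lee_fin expR_ge0.
  have mh : measurable_fun setT (fun v => (expR (- ((g - 1) * v)))%:E * offspring_moment v)%E.
    apply: emeasurable_funM; last exact: measurable_offspring_moment.
    by apply/measurable_EFinP; do 3! apply: measurableT_comp => //.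
  rewrite -ge0_integralZl//; last 2 first.
  - exact: (measurable_gsum HX).
  - by move=> w _; exact: gsum_ge0.
  rewrite -integral_esum; last 2 first.
  - by move=> u _; exact: measurable_dev_bound.
  - by move=> u w _; exact: dev_bound_ge0.
  apply: eq_integral => w _; rewrite -gsumZ//; apply: eq_esum => u _.
  rewrite /dev_bound !muleA; congr (_ * _)%E.
  rewrite rwgtE -!EFinM; congr (_%:E).
  case: (V X u w) => [v||] /=; rewrite ?mul0r ?powR0 ?mulr0 ?gt_eqF//; try lra.
  rewrite -expRM mulrAC (mulrC _ 8); congr (_ * _); rewrite /rwgt /= -expRD; congr expR; lra.
have mS k : measurable_fun setT (fun w => f w + \sum_(0 <= i < k) dev_term j i w).
  apply: measurable_funD => //; apply: measurable_sum => i; exact: measurable_dev_term.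
have mp (h : T -> R) : measurable_fun setT h -> measurable_fun setT (fun w => (`|h w| `^ g)%:E).
  move=> mh; apply/measurable_EFinP; apply: measurable_powR_comp.
  exact: measurableT_comp.
have mgen : measurable_fun setT (fun w => fine (gen_sum X j chiE w)).
  exact: (measurableT_comp (@fine_measurable R setT measurableT) (measurable_gen_sum HX j mchiE chiE0)).
have mgs : measurable_fun setT (fun w => fine (gsum X j (fun v => mean v) w)).
  exact: (measurableT_comp (@fine_measurable R setT measurableT) (measurable_gsum HX j mmean mean_ge0)).
apply: (fatou_ae (f := fun k w => (`|f w + \sum_(0 <= i < k) dev_term j i w| `^ g)%:E)).
- by move=> k; exact: mp.
- by move=> k w; rewrite lee_fin powR_ge0.
- by apply: mp; apply: measurable_funD => //; exact: measurable_funB.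
- by move=> w; rewrite lee_fin powR_ge0.
- have fa := gen_sum_lty j; have fb := gsum_mean_lty j.
  apply: filterS2 fa fb => w fa fb; apply: cvg_EFin; first by apply: nearW.
  by apply: cvg_norm_powR => //; apply: cvgD; [exact: cvg_cst|exact: dev_sum_cvg].
- move=> k; apply: (le_trans (dev_partial k mf mfu)); rewrite leeD2l//.
  apply: nneseries_lim_ge => i _ _; apply: enum_term_ge0 => u _.
  by apply: integral_ge0 => w _; exact: dev_bound_ge0.
Qed.

End generation_deviation.

(** * Several generations and geometric decay *)

Section generation_chain.
Context {d : measure_display} {T : measurableType d} {R : realType}.
Variables (P : probability T R) (X : vertex -> nat -> T -> \bar R).
Hypotheses (HX : iid_copies P X) (HE : point_process_encoding X).
Hypothesis law1 : (\int[law HX]_x atom_sum (fun=> 1%E) x = 1)%E.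

Local Notation F := (step_prob law1).

(** Values in [0, 1] keep the mean of every generation sum below E W_j = 1, hence the sums almost
    surely finite. *)
Definition unit_kernel (chi : R -> R -> R) :=
  measurable_fun setT (fun z : R * R => chi z.1 z.2) /\ forall v y, 0 <= chi v y <= 1.

Definition gmean (j : nat) (chi : R -> R -> R) (w : T) : \bar R :=
  gsum X j (fun v => \int[F]_y (chi v y)%:E)%E w.

Definition gdev (j : nat) (chi : R -> R -> R) (w : T) : R :=
  fine (gen_sum X j (fun v y => (chi v y)%:E) w) - fine (gmean j chi w).

Lemma unit_kernel_ereal chi : unit_kernel chi ->
  measurable_fun setT (fun z : R * R => (chi z.1 z.2)%:E) /\ (forall v y, (0 <= (chi v y)%:E)%E).
Proof.
move=> [mc c01]; split; first exact/measurable_EFinP.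
by move=> v y; rewrite lee_fin; have /andP[] := c01 v y.
Qed.

Lemma measurable_gdev_away j chi u : unit_kernel chi -> (j < size u)%N ->
  measurable_fun setT (gdev j chi : away X u -> R).
Proof.
move=> /unit_kernel_ereal[mc c0] ju.
have fm := @fine_measurable R setT measurableT.
have mm := measurable_chi_mean law1 mc c0.
have h1 : measurable_fun setT (gen_sum X j (fun v y => (chi v y)%:E) : away X u -> \bar R).
  apply: measurable_esum => [v /eqP vj|v w _]; last by rewrite mule_ge0 ?wgt_ge0 ?atom_sum_ge0.
  apply: (measurable_gen_term_away (chi := fun v y => (chi v y)%:E)) => //.
    by rewrite vj ltnW.
  by apply: contraTneq ju => <-; rewrite vj ltnn.
have h2 : measurable_fun setT (gmean j chi : away X u -> \bar R).
  by apply: measurable_gsum_away => //; [exact: ltnW|move=> v; exact: integral_ge0].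
exact: (measurable_funB (measurableT_comp fm h1) (measurableT_comp fm h2)).
Qed.

Lemma measurable_gdev j chi : unit_kernel chi -> measurable_fun setT (gdev j chi).
Proof.
move=> uc; have ju : (j < size (nseq j.+1 0%N : vertex))%N by rewrite size_nseq.
exact: (measurable_from_away HX (measurable_gdev_away uc ju)).
Qed.

Variable g : R.
Hypotheses (g1 : 1 < g) (g2 : g < 2).

Local Notation bound j chi := (8%:E * \int[P]_w gsum X j
  (fun v => (expR (- ((g - 1) * v)))%:E * offspring_moment HX g chi v) w)%E.

(** The deviations of earlier generations involve only vertices shorter than those of generation
    [m], so [gen_dev] adds one generation at a time without worsening the constant. *)
Lemma gdev_chain (chi : nat -> R -> R -> R) k m : (forall j, unit_kernel (chi j)) ->
  (\int[P]_w (`|\sum_(k <= j < m) gdev j (chi j) w| `^ g)%:E <=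
   \sum_(k <= j < m) bound j (chi j))%E.
Proof.
move=> uc; elim: m => [|m IH].
  rewrite big_geq//; under eq_integral do rewrite big_geq// normr0.
  by rewrite integral_cst// powR0 ?mul0e//; have := g1; lra.
have [km|mk] := leqP k m; last first.
  rewrite big_geq//; under eq_integral do rewrite big_geq// normr0.
  by rewrite integral_cst// powR0 ?mul0e//; have := g1; lra.
rewrite big_nat_recr//=; under eq_integral do rewrite big_nat_recr//=.
have [mc c01] := uc m.
have mS u : (m <= size u)%N ->
    measurable_fun setT (fun w : away X u => \sum_(k <= j < m) gdev j (chi j) w).
  move=> mu.
  have H : forall i, i \in index_iota k m -> measurable_fun setT (gdev i (chi i) : away X u -> R).
    move=> i; rewrite mem_index_iota => /andP[_ im].
    by apply: measurable_gdev_away => //; exact: leq_trans mu.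
  elim: (index_iota k m) H => [|i s IHs] H.
    by under eq_fun do rewrite big_nil; exact: measurable_cst.
  under eq_fun do rewrite big_cons.
  apply: measurable_funD; first by apply: H; rewrite inE eqxx.
  by apply: IHs => i' i's; apply: H; rewrite inE i's orbT.
apply: (@le_trans _ _ (\int[P]_w (`|\sum_(k <= j < m) gdev j (chi j) w| `^ g)%:E +
   bound m (chi m))%E); last by rewrite leeD2r.
apply: (gen_dev HE law1 g1 g2 mc c01 (j := m) (f := fun w => \sum_(k <= j < m) gdev j (chi j) w)).
  by apply: measurable_sum => j; exact: measurable_gdev.
by move=> u um; apply: mS; rewrite um.
Qed.

Variables (mg c : R).
Hypotheses (mgE : (\int[F]_y (expR (- ((g - 1) * y)))%:E = mg%:E)%E) (mg1 : mg < 1).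
Hypothesis c0 : 0 < c.

Lemma measurable_expR_lin (k : R) : measurable_fun setT (fun v : R => (expR (- (k * v)))%:E).
Proof. by apply/measurable_EFinP; do 3! apply: measurableT_comp => //. Qed.

Lemma mg_ge0 : 0 <= mg.
Proof. by rewrite -lee_fin -mgE; apply: integral_ge0 => y _; rewrite lee_fin expR_ge0. Qed.

(** [mg] is m(g), and the sum is that of e^(-g V_u) over generation [n]. *)
Lemma integral_gsum_exp n :
  (\int[P]_w gsum X n (fun v => (expR (- ((g - 1) * v)))%:E) w = (mg ^+ n)%:E)%E.
Proof.
have e0 v : (0 <= (expR (- ((g - 1) * v)))%:E)%E by rewrite lee_fin expR_ge0.
have me := measurable_expR_lin (g - 1).
elim: n => [|n IH].
  under eq_integral do rewrite gsum0// mulr0 oppr0 expR0.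
  by rewrite integral_cst// mul1e; exact: probability_setT.
rewrite (integral_gsumS HE law1)//.
have E v : (\int[F]_y (expR (- ((g - 1) * (v + y)%R)))%:E = mg%:E * (expR (- ((g - 1) * v)))%:E)%E.
  rewrite muleC -mgE -ge0_integralZl//.
  by apply: eq_integral => y _; rewrite -EFinM -expRD; congr (expR _)%:E; ring.
transitivity (\int[P]_w (mg%:E * gsum X n (fun v => (expR (- ((g - 1) * v)))%:E) w))%E.
  by apply: eq_integral => w _; rewrite -gsumZ ?mg_ge0//; exact: eq_gsum.
rewrite ge0_integralZl ?lee_fin ?mg_ge0//; last 2 first.
- exact: (measurable_gsum HX).
- by move=> w _; exact: gsum_ge0.
by rewrite IH -EFinM exprS.
Qed.

(** A common geometric rate: m(g) for sums over whole generations, e^(-(g-1)c) for the vertices far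
    beyond their mean position j c. *)
Definition grate : R := Num.max mg (expR (- ((g - 1) * c))).

Lemma grate_gt0 : 0 < grate. Proof. by rewrite lt_max expR_gt0 orbT. Qed.

Lemma grate_lt1 : grate < 1.
Proof.
have hg := g1; have hc := c0; have hm := mg1.
rewrite /grate gt_max hm/= expR_lt1 oppr_lt0 mulr_gt0//; lra.
Qed.

(** The part [A] is multiplied by the expected sum of e^(-gV), which is m(g)^j. The part [B] lives
    beyond j c + e, where e^(-(g-1)V) is at most e^(-(g-1)(jc+e)), and E W_j = 1. *)
Lemma gbound_geo (chi : R -> R -> R) j (A B e : R) : unit_kernel chi -> 0 <= A -> 0 <= B ->
  (forall v, offspring_moment HX g chi v <= (A + B * (j%:R * c + e < v)%R%:R)%:E)%E ->
  (bound j chi <= (8 * (A + B * expR (- ((g - 1) * e))) * grate ^+ j)%:E)%E.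
Proof.
move=> uc A0 B0 mom; have hg := g1.
have [mcE cE0] := unit_kernel_ereal uc; have [mc c01] := uc.
rewrite -mulrA EFinM lee_pmul2l ?lte_fin//.
pose h1 v : \bar R := (A%:E * (expR (- ((g - 1) * v)))%:E)%E.
pose K := B * expR (- ((g - 1) * (j%:R * c + e))).
have K0 : 0 <= K by rewrite mulr_ge0// expR_ge0.
have e0 v : (0 <= (expR (- ((g - 1) * v)))%:E)%E by rewrite lee_fin expR_ge0.
have h10 v : (0 <= h1 v)%E by rewrite mule_ge0.
have me := measurable_expR_lin (g - 1).
have mh1 : measurable_fun setT h1 by exact: measurable_funeM.
have K0' : (0 <= K%:E * 1)%E by rewrite mule1 lee_fin.
apply: (@le_trans _ _ (\int[P]_w (gsum X j h1 w + gsum X j (fun v => K%:E * 1)%E w))%E).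
  apply: ge0_le_integral => //.
  - by move=> w _; apply: gsum_ge0 => v; rewrite mule_ge0// offspring_moment_ge0.
  - apply: (measurable_gsum HX) => [|v].
      by apply: emeasurable_funM => //; exact: measurable_offspring_moment.
    by rewrite mule_ge0// offspring_moment_ge0.
  - by apply: emeasurable_funD; apply: (measurable_gsum HX).
  - move=> w _; rewrite -gsumD//.
    apply: gsum_le => v; rewrite /h1 mule1.
    apply: (le_trans (lee_wpmul2l (e0 v) (mom v))).
    rewrite -!EFinM -EFinD lee_fin mulrDr (mulrC A) lerD2l.
    case: ltP => ve; rewrite ?mulr0// mulr1 /K mulrC ler_wpM2l// ler_expR lerN2.
    by rewrite ler_wpM2l ?(ltW ve)//; lra.
rewrite ge0_integralD//; last 4 first.
- by move=> w _; exact: gsum_ge0.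
- exact: (measurable_gsum HX).
- by move=> w _; exact: gsum_ge0.
- exact: (measurable_gsum HX).
under eq_integral do rewrite gsumZ//.
under [X in (_ + X)%E]eq_integral do rewrite gsumZ//.
rewrite !ge0_integralZl//; first last.
- by move=> w _; exact: gsum_ge0.
- exact: (measurable_gsum HX).
- by move=> w _; exact: gsum_ge0.
- exact: (measurable_gsum HX).
rewrite integral_gsum_exp integral_gsum1// mule1 -EFinM -EFinD lee_fin mulrDl.
have m0 := mg_ge0.
have r1 : mg ^+ j <= grate ^+ j by rewrite lerXn2r ?nnegrE ?(ltW grate_gt0)// /grate le_max lexx.
have r2 : expR (- ((g - 1) * c)) ^+ j <= grate ^+ j.
  by rewrite lerXn2r ?nnegrE ?expR_ge0 ?(ltW grate_gt0)// /grate le_max lexx orbT.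
apply: lerD; first by rewrite ler_wpM2l.
rewrite /K -mulrA ler_wpM2l//.
have -> : expR (- ((g - 1) * (j%:R * c + e))) = expR (- ((g - 1) * e)) * expR (- ((g - 1) * c)) ^+ j.
  by rewrite -expRM_natl -expRD; congr expR; ring.
by rewrite ler_wpM2l ?expR_ge0.
Qed.

Lemma geo_sum_le (r : R) k m : 0 < r -> r < 1 -> \sum_(k <= j < m) r ^+ j <= r ^+ k / (1 - r).
Proof.
move=> r0 r1; rewrite ler_pdivlMr ?subr_gt0//.
have rk i : 0 <= r ^+ i by rewrite exprn_ge0// ltW.
have [km|mk] := leqP k m; last by rewrite big_geq ?mul0r// ltnW.
rewrite mulr_suml (eq_bigr (fun j => - (r ^+ j.+1 - r ^+ j))); last by move=> j _; rewrite exprS; ring.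
by rewrite sumrN telescope_sumr// opprB gerBl.
Qed.

Lemma gdev_chain_geo (chi : nat -> R -> R -> R) k m (A B e : R) :
  (forall j, unit_kernel (chi j)) -> 0 <= A -> 0 <= B ->
  (forall j v, (j < m)%N -> offspring_moment HX g (chi j) v <=
     (A + B * (j%:R * c + e < v)%R%:R)%:E)%E ->
  (\int[P]_w (`|\sum_(k <= j < m) gdev j (chi j) w| `^ g)%:E <=
   (8 * (A + B * expR (- ((g - 1) * e))) * (grate ^+ k / (1 - grate)))%:E)%E.
Proof.
move=> uc A0 B0 mom; apply: (le_trans (gdev_chain k m uc)).
set K := 8 * _.
have K0 : 0 <= K by rewrite mulr_ge0// addr_ge0// mulr_ge0// expR_ge0.
apply: (@le_trans _ _ (\sum_(k <= j < m) (K * grate ^+ j)%:E)%E).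
  rewrite big_nat [leRHS]big_nat; apply: lee_sum => j /andP[_ jm].
  by apply: gbound_geo => // v; exact: mom.
rewrite sumEFin lee_fin -mulr_sumr ler_wpM2l// geo_sum_le ?grate_gt0//.
exact: grate_lt1.
Qed.

End generation_chain.

(** * Biggins' martingale *)

Section biggins_martingale.
Context {d : measure_display} {T : measurableType d} {R : realType}.
Variables (P : probability T R) (X : vertex -> nat -> T -> \bar R).
Hypotheses (HX : iid_copies P X) (HE : point_process_encoding X).
Hypothesis law1 : (\int[law HX]_x atom_sum (fun=> 1%E) x = 1)%E.

Local Notation F := (step_prob law1).

Lemma unit_kernel1 : unit_kernel (fun _ _ : R => 1 : R).
Proof. by split=> [|v y]; [exact: measurable_cst|rewrite ler01 lexx]. Qed.

Lemma gdev1 j w : gdev law1 j (fun _ _ => 1) w =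
  fine (gsum X j.+1 (fun=> 1%E) w) - fine (gsum X j (fun=> 1%E) w).
Proof.
rewrite /gdev gsumS//; congr (_ - fine _); apply: eq_gsum => v.
by rewrite integral_cst// mul1e; exact: probability_setT.
Qed.

Variables (g mg c KW : R).
Hypotheses (g1 : 1 < g) (g2 : g < 2).
Hypotheses (mgE : (\int[F]_y (expR (- ((g - 1) * y)))%:E = mg%:E)%E) (mg1 : mg < 1).
Hypothesis c0 : 0 < c.
Hypothesis KWE : (\int[law HX]_x (atom_sum (fun=> 1%E) x) `^ g = KW%:E)%E.

Lemma KW_ge0 : 0 <= KW.
Proof. by rewrite -lee_fin -KWE; apply: integral_ge0 => x _; exact: poweR_ge0. Qed.

Lemma gsum1_fin n : {ae P, forall w, gsum X n (fun=> 1%E) w \is a fin_num}.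
Proof.
have ig : P.-integrable setT (gsum X n (fun=> 1%E)).
  apply/integrableP; split; first exact: (measurable_gsum HX).
  under eq_integral do rewrite gee0_abs ?gsum_ge0//.
  by rewrite integral_gsum1// ltry.
by have := integrable_ae measurableT ig; apply: filterS => w /(_ I).
Qed.

(** The increments of W_n are the deviations for the kernel 1, whose g-th moments decay
    geometrically; Fatou's lemma carries the bound to the limit. *)
Lemma biggins_gap (W : T -> R) k : measurable_fun setT W ->
  {ae P, forall w, Wn X n w @[n --> \oo] --> (W w)%:E} ->
  (\int[P]_w (`|W w - fine (gsum X k (fun=> 1%E) w)| `^ g)%:E <=
    (8 * KW * (grate g mg c ^+ k / (1 - grate g mg c)))%:E)%E.
Proof.
move=> mW cW.
have mG n : measurable_fun setT (fun w => fine (gsum X n (fun=> 1%E) w)).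
  exact: (measurableT_comp (@fine_measurable R setT measurableT) (measurable_gsum HX n _ _)).
have mp (h : T -> R) : measurable_fun setT h -> measurable_fun setT (fun w => (`|h w| `^ g)%:E).
  move=> mh; apply/measurable_EFinP; apply: measurable_powR_comp.
  exact: measurableT_comp.
apply: (fatou_ae (f := fun m w => (`|fine (gsum X (k + m) (fun=> 1%E) w) -
   fine (gsum X k (fun=> 1%E) w)| `^ g)%:E)).
- by move=> m; apply: mp; exact: measurable_funB.
- by move=> m w; rewrite lee_fin powR_ge0.
- by apply: mp; exact: measurable_funB.
- by move=> w; rewrite lee_fin powR_ge0.
- apply: filterS cW => w cW.
  apply: cvg_EFin; first by apply: nearW.
  apply: cvg_norm_powR => //; apply: cvgB; last exact: cvg_cst.
  have h := fine_cvg cW; rewrite -(cvg_shiftn k) in h.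
  suff -> : (fun m : nat => fine (gsum X (k + m) (fun=> 1%E) w)) =
      (fun n => (fine \o (fun n => Wn X n w)) (n + k)%N) by exact: h.
  by apply/funext => n /=; rewrite WnE addnC.
- move=> m.
  have -> : (\int[P]_w (`|fine (gsum X (k + m) (fun=> 1%E) w) - fine (gsum X k (fun=> 1%E) w)| `^ g)%:E =
     \int[P]_w (`|\sum_(k <= j < k + m) gdev law1 j (fun _ _ => 1) w| `^ g)%:E)%E.
    apply: eq_integral => w _; congr (`| _ | `^ g)%:E.
    under eq_bigr do rewrite gdev1.
    by rewrite (telescope_sumr (fun j => fine (gsum X j (fun=> 1%E) w)))// leq_addr.
  have := gdev_chain_geo HE g1 g2 mgE mg1 c0 (chi := fun _ _ _ => 1) k (m := k + m)
    (A := KW) (B := 0) (e := 0) (fun=> unit_kernel1) KW_ge0 (lexx 0).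
  rewrite mul0r addr0; apply => j v _.
  by rewrite mul0r addr0 /offspring_moment KWE.
Qed.

(** Many-to-one: the first [k] steps of the walk are those along the tree. It shows that the mean of
    M_k does not depend on k. *)
Lemma gsum_walk_tail k m s :
  (\int[P]_w gsum X k (fun v => (walk_tail F m (s - v)%R)%:E) w = (walk_tail F (m + k) s)%:E)%E.
Proof.
elim: k m => [|k IH] m.
  under eq_integral do rewrite gsum0 ?lee_fin ?walk_tail_ge0// subr0.
  by rewrite integral_cst// addn0 [X in (_ * X)%E]probability_setT mule1.
have mH n : measurable_fun setT (fun v : R => (walk_tail F n (s - v))%:E).
  apply/measurable_EFinP; apply: (measurableT_comp (measurable_walk_tail F n)).
  exact: measurable_funB.
rewrite (integral_gsumS HE law1)//; last by move=> v; rewrite lee_fin walk_tail_ge0.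
rewrite addnS -addSn -IH; apply: eq_integral => w _; apply: eq_gsum => v.
rewrite walk_tailS -rint_EFin; last exact: rintegrable_walk_tail.
by apply: eq_integral => y _; congr (walk_tail _ _ _)%:E; ring.
Qed.

(** Dominated convergence, one generation at a time: averaging over one step gives functions [psi']
    with the same properties. *)
Lemma gsum_dct k (psi : nat -> R -> R) :
  (forall n, measurable_fun setT (psi n)) -> (forall n v, 0 <= psi n v <= 1) ->
  (forall v, psi n v @[n --> \oo] --> 0) ->
  (\int[P]_w gsum X k (fun v => (psi n v)%:E) w)%E @[n --> \oo] --> 0%E.
Proof.
elim: k psi => [|k IH] psi mpsi p01 pc.
  rewrite (_ : (fun n => _) = (fun n => (psi n 0)%:E)).
    by apply: cvg_EFin; [exact: nearW|exact: pc].
  apply/funext => n; have /andP[p0 _] := p01 n 0.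
  under eq_integral do rewrite gsum0 ?lee_fin//.
  by rewrite integral_cst// [X in (_ * X)%E]probability_setT mule1.
have p0 n v : (0 <= (psi n v)%:E)%E by rewrite lee_fin; have /andP[] := p01 n v.
have mshift n v : measurable_fun setT (fun y : R => psi n (v + y)).
  by apply: (measurableT_comp (mpsi n)); exact: measurable_funD.
have ir n v : rintegrable F (fun y => psi n (v + y)).
  by apply: (rintegrable_bounded _ (mshift n v)) => y; exact: p01.
pose psi' n v := \int[F]_y psi n (v + y).
have E n v : (\int[F]_y (psi n (v + y)%R)%:E)%E = (psi' n v)%:E by rewrite rint_EFin.
have mpsi2 n : measurable_fun setT (fun z : R * R => (psi n (z.1 + z.2))%:E).
  apply/measurable_EFinP; apply: (measurableT_comp (mpsi n)); exact: measurable_funD.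
rewrite (_ : (fun n => _) = (fun n => \int[P]_w gsum X k (fun v => (psi' n v)%:E) w)%E); last first.
  apply/funext => n; rewrite (integral_gsumS HE law1)//; last exact/measurable_EFinP.
  by apply: eq_integral => w _; apply: eq_gsum => v; rewrite E.
apply: IH.
- move=> n; have := measurable_chi_mean law1 (chi := fun v y => (psi n (v + y))%:E) (mpsi2 n) (fun v y => p0 n (v + y)).
  by move=> h; exact: (measurableT_comp (@fine_measurable R setT measurableT) h).
- move=> n v; rewrite -!lee_fin -E; apply/andP; split; first exact: integral_ge0.
  apply: (@le_trans _ _ (\int[F]_y 1)%E).
    apply: ge0_le_integral => //; first exact/measurable_EFinP.
    by move=> y _; rewrite lee_fin; have /andP[] := p01 n (v + y).
  by rewrite integral_cst// mul1e [leLHS]probability_setT.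
- move=> v.
  have [|||||_ _ h] := @dominated_convergence _ _ _ F setT measurableT
     (fun n y => (psi n (v + y))%:E) (cst 0%E) (cst 1%E).
  + by move=> n; exact/measurable_EFinP.
  + exact: measurable_cst.
  + by apply: aeW => y _; apply: cvg_EFin; [exact: nearW|exact: pc].
  + exact: (rintegrable_cst F 1).
  + apply: aeW => y n _; rewrite /= lee_fin ger0_norm; have /andP[] := p01 n (v + y) => //.
  rewrite integral0 in h.
  suff -> : psi'^~ v = fine \o [sequence \int[F]_(y in setT) (psi n (v + y))%:E]_n%E by exact: fine_cvg h.
  by apply/funext => n /=; rewrite E.
Qed.

(** Scheffe's argument: |A/N - B| = (A/N - B) + 2 (B - A/N)^+ with E B = 1. The positive part is at
    most the sum of (1 - h/N)^+, so a lower bound on h and an upper bound on the mean of A are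
    enough for closeness in L^1. *)
Lemma gsum_dist k (h : R -> R) (N H I : R) : 0 < N -> measurable_fun setT h ->
  (forall v, 0 <= h v) ->
  (\int[P]_w gsum X k (fun v => (h v)%:E) w = H%:E)%E ->
  (\int[P]_w gsum X k (fun v => (Num.max 0 (1 - h v / N))%:E) w = I%:E)%E ->
  (\int[P]_w (`|fine (gsum X k (fun v => (h v)%:E) w) / N - fine (gsum X k (fun=> 1%E) w)|)%:E
    <= (H / N - 1 + 2 * I)%:E)%E.
Proof.
move=> N0 mh h0 EH EI.
set A := gsum X k _; set B := gsum X k _; set Psi := gsum X k _ in EI.
have hE0 v : (0 <= (h v)%:E)%E by rewrite lee_fin.
have p0 v : 0 <= Num.max 0 (1 - h v / N) by rewrite le_max lexx.
have pE0 v : (0 <= (Num.max 0 (1 - h v / N))%:E)%E by rewrite lee_fin.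
have mpsi : measurable_fun setT (fun v => (Num.max 0 (1 - h v / N))%:E).
  apply/measurable_EFinP; apply: measurable_maxr => //; apply: measurable_funB => //.
  exact: measurable_funM.
have mhE : measurable_fun setT (fun v => (h v)%:E) by exact/measurable_EFinP.
have mA : measurable_fun setT A by exact: (measurable_gsum HX).
have mB : measurable_fun setT B by exact: (measurable_gsum HX).
have mP : measurable_fun setT Psi by exact: (measurable_gsum HX).
have A0 w : (0 <= A w)%E by exact: gsum_ge0.
have B0 w : (0 <= B w)%E by exact: gsum_ge0.
have P0 w : (0 <= Psi w)%E by exact: gsum_ge0.
have N0' : 0 <= N^-1 by rewrite invr_ge0 ltW.
have BAP w : (B w <= N^-1%:E * A w + Psi w)%E.
  rewrite /A /Psi -gsumZ// -gsumD//; last by move=> v; rewrite mule_ge0.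
  apply: gsum_le => v; rewrite -EFinM -EFinD lee_fin mulrC.
  have : 1 - h v / N <= Num.max 0 (1 - h v / N) by rewrite le_max lexx orbT.
  lra.
set D := (\int[P]_w _)%E.
(* Stated with [D + 1] so that no subtraction of possibly infinite integrals occurs. *)
suff : (D + 1 <= N^-1%:E * H%:E + 2%:E * I%:E)%E.
  have D0 : (0 <= D)%E by apply: integral_ge0 => w _; rewrite lee_fin.
  case: D D0 => [D||]// _; rewrite -!EFinM -!EFinD !lee_fin; lra.
have <- : (\int[P]_w B w = 1)%E by exact: integral_gsum1.
have mD : measurable_fun setT (fun w => (`|fine (A w) / N - fine (B w)|)%:E).
  apply/measurable_EFinP; apply: measurableT_comp => //; apply: measurable_funB.
    apply: measurable_funM => //.
    exact: (measurableT_comp (@fine_measurable R setT measurableT) mA).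
  exact: (measurableT_comp (@fine_measurable R setT measurableT) mB).
rewrite -EH -EI -!ge0_integralZl ?lee_fin// -!ge0_integralD//; last first.
- exact: measurable_funeM.
- by move=> w _; rewrite mule_ge0.
- exact: measurable_funeM.
- by move=> w _; rewrite mule_ge0.
apply: ge0_le_integral => //.
- by move=> w _; rewrite adde_ge0// lee_fin.
- exact: emeasurable_funD.
- by apply: emeasurable_funD; exact: measurable_funeM.
move=> w _; rewrite -/(A w).
have := BAP w; have := A0 w; have := B0 w; have := P0 w.
case: (Psi w) => [p||]//.
  case: (A w) => [a||]//; last first.
    by move=> _ _ _ _; rewrite gt0_muley ?lte_fin ?invr_gt0//; apply: leey.
  case: (B w) => [b||]// ; rewrite -!EFinM -!EFinD !lee_fin /= (mulrC a) => q0 q1 q2 q3.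
  have [ab|ab] := leP b (N^-1 * a).
    rewrite ger0_norm; lra.
  rewrite ltr0_norm; lra.
move=> _ _ a0 _; rewrite (gt0_muley (_ : (0 < 2%:E)%E)) ?lte_fin//.
by rewrite addey ?leey// -ltNye (@lt_le_trans _ _ 0%E)// mule_ge0// lee_fin.
Qed.

End biggins_martingale.

(** * The martingale of conditional tail masses *)

Section walk_martingale.
Context {d : measure_display} {T : measurableType d} {R : realType}.
Variables (P : probability T R) (X : vertex -> nat -> T -> \bar R).
Hypotheses (HX : iid_copies P X) (HE : point_process_encoding X).
Hypothesis law1 : (\int[law HX]_x atom_sum (fun=> 1%E) x = 1)%E.

Local Notation F := (step_prob law1).

Variables (g mg c KW : R).
Hypotheses (g1 : 1 < g) (g2 : g < 2).
Hypotheses (mgE : (\int[F]_y (expR (- ((g - 1) * y)))%:E = mg%:E)%E) (mg1 : mg < 1).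
Hypothesis c0 : 0 < c.
Hypothesis KWE : (\int[law HX]_x (atom_sum (fun=> 1%E) x) `^ g = KW%:E)%E.

Local Notation r := (grate g mg c).

Let r0 : 0 < r. Proof. exact: grate_gt0. Qed.
Let r1 : r < 1. Proof. exact: (grate_lt1 g1 mg1 c0). Qed.
Let KW0 : 0 <= KW. Proof. exact: KW_ge0 KWE. Qed.

Lemma atom_sum_le (f h : R -> \bar R) x : (forall y, f y <= h y)%E ->
  (forall y, 0 <= f y)%E -> (atom_sum f x <= atom_sum h x)%E.
Proof.
move=> fh f0; apply: lee_nneseries => i _; first by rewrite mule_ge0 ?wgt_ge0.
by rewrite lee_wpmul2l ?wgt_ge0.
Qed.

Lemma atom_sumZ (k : R) (f : R -> \bar R) x : 0 <= k -> (forall y, 0 <= f y)%E ->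
  atom_sum (fun y => k%:E * f y)%E x = (k%:E * atom_sum f x)%E.
Proof.
move=> k0 f0; rewrite /atom_sum -nneseriesZl; last by move=> i _; rewrite mule_ge0 ?wgt_ge0.
by apply: eq_eseriesr => i _; rewrite muleCA.
Qed.

Lemma atom_sumD (f h : R -> \bar R) x : (forall y, 0 <= f y)%E -> (forall y, 0 <= h y)%E ->
  atom_sum (fun y => f y + h y)%E x = (atom_sum f x + atom_sum h x)%E.
Proof.
move=> f0 h0; rewrite /atom_sum -nneseriesD; last 2 first.
- by move=> i _ _; rewrite mule_ge0 ?wgt_ge0.
- by move=> i _ _; rewrite mule_ge0 ?wgt_ge0.
by apply: eq_eseriesr => i _; rewrite ge0_muleDr.
Qed.

Lemma poweR_le (x y : \bar R) : (0 <= x)%E -> (x <= y)%E -> (x `^ g <= y `^ g)%E.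
Proof.
move=> x0 xy; have hg := g1; apply: gt0_ler_poweR => //; first by lra.
  by rewrite in_itv/= x0 leey.
by rewrite in_itv/= (le_trans x0 xy) leey.
Qed.

Let measurable_atom_sum1 (f : R -> \bar R) : measurable_fun setT f -> (forall y, 0 <= f y)%E ->
  measurable_fun setT (fun x : @atom_seq R => (atom_sum f x) `^ g)%E.
Proof.
move=> mf f0.
have mz : measurable_fun setT (fun z : @atom_seq R * R => f z.2).
  exact: (measurableT_comp mf measurable_snd).
have := measurable_atom_sum (S := @atom_seq R) (g := id) (f := fun=> f) (@measurable_id _ _ _) mz (fun _ => f0).
by move=> h; exact: (measurableT_comp (measurable_poweR g) h).
Qed.

Lemma unit_kernel_section (chi : R -> R -> R) v : unit_kernel chi ->
  measurable_fun setT (fun y => (chi v y)%:E).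
Proof.
move=> /unit_kernel_ereal[mc _].
exact: (@measurable_chi_section R (fun v y => (chi v y)%:E) v mc).
Qed.

Lemma offspring_moment_le (chi : R -> R -> R) v (f : R -> R) (kap I : R) : unit_kernel chi ->
  0 <= kap -> measurable_fun setT f -> (forall y, 0 <= f y) ->
  (forall y, chi v y <= kap * f y) ->
  (\int[law HX]_x (atom_sum (fun y => (f y)%:E) x) `^ g = I%:E)%E ->
  (offspring_moment HX g chi v <= (kap `^ g * I)%:E)%E.
Proof.
move=> uc k0 mf f0 cf fI.
have [mcE cE0] := unit_kernel_ereal uc.
have mfE : measurable_fun setT (fun y => (f y)%:E) by exact/measurable_EFinP.
have fE0 y : (0 <= (f y)%:E)%E by rewrite lee_fin.
have m1 := measurable_atom_sum1 mfE fE0.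
have m2 := measurable_atom_sum1 (unit_kernel_section v uc) (cE0 v).
rewrite EFinM -fI -ge0_integralZl ?lee_fin ?powR_ge0//; last by move=> x _; exact: poweR_ge0.
apply: ge0_le_integral => //.
- by move=> x _; exact: poweR_ge0.
- exact: measurable_funeM.
move=> x _; rewrite -poweR_EFin -poweRM ?lee_fin ?atom_sum_ge0// -atom_sumZ//.
apply: poweR_le; first exact: atom_sum_ge0.
by apply: atom_sum_le => // y; rewrite -EFinM lee_fin.
Qed.

Variables (n : nat) (t th K ZK : R).
Hypotheses (th0 : 0 < th) (K0 : 0 <= K) (K1 : K <= 1).
Hypothesis HK : forall m, (m <= n)%N -> walk_tail F m (m%:R * c + (t - 2 * th)) <= K.
Hypothesis ZKE : (\int[law HX]_x (atom_sum (fun y => (th < y)%R%:R%:E) x) `^ g = ZK%:E)%E.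

Local Notation s := (n%:R * c + t).

(** The martingale M_j of the fixed horizon [n]. In this section [th] separates big displacements
    from small ones, [K] bounds the tails at deviation t - 2 th, and [ZK] is the g-th moment of the
    tilted mass of big displacements. *)
Definition walk_mart (j : nat) (w : T) : \bar R :=
  gsum X j (fun v => (walk_tail F (n - j) (s - v)%R)%:E)%E w.

Definition walk_chi (j : nat) (v y : R) : R := walk_tail F (n - j.+1) (s - (v + y)).
Definition big_chi (j : nat) (v y : R) : R := walk_chi j v y * (th < y)%R%:R.
Definition small_chi (j : nat) (v y : R) : R := walk_chi j v y * (y <= th)%R%:R.

Lemma walk_chi_kernel j : unit_kernel (walk_chi j).
Proof.
split=> [|v y]; last exact: walk_tail_01.
apply: (measurableT_comp (measurable_walk_tail F (n - j.+1))).
by apply: measurable_funB => //; exact: measurable_funD.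
Qed.

Let ind_kernel (chi : R -> R -> R) (i : R -> bool) : unit_kernel chi ->
  measurable_fun setT (fun y => (i y)%:R : R) -> unit_kernel (fun v y => chi v y * (i y)%:R).
Proof.
move=> [mc c01] mi; split.
  apply: measurable_funM => //; exact: (measurableT_comp mi measurable_snd).
move=> v y; have /andP[h0 h1] := c01 v y.
by case: (i y); rewrite ?mulr1 ?mulr0 ?h0 ?h1 ?lexx ?ler01.
Qed.

Lemma big_chi_kernel j : unit_kernel (big_chi j).
Proof. by apply: ind_kernel; [exact: walk_chi_kernel|exact: measurable_gt_ind]. Qed.

Lemma small_chi_kernel j : unit_kernel (small_chi j).
Proof. by apply: ind_kernel; [exact: walk_chi_kernel|exact: measurable_le_ind]. Qed.

Lemma walk_chiD j v y : walk_chi j v y = big_chi j v y + small_chi j v y.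
Proof. by rewrite /big_chi /small_chi; case: ltP; rewrite ?mulr1 ?mulr0 ?addr0 ?add0r. Qed.

(** Integrating the kernel over the displacement gives back one more step of the walk, so the
    compensator of M_{j+1} is M_j. *)
Lemma gdev_walk_chi j w : (j < n)%N ->
  gdev law1 j (walk_chi j) w = fine (walk_mart j.+1 w) - fine (walk_mart j w).
Proof.
move=> jn; rewrite /gdev /walk_mart gsumS//; last by move=> v; rewrite lee_fin walk_tail_ge0.
congr (_ - fine _); apply: eq_gsum => v.
rewrite -(subnSK jn) walk_tailS -rint_EFin; last exact: rintegrable_walk_tail.
by apply: eq_integral => y _; congr (walk_tail _ _ _)%:E; ring.
Qed.

Lemma walk_mart_telescope k w : (k <= n)%N ->
  \sum_(k <= j < n) gdev law1 j (walk_chi j) w = fine (walk_mart n w) - fine (walk_mart k w).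
Proof.
move=> kn; rewrite -(telescope_sumr (fun j => fine (walk_mart j w)))//.
by rewrite big_nat [RHS]big_nat; apply: eq_bigr => j /andP[_ jn]; exact: gdev_walk_chi.
Qed.

Let fine_addB (x y z v : \bar R) : (0 <= x)%E -> (x < +oo)%E -> (0 <= y)%E -> (y < +oo)%E ->
  (0 <= z)%E -> (z < +oo)%E -> (0 <= v)%E -> (v < +oo)%E ->
  fine (x + y)%E - fine (z + v)%E = (fine x - fine z) + (fine y - fine v).
Proof.
by case: x => [x||]//; case: y => [y||]//; case: z => [z||]//; case: v => [v||]//= *; ring.
Qed.

Let gen_sum_walk_chi j w : gen_sum X j (fun v y => (walk_chi j v y)%:E) w =
  (gen_sum X j (fun v y => (big_chi j v y)%:E) w + gen_sum X j (fun v y => (small_chi j v y)%:E) w)%E.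
Proof.
have [mbE bE0] := unit_kernel_ereal (big_chi_kernel j).
have [msE sE0] := unit_kernel_ereal (small_chi_kernel j).
rewrite -esumD; last 2 first.
- by move=> u _; rewrite mule_ge0 ?wgt_ge0 ?atom_sum_ge0.
- by move=> u _; rewrite mule_ge0 ?wgt_ge0 ?atom_sum_ge0.
apply: eq_esum => u _; rewrite -ge0_muleDr ?atom_sum_ge0//; congr (_ * _)%E.
rewrite -atom_sumD//; congr (atom_sum _ _); apply/funext => y.
by rewrite -EFinD walk_chiD.
Qed.

Let gmean_walk_chi j w : gmean law1 j (walk_chi j) w =
  (gmean law1 j (big_chi j) w + gmean law1 j (small_chi j) w)%E.
Proof.
have [mbE bE0] := unit_kernel_ereal (big_chi_kernel j).
have [msE sE0] := unit_kernel_ereal (small_chi_kernel j).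
rewrite /gmean -gsumD; last 2 first.
- by move=> v; exact: integral_ge0.
- by move=> v; exact: integral_ge0.
apply: eq_gsum => v; rewrite -ge0_integralD//; last 2 first.
- exact: (unit_kernel_section v (big_chi_kernel j)).
- exact: (unit_kernel_section v (small_chi_kernel j)).
by apply: eq_integral => y _; rewrite -EFinD walk_chiD.
Qed.

Let gmean_ge0 (chi : R -> R -> R) j w : unit_kernel chi -> (0 <= gmean law1 j chi w)%E.
Proof.
by move=> /unit_kernel_ereal[_ h]; apply: gsum_ge0 => v; exact: integral_ge0.
Qed.

Local Opaque gen_sum gsum walk_tail gmean.

Lemma gdev_split j : {ae P, forall w, gdev law1 j (walk_chi j) w =
  gdev law1 j (big_chi j) w + gdev law1 j (small_chi j) w}.
Proof.
have [mb b01] := big_chi_kernel j; have [ms s01] := small_chi_kernel j.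
have [mbE bE0] := unit_kernel_ereal (big_chi_kernel j).
have [msE sE0] := unit_kernel_ereal (small_chi_kernel j).
have a1 := gen_sum_lty HE law1 mb b01 j; have a2 := gen_sum_lty HE law1 ms s01 j.
have a3 := gsum_mean_lty HE law1 mb b01 j; have a4 := gsum_mean_lty HE law1 ms s01 j.
apply: filterS2 (filterI a1 a2) (filterI a3 a4) => w [h1 h2] [h3 h4].
rewrite /gdev gen_sum_walk_chi gmean_walk_chi.
exact: (fine_addB (gen_sum_ge0 _ _ _ bE0) h1 (gen_sum_ge0 _ _ _ sE0) h2
  (gmean_ge0 _ _ (big_chi_kernel j)) h3 (gmean_ge0 _ _ (small_chi_kernel j)) h4).
Qed.

Let ae_big_split (a b e : nat -> T -> R) k m :
  (forall j, {ae P, forall w, a j w = b j w + e j w}) ->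
  {ae P, forall w, \sum_(k <= j < m) a j w = \sum_(k <= j < m) b j w + \sum_(k <= j < m) e j w}.
Proof.
move=> abe; elim: m => [|m IH]; first by apply: aeW => w; rewrite !big_geq// addr0.
have [km|mk] := leqP k m; last by apply: aeW => w; rewrite !big_geq// addr0.
apply: filterS2 IH (abe m) => w h1 h2.
by rewrite !big_nat_recr//= h1 h2 addrACA.
Qed.

Lemma gdev_sum_split k m : {ae P, forall w, \sum_(k <= j < m) gdev law1 j (walk_chi j) w =
  \sum_(k <= j < m) gdev law1 j (big_chi j) w + \sum_(k <= j < m) gdev law1 j (small_chi j) w}.
Proof. exact: (ae_big_split k m gdev_split). Qed.

(** A parent below j c + th and a displacement at most th leave a deviation of at least t - 2 th to
    the n - j - 1 remaining steps, so the kernel is at most [K]. For a parent further out it is only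
    bounded by 1; this costs (K + 1)^g <= 4 and is paid for by e^(-(g-1) th). *)
Lemma small_chi_chain k :
  (\int[P]_w (`|\sum_(k <= j < n) gdev law1 j (small_chi j) w| `^ g)%:E <=
   (8 * (K `^ g * KW + 4 * KW * expR (- ((g - 1) * th))) * (r ^+ k / (1 - r)))%:E)%E.
Proof.
apply: (gdev_chain_geo HE g1 g2 mgE mg1 c0) => [j|||j v jn].
- exact: small_chi_kernel.
- by rewrite mulr_ge0// powR_ge0.
- by rewrite mulr_ge0.
set i := (_ < v)%R.
have i0 : 0 <= (i%:R : R) by [].
apply: (@le_trans _ _ ((K + i%:R) `^ g * KW)%:E).
  apply: (@offspring_moment_le _ _ (fun=> 1)) => //; first exact: small_chi_kernel.
    exact: addr_ge0.
  move=> y; rewrite (_ : (K + i%:R) * _ = K + i%:R); last exact: mulr1.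
  rewrite /small_chi /walk_chi.
  case: (leP y th) => yth; last by rewrite mulr0 addr_ge0.
  rewrite [leLHS]mulr1.
  rewrite /i; case: (ltP _ v) => ve; first by rewrite (le_trans (walk_tail_le1 _ _ _))// lerDr.
  rewrite addr0; apply: le_trans (HK (leq_subr j.+1 n)); apply: walk_tail_le.
  have -> : n%:R = (n - j.+1)%:R + j%:R + 1 :> R by rewrite -addrA natr1 -natrD subnK.
  have := c0; lra.
rewrite lee_fin /i; case: (ltP _ v) => _; rewrite ?addr0 ?mulr0 ?addr0 ?lexx// mulr1 -mulrDl.
rewrite ler_wpM2r//; apply: (@le_trans _ _ (2 `^ g)).
  by apply: (powR_mono g1); [exact: addr_ge0|rewrite -[2](_ : 1 + 1 = _)//; apply: lerD].
have -> : 4 = 2 `^ 2 :> R by rewrite powR_mulrn//; lra.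
apply: (@le_trans _ _ (2 `^ 2)); last by rewrite lerDr powR_ge0.
by rewrite ler_powR//; have := g2; lra.
Qed.

Lemma ZK_ge0 : 0 <= ZK.
Proof. by rewrite -lee_fin -ZKE; apply: integral_ge0 => x _; exact: poweR_ge0. Qed.

Lemma big_chi_chain j0 :
  (\int[P]_w (`|\sum_(j0 <= j < n) gdev law1 j (big_chi j) w| `^ g)%:E <=
   (8 * ZK * (r ^+ j0 / (1 - r)))%:E)%E.
Proof.
have := gdev_chain_geo HE g1 g2 mgE mg1 c0 (chi := big_chi) j0 (m := n)
    (A := ZK) (B := 0) (e := 0) big_chi_kernel ZK_ge0 (lexx 0).
rewrite mul0r addr0; apply => j v _; rewrite mul0r addr0.
have := @offspring_moment_le (big_chi j) v (fun y => (th < y)%R%:R) 1 ZK (big_chi_kernel j) ler01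
  (measurable_gt_ind th) (fun y => ler0n _ _).
rewrite powR1 mul1r; apply => // y; rewrite mul1r /big_chi.
by rewrite ler_piMl ?ler0n// walk_tail_le1.
Qed.

(** The sum over big displacements and its compensator have the same mean, at most F((th, oo))
    because the kernel is below the indicator and E W_j = 1. *)
Lemma big_chi_L1 j : (\int[P]_w (`|gdev law1 j (big_chi j) w|)%:E <= (2 * tail F th)%:E)%E.
Proof.
have [mb b01] := big_chi_kernel j.
have [mbE bE0] := unit_kernel_ereal (big_chi_kernel j).
have mm := measurable_chi_mean law1 mbE bE0.
have i0 v : (0 <= \int[F]_y (big_chi j v y)%:E)%E by exact: integral_ge0.
have mG := measurable_gen_sum HX j mbE bE0.
have mM := measurable_gsum HX j mm i0.
apply: (@le_trans _ _ (\int[P]_w (gen_sum X j (fun v y => (big_chi j v y)%:E) w + gmean law1 j (big_chi j) w))%E).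
  apply: ge0_le_integral => //.
  - apply/measurable_EFinP; apply: measurableT_comp => //; apply: measurable_gdev.
    exact: big_chi_kernel.
  - exact: emeasurable_funD.
  move=> w _; rewrite /gdev.
  have G0 : (0 <= gen_sum X j (fun v y => (big_chi j v y)%:E) w)%E by exact: gen_sum_ge0.
  have M0 : (0 <= gmean law1 j (big_chi j) w)%E by exact: gsum_ge0.
  move: G0 M0; case: (gen_sum _ _ _ _) => [a||]//; case: (gmean _ _ _ _) => [b||]//=;
    rewrite ?leey// -EFinD !lee_fin => a0 b0.
  by rewrite (le_trans (ler_normB _ _))// !ger0_norm.
rewrite ge0_integralD//; last 2 first.
- by move=> w _; exact: gen_sum_ge0.
- by move=> w _; exact: gsum_ge0.
rewrite (integral_gen_sum law1)// -/(gmean law1 j (big_chi j)).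
suff H : (\int[P]_w gmean law1 j (big_chi j) w <= (tail F th)%:E)%E.
  by rewrite mulrDl mul1r EFinD; apply: leeD.
have t0 := tail_ge0 F th.
apply: (@le_trans _ _ (\int[P]_w ((tail F th)%:E * gsum X j (fun=> 1%E) w))%E).
  apply: ge0_le_integral => //.
  - by move=> w _; exact: gsum_ge0.
  - by apply: measurable_funeM; exact: (measurable_gsum HX).
  move=> w _; rewrite -gsumZ//; apply: gsum_le => v; rewrite mule1.
  rewrite /tail -rint_EFin; last exact: rintegrable_gt_ind.
  apply: ge0_le_integral => //; first exact: (unit_kernel_section v (big_chi_kernel j)).
    by apply/measurable_EFinP; exact: measurable_gt_ind.
  by move=> y _; rewrite lee_fin /big_chi ler_piMl ?ler0n// walk_tail_le1.
rewrite ge0_integralZl ?lee_fin//; last 2 first.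
- exact: (measurable_gsum HX).
- by move=> w _; exact: gsum_ge0.
by rewrite integral_gsum1// mule1.
Qed.

Lemma le_L1_Lg (h x : R) : 0 < h -> `|x| <= h + h `^ (1 - g) * `|x| `^ g.
Proof.
move=> h0; have hg := g1.
have [xh|xh] := leP `|x| h.
  by rewrite (le_trans xh)// lerDl mulr_ge0// powR_ge0.
have x0 : 0 < `|x| by exact: lt_trans xh.
suff : `|x| <= h `^ (1 - g) * `|x| `^ g by lra.
have e : `|x| = `|x| `^ (1 - g) * `|x| `^ g.
  rewrite -powRD; last by rewrite (gt_eqF x0) implybT.
  by rewrite (_ : 1 - g + g = 1) ?powRr1//; lra.
rewrite {1}e ler_wpM2r ?powR_ge0//.
rewrite /powR !gt_eqF// ler_expR.
have lx : ln h <= ln `|x| by rewrite ler_ln ?posrE// ltW.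
have : (g - 1) * ln h <= (g - 1) * ln `|x| by rewrite ler_wpM2l//; lra.
lra.
Qed.

Lemma powRD_le4 (x y : R) : `|x + y| `^ g <= 4 * (`|x| `^ g + `|y| `^ g).
Proof.
have hg := g1; have hg2 := g2.
wlog xy : x y / `|x| <= `|y|.
  move=> H; have [/H//|/ltW/H] := leP `|x| `|y|.
  by rewrite addrC [X in 4 * X]addrC.
apply: (@le_trans _ _ ((2 * `|y|) `^ g)).
  by apply: powR_mono => //; rewrite (le_trans (ler_normD _ _))//; lra.
have two : 2 `^ g <= 4 :> R.
  have -> : 4 = 2 `^ 2 :> R by rewrite powR_mulrn//; lra.
  by rewrite ler_powR//; lra.
rewrite powRM//; have := ler_wpM2r (powR_ge0 `|y| g) two; have := powR_ge0 `|x| g; lra.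
Qed.

Lemma integral_L1_Lg (f : T -> R) (h A : R) : measurable_fun setT f -> 0 < h ->
  (\int[P]_w (`|f w| `^ g)%:E <= A%:E)%E ->
  (\int[P]_w (`|f w|)%:E <= (h + h `^ (1 - g) * A)%:E)%E.
Proof.
move=> mf h0 fA.
have mfg : measurable_fun setT (fun w => (`|f w| `^ g)%:E).
  by apply/measurable_EFinP; apply: measurable_powR_comp; exact: measurableT_comp.
apply: (@le_trans _ _ (\int[P]_w (h%:E + (h `^ (1 - g))%:E * (`|f w| `^ g)%:E))%E).
  apply: ge0_le_integral => //.
  - by apply/measurable_EFinP; exact: measurableT_comp.
  - by apply: emeasurable_funD => //; exact: measurable_funeM.
  - by move=> w _; rewrite -EFinM -EFinD lee_fin le_L1_Lg.
rewrite ge0_integralD//; last 3 first.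
- by move=> w _; rewrite lee_fin ltW.
- by move=> w _; rewrite -EFinM lee_fin mulr_ge0// powR_ge0.
- exact: measurable_funeM.
rewrite integral_cst// [X in (_ * X)%E]probability_setT mule1 EFinD leeD2l//.
rewrite ge0_integralZl ?lee_fin ?powR_ge0//.
by rewrite EFinM lee_wpmul2l// lee_fin powR_ge0.
Qed.

Let measurable_gdev_sum (chi : nat -> R -> R -> R) k m : (forall j, unit_kernel (chi j)) ->
  measurable_fun setT (fun w => \sum_(k <= j < m) gdev law1 j (chi j) w).
Proof. by move=> uc; apply: measurable_sum => j; exact: measurable_gdev. Qed.

Lemma integral_normD_le (f h : T -> R) : measurable_fun setT f -> measurable_fun setT h ->
  (\int[P]_w (`|f w + h w|)%:E <= \int[P]_w (`|f w|)%:E + \int[P]_w (`|h w|)%:E)%E.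
Proof.
move=> mf mh.
have mE (u : T -> R) : measurable_fun setT u -> measurable_fun setT (fun w => (`|u w|)%:E).
  by move=> mu; apply/measurable_EFinP; exact: measurableT_comp.
rewrite -ge0_integralD//; [|exact: mE|exact: mE].
apply: ge0_le_integral => //.
- by apply: mE; exact: measurable_funD.
- by apply: emeasurable_funD; exact: mE.
- by move=> w _; rewrite -EFinD lee_fin ler_normD.
Qed.

Definition small_const : R := 8 * (K `^ g * KW + 4 * KW * expR (- ((g - 1) * th))) / (1 - r).
Definition big_const : R := 8 * ZK / (1 - r).

Lemma measurable_walk_mart j : measurable_fun setT (walk_mart j).
Proof.
apply: (measurable_gsum HX) => [|v]; last by rewrite lee_fin walk_tail_ge0.
apply/measurable_EFinP; apply: (measurableT_comp (measurable_walk_tail F _)).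
exact: measurable_funB.
Qed.

Lemma measurable_fine_walk_mart j : measurable_fun setT (fun w => fine (walk_mart j w)).
Proof.
exact: (measurableT_comp (@fine_measurable R setT measurableT) (measurable_walk_mart j)).
Qed.

Let walk_mart_ae (phi : R -> R) k : (k <= n)%N -> measurable_fun setT phi -> (forall x, 0 <= phi x) ->
  (\int[P]_w (phi (fine (walk_mart n w) - fine (walk_mart k w)))%:E =
   \int[P]_w (phi (\sum_(k <= j < n) gdev law1 j (big_chi j) w +
               \sum_(k <= j < n) gdev law1 j (small_chi j) w))%:E)%E.
Proof.
move=> kn mphi phi0; apply: ge0_ae_eq_integral => //.
- apply/measurable_EFinP; apply: (measurableT_comp mphi).
  by apply: measurable_funB; exact: measurable_fine_walk_mart.
- apply/measurable_EFinP; apply: (measurableT_comp mphi).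
  apply: measurable_funD; apply: measurable_gdev_sum => j; [exact: big_chi_kernel|exact: small_chi_kernel].
- by move=> w _; rewrite lee_fin.
- by move=> w _; rewrite lee_fin.
- apply: (filterS _ (gdev_sum_split k n)) => w <- _.
  by rewrite walk_mart_telescope.
Qed.

Lemma integral_powRD_le (f h : T -> R) (A B : R) : measurable_fun setT f -> measurable_fun setT h ->
  (\int[P]_w (`|f w| `^ g)%:E <= A%:E)%E -> (\int[P]_w (`|h w| `^ g)%:E <= B%:E)%E ->
  (\int[P]_w (`|f w + h w| `^ g)%:E <= (4 * (A + B))%:E)%E.
Proof.
move=> mf mh fA hB.
have mE (u : T -> R) : measurable_fun setT u -> measurable_fun setT (fun w => (`|u w| `^ g)%:E).
  by move=> mu; apply/measurable_EFinP; apply: measurable_powR_comp; exact: measurableT_comp.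
have p0 (u : T -> R) w : setT w -> (0 <= (`|u w| `^ g)%:E)%E by rewrite lee_fin powR_ge0.
apply: (@le_trans _ _ (\int[P]_w (4%:E * ((`|f w| `^ g)%:E + (`|h w| `^ g)%:E)))%E).
  apply: ge0_le_integral => //.
  - by apply: mE; exact: measurable_funD.
  - by apply: measurable_funeM; apply: emeasurable_funD; exact: mE.
  - by move=> w _; rewrite -EFinD -EFinM lee_fin powRD_le4.
rewrite ge0_integralZl; [|exact: measurableT| | |by rewrite lee_fin]; last 2 first.
- by apply: emeasurable_funD; exact: mE.
- by move=> w _; rewrite adde_ge0// lee_fin powR_ge0.
rewrite ge0_integralD; [|exact: measurableT|exact: p0|exact: mE|exact: p0|exact: mE].
by rewrite EFinM (EFinD A B); apply: lee_wpmul2l; [rewrite lee_fin|exact: leeD].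
Qed.

Lemma walk_mart_Lg k : (k <= n)%N ->
  (\int[P]_w (`|fine (walk_mart n w) - fine (walk_mart k w)| `^ g)%:E <=
   (4 * (small_const + big_const) * r ^+ k)%:E)%E.
Proof.
move=> kn.
have mphi : measurable_fun setT (fun x : R => `|x| `^ g).
  by apply: measurable_powR_comp; exact: normr_measurable.
rewrite (walk_mart_ae kn mphi); last by move=> x; exact: powR_ge0.
have := integral_powRD_le (measurable_gdev_sum k n big_chi_kernel)
  (measurable_gdev_sum k n small_chi_kernel) (big_chi_chain k) (small_chi_chain k).
move=> /le_trans; apply; rewrite lee_fin /big_const /small_const le_eqVlt; apply/orP; left.
by apply/eqP; ring.
Qed.

(** Big displacements are bounded in L^1 in the generations from k to j0 - 1, each at the cost 2
    F((th, oo)), and in L^g afterwards, where r^j0 is small. With j0 = k only L^g bounds remain. *)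
Lemma walk_mart_L1 k j0 (h : R) : (k <= j0)%N -> (j0 <= n)%N -> 0 < h ->
  (\int[P]_w (`|fine (walk_mart n w) - fine (walk_mart k w)|)%:E <=
   (2 * h + h `^ (1 - g) * (small_const * r ^+ k + big_const * r ^+ j0) +
    (j0 - k)%:R * (2 * tail F th))%:E)%E.
Proof.
move=> kj jn h0; have kn := leq_trans kj jn.
rewrite (walk_mart_ae kn (phi := fun x => `|x|) (@normr_measurable _ _) (fun x => normr_ge0 x)).
have mb a b : measurable_fun setT (fun w => \sum_(a <= j < b) gdev law1 j (big_chi j) w).
  exact: measurable_gdev_sum big_chi_kernel.
have ms : measurable_fun setT (fun w => \sum_(k <= j < n) gdev law1 j (small_chi j) w).
  exact: measurable_gdev_sum small_chi_kernel.
apply: (le_trans (integral_normD_le (mb _ _) ms)).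
under eq_integral do rewrite (big_cat_nat kj jn)//=.
have E1 := integral_L1_Lg (mb j0 n) h0 (big_chi_chain j0).
have E2 := integral_L1_Lg ms h0 (small_chi_chain k).
have E3 : (\int[P]_w (`|\sum_(k <= j < j0) gdev law1 j (big_chi j) w|)%:E <=
    ((j0 - k)%:R * (2 * tail F th))%:E)%E.
  elim: (j0) kj {jn E1 mb} => [|m IH] km.
    by rewrite sub0n mul0r; under eq_integral do rewrite big_geq// normr0; rewrite integral0.
  have [km'|mk] := leqP k m; last first.
    under eq_integral do rewrite big_geq// normr0.
    by rewrite integral0 lee_fin mulr_ge0// mulr_ge0// tail_ge0.
  under eq_integral do rewrite big_nat_recr//=.
  apply: (le_trans (integral_normD_le _ _)).
  - exact: measurable_gdev_sum big_chi_kernel.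
  - by apply: measurable_gdev; exact: big_chi_kernel.
  by rewrite subSn// -natr1 mulrDl mul1r EFinD leeD ?IH ?big_chi_L1.
apply: (le_trans (leeD (le_trans (integral_normD_le (mb k j0) (mb j0 n)) (leeD E3 E1)) E2)).
rewrite -!EFinD lee_fin /small_const /big_const le_eqVlt; apply/orP; left; apply/eqP; ring.
Qed.

End walk_martingale.

(** * The renormalized limit *)

Section scale_bounds.
Context {R : realType}.
Variables (F : probability R R) (g p a : R) (t : nat -> R).
Hypothesis g1 : 1 < g.
Hypotheses (i1 : rintegrable F (fun y => y)) (i2 : rintegrable F (fun y => y ^+ 2)).
Hypotheses (p2 : 2 < p) (rv : regvar (tail F) p) (c0 : 0 <= rmean F).
Hypotheses (a0 : 0 < a) (ap : p - 2 < a ^+ 2).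
Hypothesis ht : forall n, (0 < n)%N -> ldscale F a n <= t n.

Local Notation c := (rmean F).
Local Notation Q := (tail F).
Local Notation N n := (n%:R * tail F (t n)).

Let Q0 x : 0 < Q x. Proof. by have [h _] := rv; exact: h. Qed.

Lemma ldscale_slack : exists e0, [/\ 0 < e0, e0 < 1 / 2, p - 2 < ((1 - 2 * e0) * a) ^+ 2 &
  forall n, (0 < n)%N -> ldscale F ((1 - 2 * e0) * a) n <= t n - 2 * (e0 * t n)].
Proof.
have ha := a0; have hap := ap; have hp := p2.
have a20 : 0 < a ^+ 2 by rewrite exprn_gt0.
set D := a ^+ 2 - (p - 2).
have D0 : 0 < D by rewrite subr_gt0.
(* (1 - 2 e0)^2 a^2 >= a^2 - 4 e0 a^2 = a^2 - D/2, which still exceeds p - 2. *)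
set e0 := D / (8 * a ^+ 2).
have e00 : 0 < e0 by rewrite divr_gt0// mulr_gt0.
have e0E : e0 * (8 * a ^+ 2) = D by rewrite divfK// gt_eqF// mulr_gt0.
have e01 : e0 < 1 / 2 by rewrite /e0 ltr_pdivrMr ?mulr_gt0// /D; lra.
exists e0; split => // [|n n0].
  have : 0 <= a ^+ 2 * e0 ^+ 2 by rewrite mulr_ge0// sqr_ge0.
  by rewrite (_ : ((1 - 2 * e0) * a) ^+ 2 = a ^+ 2 - 4 * (e0 * a ^+ 2) + 4 * (a ^+ 2 * e0 ^+ 2)); [move: e0E; rewrite /D; lra|ring].
have k0 : 0 <= 1 - 2 * e0 by lra.
have := ler_wpM2l k0 (ht n0).
by rewrite /ldscale; lra.
Qed.

(** The left side is the price of the parents beyond j c + e0 tau. Being exponential in tau, it is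
    below any power of tau, hence below the order of the main terms. *)
Lemma expR_le_tail_powR e0 : 0 < e0 -> exists n0 : nat, forall n tau, (n0 <= n)%N ->
  ldscale F a n <= tau -> expR (- ((g - 1) * (e0 * tau))) <= Q tau `^ g.
Proof.
move=> e00; have hg := g1; have hp := p2.
have [||q0 q00 [t3 Ht3]] := @tail_exp_lb _ _ _ (@tail_le _ F) rv (p + 1); try lra.
have A0 : 0 < (p + 1) * g by rewrite mulr_gt0//; lra.
have g0 : 0 < (g - 1) * e0 by rewrite mulr_gt0//; lra.
have eta0 : 0 < (g - 1) * e0 / (2 * ((p + 1) * g)) by rewrite divr_gt0// mulr_gt0.
have [t4 Ht4] := le_expR_eventually ltr01 eta0.
(* Half of the exponent (g - 1) e0 tau covers the power of tau, the other half the constant [q0];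
   [G] is the size of tau needed for the latter. *)
set G := g * `|ln q0| / ((g - 1) * e0 / 2).
have G0 : 0 <= G by apply: divr_ge0; [rewrite mulr_ge0//; lra|lra].
have [n3 H3] := ldscale_large i1 i2 rv a0 (`|t3| + `|t4| + G).
exists n3 => n tau h3 hs; have [At t0 _ _ _] := H3 _ _ h3 hs.
have tE : tau = expR (ln tau) by rewrite lnK ?posrE.
have [a3 a4] := (ler_norm t3, ler_norm t4).
have [A3 A4] := (normr_ge0 t3, normr_ge0 t4).
have t3' : q0 * expR (- (p + 1) * ln tau) <= Q tau.
  by have := Ht3 (ln tau); rewrite -tE; apply; lra.
have t4' : ln tau <= (g - 1) * e0 / (2 * ((p + 1) * g)) * tau.
  by have := Ht4 (ln tau); rewrite mul1r -tE; apply; lra.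
have lt : ln tau <= tau by have := expR_ge1Dx (ln tau); rewrite -tE; lra.
apply: (@le_trans _ _ ((q0 * expR (- (p + 1) * ln tau)) `^ g)); last first.
  by apply: (powR_mono g1) => //; rewrite mulr_ge0 ?expR_ge0// ltW.
have -> : q0 * expR (- (p + 1) * ln tau) = expR (ln q0 - (p + 1) * ln tau).
  by rewrite expRD lnK ?posrE// mulNr.
rewrite -expRM ler_expR.
have h5 : (p + 1) * g * ln tau <= (g - 1) * e0 / 2 * tau.
  have := ler_wpM2l (ltW A0) t4'; set A := (p + 1) * g.
  by rewrite (_ : A * ((g - 1) * e0 / (2 * A) * tau) = (g - 1) * e0 / 2 * tau)//; field; rewrite gt_eqF.
have h6 : g * `|ln q0| <= (g - 1) * e0 / 2 * tau.
  rewrite [leRHS]mulrC -ler_pdivrMr; last by lra.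
  rewrite -/G; lra.
have h7 : - (g * ln q0) <= g * `|ln q0|.
  by rewrite -mulrN ler_wpM2l; [|lra|rewrite -normrN ler_norm].
lra.
Qed.

Lemma eventual_bounds e0 : 0 < e0 -> e0 < 1 / 2 -> p - 2 < ((1 - 2 * e0) * a) ^+ 2 ->
  (forall n, (0 < n)%N -> ldscale F ((1 - 2 * e0) * a) n <= t n - 2 * (e0 * t n)) ->
  exists C, exists n0 : nat, 0 < C /\ forall n, (n0 <= n)%N ->
  [/\ (0 < n)%N, 0 < t n, 0 < N n <= 1 &
   [/\ forall m, (m <= n)%N -> walk_tail F m (m%:R * c + (t n - 2 * (e0 * t n))) <= C * N n,
       C * N n <= 1, Q (e0 * t n) <= C * Q (t n) &
       expR (- ((g - 1) * (e0 * t n))) <= N n `^ g]].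
Proof.
move=> e00 e01 bp hb; have hg := g1; have hp := p2.
have b0 : 0 < (1 - 2 * e0) * a by rewrite mulr_gt0//; lra.
have l0 : 0 < 1 - 2 * e0 by lra.
have [C1 C10 [n1 H1]] := walk_tail_unif i1 i2 p2 rv c0 b0 bp.
have e1 : 1 - 2 * e0 < 1 - 2 * e0 + 1 by lra.
have lk : (1 - 2 * e0) `^ (- p) < (1 - 2 * e0) `^ (- p) + 1 by lra.
have ek : e0 `^ (- p) < e0 `^ (- p) + 1 by lra.
have [t1 Ht1] := regvar_le rv l0 lk; have [t2 Ht2] := regvar_le rv e00 ek.
set k1 := _ + 1 in Ht1; set k2 := _ + 1 in Ht2.
have k10 : 0 < k1 by rewrite ltr_wpDl// powR_ge0.
have k20 : 0 < k2 by rewrite ltr_wpDl// powR_ge0.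
(* One constant for the uniform tail bound, transported from (1 - 2 e0) t to t, and for the ratio
   Q(e0 t) / Q(t). Asking N <= C^-1 then makes C N an admissible bound [K <= 1]. *)
set C := C1 * k1 + k2.
have C0 : 0 < C by rewrite addr_gt0// mulr_gt0.
have C10' : 0 < C^-1 by rewrite invr_gt0.
have m0 : 0 < Num.min 1 C^-1 by rewrite lt_min ltr01.
have [n2 H2] := ntail_small i1 i2 p2 rv a0 m0.
have [n4 H4] := expR_le_tail_powR e00.
have [n3 H3] := ldscale_large i1 i2 rv a0 (`|t1| + `|t2|).
exists C, (maxn (maxn n1 n2) (maxn n3 n4)); split => // n.
rewrite !geq_max => /andP[/andP[h1 h2] /andP[h3 h4]].
have n0 : (0 < n)%N.
  have := H3 n (ldscale F a n) h3 (lexx _) => -[_ _ _ _]; exact.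
have hs := ht n0.
have [At t0 _ _ _] := H3 _ _ h3 hs.
have N1 := H2 _ _ h2 hs.
have nR0 : 0 < n%:R :> R by rewrite ltr0n.
have nR1 : 1 <= n%:R :> R by rewrite ler1n.
have N0 : 0 < N n by rewrite mulr_gt0.
have [b1 b2] : N n <= 1 /\ N n <= C^-1 by move: N1; rewrite le_min => /andP[].
have [a1 a2] := (ler_norm t1, ler_norm t2).
have [A1 A2] := (normr_ge0 t1, normr_ge0 t2).
have lt : ln (t n) <= t n.
  by have := expR_ge1Dx (ln (t n)); rewrite lnK ?posrE//; lra.
have q1 : Q ((1 - 2 * e0) * t n) <= k1 * Q (t n) by apply: Ht1; lra.
have q2 : Q (e0 * t n) <= k2 * Q (t n) by apply: Ht2; lra.
have Qn := Q0 (t n).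
split => //; first by rewrite N0.
split.
- move=> m mn; apply: (le_trans (H1 n m _ h1 mn (hb n n0))).
  have -> : t n - 2 * (e0 * t n) = (1 - 2 * e0) * t n by ring.
  apply: (@le_trans _ _ (C1 * (n%:R * (k1 * Q (t n))))).
    by rewrite ler_pM2l// ler_pM2l.
  have : 0 <= k2 * N n by rewrite mulr_ge0// ltW.
  by rewrite /C; lra.
- by rewrite mulrC -ler_pdivlMr// mul1r.
- by apply: (le_trans q2); rewrite ler_pM2r// /C lerDr mulr_ge0// ltW.
- apply: le_trans (H4 _ _ h4 hs) _; apply: (powR_mono g1); first exact: ltW.
  by rewrite ler_peMl// ltW.
Qed.

End scale_bounds.

Lemma geometric_small {R : realType} (r A eta : R) : 0 < r -> r < 1 -> 0 <= A -> 0 < eta ->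
  exists k0 : nat, forall k, (k0 <= k)%N -> A * r ^+ k <= eta.
Proof.
move=> r0 r1 A0 e0; have lr : ln r < 0 by rewrite -oppr_gt0 -lnV ?posrE// ln_gt0// invf_gt1.
have [k0 H] := nat_gt ((ln (eta / (A + 1))) / ln r).
exists k0 => k /H h.
have A1 : 0 < A + 1 by lra.
rewrite -[r]lnK ?posrE// -expRM_natl.
have h2 : k%:R * ln r <= ln (eta / (A + 1)).
  by move: h; rewrite ltr_ndivrMr// => /ltW.
have : expR (k%:R * ln r) <= eta / (A + 1) by rewrite -[leRHS]lnK ?ler_expR// posrE divr_gt0.
rewrite ler_pdivlMr//; have := expR_gt0 (k%:R * ln r); lra.
Qed.

(** Chooses the number i of generations treated in L^1, with y = - ln N. It must be at least G y, to
    make r^i a high power of N, and small against n, since each generation costs a multiple of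
    Q(t_n) = N / n. *)
Lemma slow_generations {R : realType} (G C e : R) (k : nat) : 0 < G -> 0 < C -> 0 < e ->
  exists2 z, 0 < z & exists n0 : nat, forall n (y : R), (n0 <= n)%N -> 0 <= y -> y <= z * n%:R ->
  exists i : nat, [/\ (k + i <= n)%N, G * y <= i%:R & i%:R * (2 * C) <= 2 * e * n%:R].
Proof.
move=> G0 C0 e0; have CG : 0 < C * G by rewrite mulr_gt0.
exists (Num.min (1 / (4 * G)) (e / (4 * (C * G)))).
  by rewrite lt_min !divr_gt0 ?mulr_gt0.
have [n0 H] := @nat_gt R (4 * k%:R + 4 + 8 * C / e).
exists n0 => n y /H nk y0 yz.
have Ce : 0 <= 8 * C / e by rewrite divr_ge0// ltW// mulr_gt0.
have kR : 0 <= k%:R :> R by [].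
have yz1 : y <= 1 / (4 * G) * n%:R.
  by apply: (le_trans yz); rewrite ler_wpM2r// ge_min lexx.
have yz2 : y <= e / (4 * (C * G)) * n%:R.
  by apply: (le_trans yz); rewrite ler_wpM2r// ge_min lexx orbT.
have x0 : 0 <= G * y by rewrite mulr_ge0// ltW.
have x4 : 4 * (G * y) <= n%:R.
  have := ler_wpM2l (ltW G0) yz1.
  rewrite (_ : G * (1 / (4 * G) * n%:R) = n%:R / 4); last by field; rewrite gt_eqF.
  lra.
have xC : 4 * C * (G * y) <= e * n%:R.
  have := ler_wpM2l (ltW CG) yz2.
  rewrite (_ : C * G * (e / (4 * (C * G)) * n%:R) = e * n%:R / 4); last by field; rewrite !gt_eqF.
  lra.
have CX : 8 * C <= e * n%:R by rewrite [leRHS]mulrC -ler_pdivrMr//; lra.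
have /andP[h1 h2] := truncn_itv x0; rewrite -natr1 in h2.
exists (Num.truncn (G * y)).+1; rewrite -natr1; split; last 2 first.
- exact: ltW.
- have := ler_wpM2r (ltW C0) h1; lra.
by rewrite -(ler_nat R) natrD -natr1; lra.
Qed.

Section renormalized_limit.
Context {d : measure_display} {T : measurableType d} {R : realType}.
Variables (P : probability T R) (X : vertex -> nat -> T -> \bar R).
Hypotheses (HX : iid_copies P X) (HE : point_process_encoding X).
Hypothesis law1 : (\int[law HX]_x atom_sum (fun=> 1%E) x = 1)%E.

Local Notation F := (step_prob law1).
Local Notation c := (rmean F).

Variables (g mg KW p a : R) (t : nat -> R) (W : T -> R).
Hypotheses (g1 : 1 < g) (g2 : g < 2).
Hypotheses (mgE : (\int[F]_y (expR (- ((g - 1) * y)))%:E = mg%:E)%E) (mg1 : mg < 1).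
Hypothesis KWE : (\int[law HX]_x (atom_sum (fun=> 1%E) x) `^ g = KW%:E)%E.
Hypotheses (i1 : rintegrable F (fun y => y)) (i2 : rintegrable F (fun y => y ^+ 2)).
Hypotheses (p2 : 2 < p) (rv : regvar (tail F) p) (c0 : 0 < c).
Hypotheses (a0 : 0 < a) (ap : p - 2 < a ^+ 2).
Hypothesis ht : forall n, (0 < n)%N -> ldscale F a n <= t n.
Hypothesis mW : measurable_fun setT W.
Hypothesis cW : {ae P, forall w, Wn X n w @[n --> \oo] --> (W w)%:E}.

Local Notation r := (grate g mg c).
Local Notation Q := (tail F).
Local Notation N n := (n%:R * tail F (t n)).
Local Notation M n j := (walk_mart law1 c n (t n) j).

Let r0 : 0 < r. Proof. exact: grate_gt0. Qed.
Let r1 : r < 1. Proof. exact: (grate_lt1 g1 mg1 c0). Qed.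
Let KW0 : 0 <= KW. Proof. exact: KW_ge0 KWE. Qed.
Let Q0 x : 0 < Q x. Proof. by have [h _] := rv; exact: h. Qed.
Let cge0 : 0 <= c. Proof. exact: ltW. Qed.

Definition tail_moment (th : R) : R :=
  fine (\int[law HX]_x (atom_sum (fun y => (th < y)%R%:R%:E) x) `^ g)%E.

Lemma tail_moment_spec th : (\int[law HX]_x (atom_sum (fun y => (th < y)%R%:R%:E) x) `^ g
   = (tail_moment th)%:E)%E /\ tail_moment th <= KW.
Proof.
have uc : unit_kernel (fun _ y : R => (th < y)%R%:R).
  split=> [|v y]; last exact: ind_01.
  exact: (measurableT_comp (measurable_gt_ind th) measurable_snd).
have m1 : measurable_fun setT (fun _ : R => 1 : R) by exact: measurable_cst.
have cf y : (th < y)%R%:R <= 1 * 1 :> R by rewrite mulr1; case: (th < y); rewrite ?ler01.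
have H := offspring_moment_le (HX := HX) g1 (v := 0) uc ler01 m1 (fun=> ler01) cf KWE.
rewrite powR1 mul1r /offspring_moment in H.
have fin : (\int[law HX]_x (atom_sum (fun y => (th < y)%R%:R%:E) x) `^ g)%E \is a fin_num.
  rewrite ge0_fin_numE; first by rewrite (le_lt_trans H)// ltry.
  by apply: integral_ge0 => x _; exact: poweR_ge0.
by rewrite /tail_moment fineK//; split => //; rewrite -lee_fin fineK.
Qed.

Definition mart_small := forall eta, 0 < eta -> exists k0 : nat, forall k, (k0 <= k)%N ->
  exists n0 : nat, forall n, (n0 <= n)%N -> (k <= n)%N /\
  (\int[P]_w (`|fine (M n n w) - fine (M n k w)|)%:E <= (eta * N n)%:E)%E.

(** With the tail bound a multiple of N and the exponential price of far parents below N^g, both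
    parts of [small_const] are of order N^g. *)
Lemma small_constE C n : 0 < C -> 0 < N n -> expR (- ((g - 1) * C)) <= N n `^ g -> forall K,
  0 <= K ->
  small_const g mg c KW C (K * N n) <= 8 * (K `^ g * KW + 4 * KW) / (1 - r) * N n `^ g.
Proof.
move=> C0 N0 eN K K0; rewrite /small_const [(K * N n) `^ g]powRM ?(ltW N0)//.
rewrite [leRHS]mulrAC ler_pM2r; last by rewrite invr_gt0; have := r1; lra.
apply: (@le_trans _ _ (8 * (K `^ g * N n `^ g * KW + 4 * KW * N n `^ g))).
  by rewrite ler_pM2l// lerD2l ler_wpM2l// mulr_ge0.
by rewrite le_eqVlt; apply/orP; left; apply/eqP; ring.
Qed.

Let powN (eta x : R) : 0 < eta -> 0 < x -> (eta * x) `^ (1 - g) * x `^ g = eta `^ (1 - g) * x.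
Proof.
move=> e0 x0; rewrite powRM ?ltW// -mulrA -powRD; last by rewrite (gt_eqF x0) implybT.
by rewrite (_ : 1 - g + g = 1) ?powRr1 ?ltW//; lra.
Qed.

Let powN_le (eta x A B : R) : 0 < eta -> 0 < x -> eta `^ (1 - g) * A * B <= eta ->
  (eta * x) `^ (1 - g) * (A * x `^ g * B) <= eta * x.
Proof.
move=> e0 x0 h; rewrite (_ : _ * _ = ((eta * x) `^ (1 - g) * x `^ g) * A * B); last by ring.
rewrite (powN e0 x0); have := ler_wpM2r (ltW x0) h; lra.
Qed.

Let powN_le1 (eta x B : R) : 0 < eta -> 0 < x -> 0 <= B -> x <= eta `^ g / (B + 1) ->
  (eta * x) `^ (1 - g) * (B * x `^ (g + 1)) <= eta * x.
Proof.
move=> e0 x0 B0; rewrite ler_pdivlMr; last by lra.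
move=> h; rewrite (_ : x `^ (g + 1) = x `^ g * x); last first.
  by rewrite powRD ?powRr1 ?ltW// (gt_eqF x0) implybT.

rewrite (_ : _ * _ = ((eta * x) `^ (1 - g) * x `^ g) * B * x); last by ring.
rewrite (powN e0 x0) ler_pM2r//.
have h' : B * x <= eta `^ g by lra.
have := ler_wpM2l (powR_ge0 eta (1 - g)) h'.
rewrite -powRD; last by rewrite (gt_eqF e0) implybT.
by rewrite (_ : 1 - g + g = 1) ?powRr1 ?(ltW e0)//; lra.
Qed.

Section heavy_offspring.
Hypothesis A5' : exists CA, 0 <= CA /\ \forall s \near +oo, tail_moment s <= CA * Q s `^ g.

(** Under (A5) the g-th moment of the big offspring is of order Q(e0 t)^g, hence of order Q(t)^g by
    regular variation, and n >= 1 allows N in place of Q(t). *)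
Lemma big_const_bound e0 C : 0 < e0 -> 0 < C ->
  (exists n0 : nat, forall n, (n0 <= n)%N -> [/\ (0 < n)%N, 0 < t n & Q (e0 * t n) <= C * Q (t n)]) ->
  exists CB, exists n0 : nat, 0 <= CB /\ forall n, (n0 <= n)%N ->
    big_const g mg c (tail_moment (e0 * t n)) <= CB * N n `^ g.
Proof.
move=> e00 C0 [n1 H1]; have [CA [CA0 [s0 [_ Hs]]]] := A5'.
have hg := g1.
have [n2 H2] := ldscale_large i1 i2 rv a0 (`|s0| / e0).
exists (8 * (CA * C `^ g) / (1 - r)), (maxn n1 n2); split.
  by rewrite divr_ge0 ?mulr_ge0 ?powR_ge0//; have := r1; lra.
move=> n; rewrite geq_max => /andP[/H1[n0 t0 q1] h2].
have [At _ _ _ _] := H2 _ _ h2 (ht n0).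
have lt : 1 + ln (t n) <= t n.
  by have := expR_ge1Dx (ln (t n)); rewrite lnK ?posrE//; lra.
have es : s0 < e0 * t n.
  rewrite ler_pdivrMr// in At.
  have : e0 * (1 + ln (t n)) <= e0 * t n by rewrite ler_pM2l.
  have := ler_norm s0; lra.
have nR1 : 1 <= n%:R :> R by rewrite ler1n.
have Qn := Q0 (t n).
rewrite /big_const [leRHS]mulrAC ler_pM2r; last by rewrite invr_gt0; have := r1; lra.
rewrite -[leRHS]mulrA ler_pM2l//.
have nR0 : 0 < n%:R :> R by exact: lt_le_trans nR1.
have -> : CA * C `^ g * N n `^ g = CA * (C * N n) `^ g.
  by rewrite [(C * N n) `^ g]powRM ?mulrA// ?mulr_ge0// ltW.
apply: (le_trans (Hs _ es)); rewrite ler_wpM2l//.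
apply: powR_mono => //; first exact: tail_ge0.
by apply: (le_trans q1); rewrite ler_pM2l// ler_peMl// ltW.
Qed.

Lemma walk_mart_Lg_bound : exists C, exists n0 : nat, 0 <= C /\
  forall n k, (n0 <= n)%N -> (k <= n)%N ->
  [/\ (0 < n)%N, 0 < N n <= 1,
  (\int[P]_w (`|fine (M n n w) - fine (M n k w)| `^ g)%:E <= (C * N n `^ g * r ^+ k)%:E)%E &
  forall h, 0 < h -> (\int[P]_w (`|fine (M n n w) - fine (M n k w)|)%:E <=
      (2 * h + h `^ (1 - g) * (C * N n `^ g * r ^+ k))%:E)%E].
Proof.
have [e0 [e00 e01 bp hb]] := (ldscale_slack p2 a0 ap ht).
have [C [n1 [C0 H1]]] := eventual_bounds g1 i1 i2 p2 rv cge0 a0 ht e00 e01 bp hb.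
have [|CB [n2 [CB0 H2]]] := big_const_bound e00 C0.
  by exists n1 => n /H1[? ? _ [_ _ ? _]].
set CS := 8 * (C `^ g * KW + 4 * KW) / (1 - r).
have CS0 : 0 <= CS.
  apply: divr_ge0; last by rewrite subr_ge0 ltW.
  by rewrite mulr_ge0 ?addr_ge0 ?mulr_ge0 ?powR_ge0.
exists (4 * (CS + CB)), (maxn n1 n2); split; first by rewrite mulr_ge0// addr_ge0.
move=> n k; rewrite geq_max => /andP[/H1[n0 t0 N01 [HK K1 q1 eN]] /H2 h2] kn.
have /andP[N0 N1] := N01.
have th0 : 0 < e0 * t n by rewrite mulr_gt0.
have K0 : 0 <= C * N n by rewrite mulr_ge0 ?ltW.
have [ZKE _] := tail_moment_spec (e0 * t n).
have sc := small_constE th0 N0 eN (ltW C0).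
have rk : 0 <= r ^+ k by rewrite exprn_ge0// ltW.
have rk1 : r ^+ k <= 1 by rewrite exprn_ile1 ?ltW.
split => //.
- apply: (le_trans (walk_mart_Lg HE g1 g2 mgE mg1 c0 KWE K0 K1 HK ZKE kn)).
  by rewrite lee_fin ler_wpM2r// -mulrA ler_pM2l// mulrDl lerD.
- move=> h h0.
  apply: (le_trans (walk_mart_L1 HE g1 g2 mgE mg1 c0 KWE K0 K1 HK ZKE (leqnn k) kn h0)).
  rewrite lee_fin subnn mul0r addr0 lerD2l ler_wpM2l ?powR_ge0// -mulrDl ler_wpM2r//.
  have : 0 <= (CS + CB) * N n `^ g by rewrite mulr_ge0 ?addr_ge0 ?powR_ge0.
  rewrite -/CS in sc; lra.
Qed.

Lemma mart_small_heavy : mart_small.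
Proof.
have [C [n0 [C0 H]]] := walk_mart_Lg_bound.
(* With h = (eta/3) N, two thirds go to 2 h and one to the L^g term. *)
move=> eta e0; have e3 : 0 < eta / 3 by lra.
have A0 : 0 <= (eta / 3) `^ (1 - g) * C by rewrite mulr_ge0// powR_ge0.
have [k0 Hk] := geometric_small r0 r1 A0 e3.
exists k0 => k /Hk{}Hk; exists (maxn n0 k) => n; rewrite geq_max => /andP[h1 kn].
have [n0' /andP[N0 N1] _ L1] := H n k h1 kn; split => //.
apply: (le_trans (L1 (eta / 3 * N n) _)); first by rewrite mulr_gt0.
rewrite lee_fin; have := powN_le e3 N0 Hk; lra.
Qed.

End heavy_offspring.

Section slow_normalization.
Hypothesis slow : forall eta, 0 < eta -> exists n0 : nat, forall n, (n0 <= n)%N ->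
  - ln (N n) <= eta * n%:R.

Lemma mart_small_slow : mart_small.
Proof.
have hg := g1.
have [e0 [e00 e01 bp hb]] := (ldscale_slack p2 a0 ap ht).
have [C [n1 [C0 H1]]] := eventual_bounds g1 i1 i2 p2 rv cge0 a0 ht e00 e01 bp hb.
set CS := 8 * (C `^ g * KW + 4 * KW) / (1 - r).
have CS0 : 0 <= CS.
  apply: divr_ge0; last by rewrite subr_ge0 ltW.
  by rewrite mulr_ge0 ?addr_ge0 ?mulr_ge0 ?powR_ge0.
set CB := 8 * KW / (1 - r).
have CB0 : 0 <= CB by rewrite divr_ge0 ?mulr_ge0//; have := r1; lra.
set L := - ln r.
have L0 : 0 < L by rewrite /L -lnV ?posrE// ln_gt0// invf_gt1.
(* Six shares: two for 2 h, one for each of the two L^g terms, two for the L^1 term. *)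
move=> eta eta0; have e5 : 0 < eta / 6 by lra.
have E0 : 0 <= (eta / 6) `^ (1 - g) by exact: powR_ge0.
have [k0 Hk] := geometric_small r0 r1 (mulr_ge0 E0 CS0) e5.
exists k0 => k /Hk{}Hk.
(* i >= (g + 1)(- ln N) / L gives r^i <= N^(g+1), one power more than needed to make h^(1-g) r^i of
   order N; the extra factor N absorbs the constant [CB], as [big_const] is merely bounded here. *)
have KC0 : 0 < (g + 1) / L by rewrite divr_gt0//; lra.
have [z z0 [n4 H4]] := slow_generations k KC0 C0 e5.
have [n2 H2] := slow z0.
have e0' : 0 < Num.min 1 ((eta / 6) `^ g / (CB + 1)).
  by rewrite lt_min ltr01 divr_gt0 ?powR_gt0//; lra.
have [n3 H3] := ntail_small i1 i2 p2 rv a0 e0'.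
exists (maxn (maxn n1 n2) (maxn n3 n4)) => n.
rewrite !geq_max => /andP[/andP[/H1[n0 t0 /andP[N0 N1] [HK K1 q1 eN]] /H2 sl] /andP[h3 h4]].
have N2 := H3 _ _ h3 (ht n0).
have th0 : 0 < e0 * t n by rewrite mulr_gt0.
have K0 : 0 <= C * N n by rewrite mulr_ge0 ?ltW.
have [ZKE ZK1] := tail_moment_spec (e0 * t n).
have sc := small_constE th0 N0 eN (ltW C0).
have nR0 : 0 < n%:R :> R by rewrite ltr0n.
have lN : ln (N n) <= 0 by rewrite -ln1 ler_ln ?posrE.
have y0 : 0 <= - ln (N n) by rewrite oppr_ge0.
have [i [jn xi iC]] := H4 n _ h4 y0 sl.
set j0 := (k + i)%N in jn.
have kj : (k <= j0)%N by exact: leq_addr.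
split; first exact: leq_trans jn.
apply: (le_trans (walk_mart_L1 HE g1 g2 mgE mg1 c0 KWE K0 K1 HK ZKE kj jn (mulr_gt0 e5 N0))).
have rk : 0 <= r ^+ k by rewrite exprn_ge0// ltW.
have rk1 : r ^+ k <= 1 by rewrite exprn_ile1 ?ltW.
have rj : r ^+ j0 <= N n `^ (g + 1).
  rewrite exprD; apply: (@le_trans _ _ (r ^+ i)); first by rewrite ler_piMl// exprn_ge0// ltW.
  rewrite -[r]lnK ?posrE// -expRM_natl /powR gt_eqF// ler_expR.
  have := ler_wpM2l (ltW L0) xi.
  rewrite (_ : L * ((g + 1) / L * - ln (N n)) = - ((g + 1) * ln (N n))); last by field; rewrite gt_eqF.
  by rewrite /L mulNr lerN2 [ln r * _]mulrC.
have bc : big_const g mg c (tail_moment (e0 * t n)) <= CB.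
  by rewrite /big_const /CB ler_pM2r ?ler_pM2l// invr_gt0 subr_gt0.
have T1 := powN_le e5 N0 Hk.
have T2 := powN_le1 e5 N0 CB0 (le_trans N2 (_ : _ <= (eta / 6) `^ g / (CB + 1))).
have {}T2 : (eta / 6 * N n) `^ (1 - g) * (CB * N n `^ (g + 1)) <= eta / 6 * N n.
  by apply: T2; rewrite ge_min lexx orbT.
have T3 : (j0 - k)%:R * (2 * Q (e0 * t n)) <= 2 * (eta / 6) * N n.
  rewrite (_ : (j0 - k)%N = i); last by rewrite /j0 addKn.
  apply: (@le_trans _ _ (i%:R * (2 * C) * Q (t n))).
    by rewrite -!mulrA ler_wpM2l// ler_wpM2l.
  by rewrite [leRHS]mulrA ler_wpM2r// ltW.
rewrite lee_fin.
have U1 : (eta / 6 * N n) `^ (1 - g) * (small_const g mg c KW (e0 * t n) (C * N n) * r ^+ k)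
    <= eta / 6 * N n.
  by apply: le_trans T1; rewrite ler_wpM2l ?powR_ge0// ler_wpM2r.
have U2 : (eta / 6 * N n) `^ (1 - g) * (big_const g mg c (tail_moment (e0 * t n)) * r ^+ j0)
    <= eta / 6 * N n.
  apply: le_trans T2; rewrite ler_wpM2l ?powR_ge0//.
  apply: ler_pM => //; last by rewrite exprn_ge0// ltW.
  rewrite /big_const; apply: divr_ge0; last by rewrite subr_ge0 ltW.
  by rewrite mulr_ge0//; exact: (ZK_ge0 ZKE).
rewrite [_ `^ _ * (_ + _)]mulrDr; lra.
Qed.

End slow_normalization.

End renormalized_limit.

(** * From L^1 convergence and L^g bounds to L^q *)

Section Lq_interpolation.
Context {d : measure_display} {T : measurableType d} {R : realType}.
Variables (P : probability T R) (g q : R).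
Hypotheses (q0 : 0 < q) (qg : q < g).

(* The three terms dominate [x ^ q] near 0, on a compact interval and near infinity. *)
Lemma powR_interp (e : R) : 0 < e -> exists2 K, 0 <= K &
  forall x, 0 <= x -> x `^ q <= e + K * x + e * x `^ g.
Proof.
move=> e0; have hq := q0; have hg := qg.
set del := e `^ q^-1; set B := e `^ (q - g)^-1.
have del0 : 0 < del by exact: powR_gt0.
have B0 : 0 < B by exact: powR_gt0.
exists (B `^ q / del) => [|x x0]; first by rewrite divr_ge0 ?powR_ge0// ltW.
have K0 : 0 <= B `^ q / del * x by rewrite mulr_ge0// divr_ge0 ?powR_ge0// ltW.
have G0 : 0 <= e * x `^ g by rewrite mulr_ge0 ?powR_ge0// ltW.
have [xd|dx] := leP x del.
  have : x `^ q <= e; last by lra.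
  have -> : e = del `^ q by rewrite -powRrM mulVf ?powRr1 ?ltW// gt_eqF.
  by apply: ge0_ler_powR; rewrite ?nnegrE// ltW.
have [Bx|xB] := leP B x.
  have : x `^ q <= e * x `^ g; last by lra.
  have x1 : 0 < x by exact: lt_le_trans Bx.
  rewrite (_ : q = (q - g) + g); last by ring.
  rewrite powRD; last by rewrite (gt_eqF x1) implybT.
  rewrite ler_wpM2r ?powR_ge0//.
  have -> : e = B `^ (q - g) by rewrite -powRrM mulVf ?powRr1 ?ltW// lt_eqF//; lra.
  rewrite /powR !gt_eqF// ler_expR ler_nM2l; last by lra.
  by rewrite ler_ln ?posrE.
have : x `^ q <= B `^ q / del * x; last by lra.
apply: (@le_trans _ _ (B `^ q)).
  by apply: ge0_ler_powR; [exact: ltW|rewrite nnegrE|rewrite nnegrE ltW|exact: ltW].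
by rewrite -mulrA ler_peMr ?powR_ge0// mulrC ler_pdivlMr// mul1r ltW.
Qed.

Lemma Lq_of_L1_Lg (D : nat -> T -> R) (C : R) : (forall n, measurable_fun setT (D n)) ->
  (forall eta, 0 < eta -> exists n0 : nat, forall n, (n0 <= n)%N ->
    (\int[P]_w (`|D n w|)%:E <= eta%:E)%E) ->
  (exists n0 : nat, forall n, (n0 <= n)%N -> (\int[P]_w (`|D n w| `^ g)%:E <= C%:E)%E) ->
  forall eta, 0 < eta -> exists n0 : nat, forall n, (n0 <= n)%N ->
    (\int[P]_w (`|D n w| `^ q)%:E <= eta%:E)%E.
Proof.
move=> mD L1 [n1 LG] eta e0.
have C0 : 0 <= C.
  rewrite -lee_fin; apply: le_trans (LG n1 (leqnn _)); apply: integral_ge0 => w _.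
  by rewrite lee_fin powR_ge0.
have e1 : 0 < eta / (2 * (C + 1)) by rewrite divr_gt0// mulr_gt0//; lra.
have [K K0 HK] := powR_interp e1; set e := eta / _ in e1 HK.
have eC : e * (C + 1) = eta / 2 by rewrite /e; field; lra.
have e2 : 0 < eta / 2 / (K + 1) by rewrite divr_gt0//; lra.
have [n2 H2] := L1 _ e2.
exists (maxn n1 n2) => n; rewrite geq_max => /andP[/LG h1 /H2 h2].
have mn : measurable_fun setT (fun w => `|D n w|) by exact: measurableT_comp.
have mp s : measurable_fun setT (fun w => (`|D n w| `^ s)%:E).
  by apply/measurable_EFinP; exact: measurable_powR_comp.
have mnE : measurable_fun setT (fun w => (`|D n w|)%:E) by exact/measurable_EFinP.
have p0 s w : setT w -> (0 <= (`|D n w| `^ s)%:E)%E by rewrite lee_fin powR_ge0.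
have n0 w : setT w -> (0 <= (`|D n w|)%:E)%E by rewrite lee_fin.
have KE w : setT w -> (0 <= K%:E * (`|D n w|)%:E)%E by rewrite -EFinM lee_fin mulr_ge0.
have eE w : setT w -> (0 <= e%:E * (`|D n w| `^ g)%:E)%E.
  by rewrite -EFinM lee_fin mulr_ge0 ?powR_ge0// ltW.
have m2 : measurable_fun setT (fun w => K%:E * (`|D n w|)%:E)%E by exact: measurable_funeM.
have m3 : measurable_fun setT (fun w => e%:E * (`|D n w| `^ g)%:E)%E by exact: measurable_funeM.
apply: (@le_trans _ _ (\int[P]_w (e%:E + (K%:E * (`|D n w|)%:E + e%:E * (`|D n w| `^ g)%:E)))%E).
  apply: ge0_le_integral => //.
  - by apply: emeasurable_funD => //; exact: emeasurable_funD.
  - by move=> w _; rewrite -!EFinM -!EFinD lee_fin addrA HK.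
rewrite ge0_integralD//; last 3 first.
- by move=> w _; rewrite lee_fin ltW.
- by move=> w _; rewrite adde_ge0 ?KE ?eE.
- exact: emeasurable_funD.
rewrite ge0_integralD// ge0_integralZl ?lee_fin// ge0_integralZl ?lee_fin ?(ltW e1)//.
rewrite integral_cst// [X in (_ * X)%E]probability_setT mule1.
apply: (@le_trans _ _ (e%:E + (K%:E * (eta / 2 / (K + 1))%:E + e%:E * C%:E))%E).
  by rewrite leeD2l// leeD// lee_wpmul2l// lee_fin// ltW.
rewrite -!EFinM -!EFinD lee_fin.
have : (K + 1) * (eta / 2 / (K + 1)) = eta / 2 by field; lra.
lra.
Qed.

End Lq_interpolation.

(** * Convergence of the renormalized tail mass to W *)

Section renormalized_limit_L1.
Context {d : measure_display} {T : measurableType d} {R : realType}.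
Variables (P : probability T R) (X : vertex -> nat -> T -> \bar R).
Hypotheses (HX : iid_copies P X) (HE : point_process_encoding X).
Hypothesis law1 : (\int[law HX]_x atom_sum (fun=> 1%E) x = 1)%E.

Local Notation F := (step_prob law1).
Local Notation c := (rmean F).

Variables (g mg KW p a : R) (t : nat -> R) (W : T -> R).
Hypotheses (g1 : 1 < g) (g2 : g < 2).
Hypotheses (mgE : (\int[F]_y (expR (- ((g - 1) * y)))%:E = mg%:E)%E) (mg1 : mg < 1).
Hypothesis KWE : (\int[law HX]_x (atom_sum (fun=> 1%E) x) `^ g = KW%:E)%E.
Hypotheses (i1 : rintegrable F (fun y => y)) (i2 : rintegrable F (fun y => y ^+ 2)).
Hypotheses (p2 : 2 < p) (rv : regvar (tail F) p) (c0 : 0 < c).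
Hypotheses (a0 : 0 < a) (ap : p - 2 < a ^+ 2).
Hypothesis ht : forall n, (0 < n)%N -> ldscale F a n <= t n.
Hypothesis mW : measurable_fun setT W.
Hypothesis cW : {ae P, forall w, Wn X n w @[n --> \oo] --> (W w)%:E}.

Local Notation r := (grate g mg c).
Local Notation Q := (tail F).
Local Notation N n := (n%:R * tail F (t n)).
Local Notation M n j := (walk_mart law1 c n (t n) j).

Let r0 : 0 < r. Proof. exact: grate_gt0. Qed.
Let r1 : r < 1. Proof. exact: (grate_lt1 g1 mg1 c0). Qed.
Let KW0 : 0 <= KW. Proof. exact: KW_ge0 KWE. Qed.
Let Q0 x : 0 < Q x. Proof. by have [h _] := rv; exact: h. Qed.
Let cge0 : 0 <= c. Proof. exact: ltW. Qed.

(** Relative shortfall of the tail seen from position [v] in generation [k]. It tends to 0 for each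
    fixed [v] by the lower asymptotics and is bounded by 1, as [gsum_dct] requires. *)
Let psi k n v : R := Num.max 0 (1 - walk_tail F (n - k) (n%:R * c + t n - v) / N n).

Let psi_small k (e : R) : 0 < e -> exists n0 : nat, forall n, (n0 <= n)%N -> (0 < n)%N /\
  exists2 I, I <= e & (\int[P]_w gsum X k (fun v => (psi k n v)%:E) w = I%:E)%E.
Proof.
move=> e0.
have mpsi n : measurable_fun setT (psi k n).
  apply: measurable_maxr => //; apply: measurable_funB => //; apply: measurable_funM => //.
  apply: (measurableT_comp (measurable_walk_tail F (n - k))); exact: measurable_funB.
have p01 n v : 0 <= psi k n v <= 1.
  rewrite le_max lexx /= ge_max ler01 /= lerBlDr lerDl divr_ge0 ?walk_tail_ge0//.
  by rewrite mulr_ge0// ltW.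
have pc v : psi k n v @[n --> \oo] --> 0.
  apply/cvgrPdist_le => e' e'0.
  have [n0 H] := walk_tail_liminf i1 i2 p2 rv cge0 a0 v k e'0.
  exists (maxn n0 1) => // n /=; rewrite geq_max => /andP[h n1].
  have := p01 n v; rewrite sub0r normrN => /andP[p0 _]; rewrite ger0_norm// ge_max ltW//=.
  have N0 : 0 < N n by rewrite mulr_gt0// ltr0n.
  by have := H n (t n) h (ht n1); rewrite -ler_pdivlMr//; lra.
have := gsum_dct HE law1 k mpsi p01 pc.
move=> /fine_cvgP[[n1 _ H1] /cvgrPdist_le/(_ _ e0)[n2 _ H2]].
exists (maxn (maxn n1 n2) 1) => n; rewrite !geq_max => /andP[/andP[h1 h2] n0]; split => //.
exists (fine (\int[P]_w gsum X k (fun v => (psi k n v)%:E) w)%E); last by rewrite fineK//; exact: H1.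
by have := H2 n h2; rewrite /= sub0r normrN; apply: le_trans; exact: ler_norm.
Qed.

Let measurable_fine_M n j : measurable_fun setT (fun w => fine (M n j w)).
Proof. exact: measurable_fine_walk_mart. Qed.

Let measurable_G k : measurable_fun setT (fun w => fine (gsum X k (fun=> 1%E) w)).
Proof. exact: (measurableT_comp (@fine_measurable R setT measurableT) (measurable_gsum HX k _ _)). Qed.

Lemma mart_L1_limit : mart_small law1 t -> forall eta, 0 < eta ->
  exists n0 : nat, forall n, (n0 <= n)%N ->
  (\int[P]_w (`|fine (M n n w) / N n - W w|)%:E <= eta%:E)%E.
Proof.
(* Six of the eight shares are used: one for (M_n - M_k)/N, three for M_k/N - W_k (one from the
   mean, two from the shortfall), two for W_k - W. *)
move=> ms eta e0; have e8 : 0 < eta / 8 by lra.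
have [k0 H0] := ms _ e8.
have A0 : 0 <= (eta / 8) `^ (1 - g) * (8 * KW / (1 - r)).
  by rewrite mulr_ge0 ?powR_ge0// divr_ge0 ?mulr_ge0// subr_ge0 ltW.
have [k1 H1] := geometric_small r0 r1 A0 e8.
set k := maxn k0 k1.
have [n1 Hn1] := H0 k (leq_maxl _ _).
have rk := H1 k (leq_maxr _ _).
have [n2 Hn2] := psi_small k e8.
have [n3 Hn3] := walk_tail_limsup i1 i2 p2 rv cge0 a0 ap e8.
exists (maxn (maxn n1 n2) n3) => n; rewrite !geq_max => /andP[/andP[/Hn1[kn h1] /Hn2[n0 [I Ie EI]]] h3].
have ub := Hn3 n (t n) h3 (ht n0).
have N0 : 0 < N n by rewrite mulr_gt0// ltr0n.
have gd := gsum_dist HE law1 (k := k) (h := fun v => walk_tail F (n - k) (n%:R * c + t n - v)) (N := N n)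
  (H := walk_tail F n (n%:R * c + t n)) (I := I) N0.
have {}gd : (\int[P]_w (`|fine (M n k w) / N n - fine (gsum X k (fun=> 1%E) w)|)%:E <= (3 * (eta / 8))%:E)%E.
  apply: (le_trans (gd _ _ _ EI)).
  - apply: (measurableT_comp (measurable_walk_tail F (n - k))); exact: measurable_funB.
  - by move=> v; exact: walk_tail_ge0.
  - by rewrite gsum_walk_tail// subnK.
  rewrite lee_fin; have : walk_tail F n (n%:R * c + t n) / N n <= 1 + eta / 8 by rewrite ler_pdivrMr.
  lra.
have bg := integral_L1_Lg g1 (measurable_funB mW (measurable_G k)) e8
  (biggins_gap HE g1 g2 mgE mg1 c0 KWE k mW cW).
have {}bg : (\int[P]_w (`|fine (gsum X k (fun=> 1%E) w) - W w|)%:E <= (2 * (eta / 8))%:E)%E.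
  under eq_integral do rewrite distrC.
  apply: (le_trans bg); rewrite lee_fin.
  rewrite (_ : 8 * KW * (r ^+ k / (1 - r)) = 8 * KW / (1 - r) * r ^+ k); last by rewrite mulrA mulrAC.
  rewrite mulrA; lra.
have {}h1 : (\int[P]_w (`|(fine (M n n w) - fine (M n k w)) / N n|)%:E <= (eta / 8)%:E)%E.
  under eq_integral do rewrite normrM [X in _ * X]ger0_norm ?invr_ge0 ?(ltW N0)// mulrC EFinM.
  rewrite ge0_integralZl ?lee_fin ?invr_ge0 ?(ltW N0)//; last first.
    by apply/measurable_EFinP; apply: measurableT_comp => //; exact: measurable_funB.
  rewrite muleC -lee_pdivlMr ?invr_gt0//.
  by rewrite invrK -EFinM.
have mA : measurable_fun setT (fun w => (fine (M n n w) - fine (M n k w)) / N n).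
  by apply: measurable_funM => //; exact: measurable_funB.
have mB : measurable_fun setT (fun w => fine (M n k w) / N n - fine (gsum X k (fun=> 1%E) w)).
  by apply: measurable_funB => //; exact: measurable_funM.
have mC : measurable_fun setT (fun w => fine (gsum X k (fun=> 1%E) w) - W w).
  exact: measurable_funB.
have e w : fine (M n n w) / N n - W w = (fine (M n n w) - fine (M n k w)) / N n +
  ((fine (M n k w) / N n - fine (gsum X k (fun=> 1%E) w)) + (fine (gsum X k (fun=> 1%E) w) - W w)).
  by rewrite mulrBl subrKA subrKA.
under eq_integral do rewrite e.
apply: (le_trans (integral_normD_le P mA (measurable_funD mB mC))).
apply: (le_trans (leeD h1 (le_trans (integral_normD_le P mB mC) (leeD gd bg)))).
by rewrite -!EFinD lee_fin; lra.
Qed.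

(** Taken from k = 0: M_0 is the deterministic tail of the walk, at most 2 N, and W_0 = 1, so each
    of the three differences is bounded in L^g. *)
Lemma mart_Lg_bound : (exists CA, 0 <= CA /\ \forall s \near +oo, tail_moment HX g s <= CA * Q s `^ g) ->
  exists C, exists n0 : nat, forall n, (n0 <= n)%N ->
  (\int[P]_w (`|fine (M n n w) / N n - W w| `^ g)%:E <= C%:E)%E.
Proof.
move=> A5'.
have [C [n1 [C0 H1]]] := walk_mart_Lg_bound HE g1 g2 mgE mg1 KWE i1 i2 p2 rv c0 a0 ap ht A5'.
have [n2 H2] := walk_tail_limsup i1 i2 p2 rv cge0 a0 ap ltr01.
exists (4 * (C + 4 * (1 + 8 * KW / (1 - r)))), (maxn n1 n2) => n.
rewrite geq_max => /andP[h1 h2].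
have [n0 /andP[N0 N1] LG _] := H1 n 0 h1 (leq0n n).
have ub := H2 n (t n) h2 (ht n0).
set m := walk_tail F n (n%:R * c + t n) / N n.
have m01 : 0 <= m <= 2.
  by rewrite divr_ge0 ?walk_tail_ge0 ?(ltW N0)//= ler_pdivrMr.
have M0 w : fine (M n 0 w) = walk_tail F n (n%:R * c + t n).
  by rewrite /walk_mart gsum0 ?lee_fin ?walk_tail_ge0// subn0 subr0.
have e w : fine (M n n w) / N n - W w = (fine (M n n w) - fine (M n 0 w)) / N n +
  ((m - 1) + (1 - W w)).
  by rewrite M0 mulrBl -/m subrKA subrKA.
under eq_integral do rewrite e.
have mA : measurable_fun setT (fun w => (fine (M n n w) - fine (M n 0 w)) / N n).
  by apply: measurable_funM => //; exact: measurable_funB.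
have mC : measurable_fun setT (fun w => 1 - W w) by exact: measurable_funB.
apply: (integral_powRD_le g1 g2) => //.
- exact: measurable_funD.
- have N0g : 0 < N n `^ g by exact: powR_gt0.
  under eq_integral do rewrite normrM [X in _ * X]ger0_norm ?invr_ge0 ?(ltW N0)// powRM ?invr_ge0 ?(ltW N0)// mulrC EFinM.
  have mD : measurable_fun setT (fun w => (`|fine (M n n w) - fine (M n 0 w)| `^ g)%:E).
    apply/measurable_EFinP; apply: measurable_powR_comp; apply: measurableT_comp => //.
    exact: measurable_funB.
  rewrite ge0_integralZl; [|exact: measurableT|exact: mD| |by rewrite lee_fin powR_ge0]; last first.
    by move=> w _; rewrite lee_fin powR_ge0.
  apply: (@le_trans _ _ (((N n)^-1 `^ g)%:E * (C * N n `^ g * r ^+ 0)%:E)%E).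
    by rewrite lee_wpmul2l// lee_fin powR_ge0.
  rewrite -EFinM lee_fin expr0 mulr1 mulrCA -powRM ?invr_ge0 ?(ltW N0)//.
  by rewrite mulVf ?gt_eqF// powR1 mulr1.
apply: (integral_powRD_le g1 g2) => //.
- rewrite integral_cst// [X in (_ * X)%E]probability_setT mule1 lee_fin.
  have -> : 1 = 1 `^ g :> R by rewrite powR1.
  apply: (powR_mono g1); [exact: normr_ge0|rewrite powR1 ler_norml; lra].
have := biggins_gap HE g1 g2 mgE mg1 c0 KWE 0 mW cW.
rewrite expr0 mul1r => /(le_trans _); apply; rewrite le_eqVlt; apply/orP; left; apply/eqP.
by apply: eq_integral => w _; rewrite gsum0//= distrC.
Qed.

End renormalized_limit_L1.

(** * The hypotheses in terms of the tilted step law *)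

Section slow_variation.
Context {R : realType}.

(** Q(lam t)/Q(t) is the quotient of Q by its model t^(-p) l(t) at lam t, times the model's own
    ratio, times the inverse quotient at t. Positivity everywhere follows from eventual positivity
    by monotonicity. *)
Lemma regvar_of_slowly_varying (Q l : R -> R) (p : R) : {homo Q : s t /~ s <= t} ->
  (forall t, 0 <= Q t) -> slowly_varying l ->
  Q t / (t `^ (- p) * l t) @[t --> +oo%R] --> (1 : R) -> regvar Q p.
Proof.
move=> Qni Qge0 [_ l0 lsv] Ql.
have Qpos : \forall t \near +oo, 0 < Q t.
  have : \forall t \near +oo, 0 < Q t / (t `^ (- p) * l t).
    by have := cvgr_gt _ Ql; apply; rewrite ltr01.
  apply: filterS => t; rewrite lt0r => /andP[/eqP h _].
  rewrite lt0r Qge0 andbT; apply/eqP => q0; apply: h; by rewrite q0 mul0r.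
have Q0 t : 0 < Q t.
  have [A [_ HA]] := Qpos.
  apply: (@lt_le_trans _ _ (Q (Num.max t (A + 1)))).
    by apply: HA; rewrite lt_max ltrDl ltr01 orbT.
  by apply: Qni; rewrite le_max lexx.
split => // lam lam0.
have Ll : (lam * t) @[t --> +oo] --> +oo by apply: gt0_cvgMry => //; exact: cvg_id.
have h1 : Q (lam * t) / ((lam * t) `^ (- p) * l (lam * t)) @[t --> +oo] --> (1 : R).
  exact: (cvg_comp _ _ Ll Ql).
have h2 := lsv _ lam0.
have h3 : (Q t / (t `^ (- p) * l t))^-1 @[t --> +oo] --> (1 : R)^-1.
  by apply: cvgV => //; exact: oner_neq0.
have h : Q (lam * t) / ((lam * t) `^ (- p) * l (lam * t)) *
    (lam `^ (- p) * (l (lam * t) / l t)) * (Q t / (t `^ (- p) * l t))^-1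
    @[t --> +oo] --> 1 * (lam `^ (- p) * 1) * 1^-1.
  by apply: cvgM h3; apply: cvgM => //; apply: cvgM => //; exact: cvg_cst.
rewrite invr1 !mulr1 mul1r in h.
apply: cvg_trans h; apply: near_eq_cvg.
have l1 : \forall t \near +oo, 0 < l (lam * t) by exact: Ll _ l0.
near=> t.
have t0 : 0 < t by near: t; exact: nbhs_pinfty_gt.
have lt0 : 0 < l t by near: t.
have llt0 : 0 < l (lam * t) by near: t.
rewrite powRM ?ltW//; have a0 := powR_gt0 (- p) lam0; have b0 := powR_gt0 (- p) t0.
have q := Q0 t; field.
by rewrite !gt_eqF.
Unshelve. all: by end_near. Qed.

Lemma limn_esup_lty_bound (u : nat -> R) : (limn_esup (fun n => (u n)%:E) < +oo)%E ->
  exists B, exists n0 : nat, forall n, (n0 <= n)%N -> u n <= B.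
Proof.
move=> /ereal_inf_lt[y [A [n0 _ nA] <-]] ylt.
have ub n : (n0 <= n)%N -> ((u n)%:E <= ereal_sup ((fun n => (u n)%:E) @` A))%E.
  by move=> hn; apply: ereal_sup_ubound; exists n => //; exact: nA.
move: ub ylt; case: (ereal_sup _) => [B||]// ub _.
  by exists B, n0 => n /ub; rewrite lee_fin.
by have := ub n0 (leqnn _); rewrite leeNy_eq.
Qed.

(** Below [b] the first term suffices, above it the second. It lowers a moment exponent from g to s:
    with b = 1 in (A3), with b = F((t, oo)) in (A5). *)
Lemma poweR_interp (z : \bar R) (s g b : R) : (0 <= z)%E -> 0 < s -> s <= g -> 0 < b ->
  (z `^ s <= (b `^ s)%:E + (b `^ (s - g))%:E * z `^ g)%E.
Proof.
move=> z0 s0 sg b0; have g0 : 0 < g by exact: lt_le_trans sg.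
case: z z0 => [z||]// z0; last first.
  by rewrite !poweRyr ?gt_eqF// gt0_muley ?lte_fin ?powR_gt0// addey ?leey.
rewrite lee_fin in z0.
rewrite !poweR_EFin -EFinM -EFinD lee_fin.
have [zb|bz] := leP z b.
  have : z `^ s <= b `^ s by apply: ge0_ler_powR; rewrite ?nnegrE// ltW.
  have : 0 <= b `^ (s - g) * z `^ g by rewrite mulr_ge0 ?powR_ge0.
  lra.
have z1 : 0 < z by exact: lt_trans bz.
have : z `^ s <= b `^ (s - g) * z `^ g; last by have := powR_ge0 b s; lra.
rewrite [X in _ `^ X <= _](_ : s = (s - g) + g); last by ring.
rewrite powRD; last by rewrite (gt_eqF z1) implybT.
rewrite ler_wpM2r ?powR_ge0//.
rewrite /powR !gt_eqF// ler_expR.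
have ll : ln b <= ln z by rewrite ler_ln ?posrE// ltW.
have : (g - s) * ln b <= (g - s) * ln z by rewrite ler_wpM2l//; lra.
lra.
Qed.

(** Convexity of exp between 0 and [z]; it interpolates m(s) between m(1) = 1 and m(g) < 1. *)
Lemma expR_convex0 (s z : R) : 0 <= s -> s <= 1 -> expR (s * z) <= 1 - s + s * expR z.
Proof.
move=> s0 s1.
have h1 : expR (s * z) * (1 + (1 - s) * z) <= expR z.
  have -> : expR z = expR (s * z) * expR ((1 - s) * z) by rewrite -expRD; congr expR; ring.
  by rewrite ler_wpM2l ?expR_ge0// expR_ge1Dx.
have h2 : expR (s * z) * (1 - s * z) <= 1.
  rewrite [leRHS](_ : _ = expR (s * z) * expR (- (s * z))); last by rewrite -expRD addrN expR0.
  by rewrite ler_wpM2l ?expR_ge0// expR_ge1Dx.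
have s1' : 0 <= 1 - s by lra.
have := ler_wpM2l s0 h1; have := ler_wpM2l s1' h2; lra.
Qed.

Lemma sqr_le_pos_sqr (k y : R) : 0 < k ->
  y ^+ 2 <= pos_sqr y + 4 / k ^+ 2 * expR (- (k * y)).
Proof.
move=> k0; have k20 : 0 < k ^+ 2 by exact: exprn_gt0.
have e0 := expR_ge0 (- (k * y)).
rewrite /pos_sqr; case: (ltP y 0) => y0; last first.
  by rewrite lerDl mulr_ge0// divr_ge0// ltW.
rewrite expr0n /= add0r mulrAC ler_pdivlMr//.
have x0 : 0 <= - (k * y) / 2 by rewrite divr_ge0// oppr_ge0 mulr_ge0_le0// ltW.
have h := expR_ge1Dx (- (k * y) / 2).
have -> : expR (- (k * y)) = expR (- (k * y) / 2) ^+ 2.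
  by rewrite expr2 -expRD; congr expR; field.
set E := expR (- (k * y) / 2) in h *.
have : (- (k * y) / 2) ^+ 2 <= E ^+ 2 by rewrite ler_sqr ?nnegrE//; lra.
rewrite (_ : (- (k * y) / 2) ^+ 2 = y ^+ 2 * k ^+ 2 / 4); last by field.
lra.
Qed.

End slow_variation.

Section hypotheses_translation.
Context {d : measure_display} {T : measurableType d} {R : realType}.
Variables (P : probability T R) (X : vertex -> nat -> T -> \bar R).
Hypotheses (HX : iid_copies P X) (HE : point_process_encoding X).

Lemma integral_law (G : @atom_seq R -> \bar R) : measurable_fun setT G -> (forall x, 0 <= G x)%E ->
  (\int[law HX]_x G x = \int[P]_w G (offspring X [::] w))%E.
Proof. by move=> mG G0; rewrite /law ge0_integral_distribution. Qed.

Lemma measurable_atom_sum_id (f : R -> \bar R) : measurable_fun setT f -> (forall y, 0 <= f y)%E ->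
  measurable_fun setT (fun x : @atom_seq R => atom_sum f x).
Proof.
move=> mf f0.
have mz : measurable_fun setT (fun z : @atom_seq R * R => f z.2).
  exact: (measurableT_comp mf measurable_snd).
exact: (measurable_atom_sum (S := @atom_seq R) (g := id) (f := fun=> f)
  (@measurable_id _ _ _) mz (fun _ => f0)).
Qed.

Lemma integral_root_law (h : \bar R -> \bar R) (f : R -> \bar R) :
  measurable_fun setT f -> (forall y, 0 <= f y)%E ->
  (forall v, h v = wgt v * f (fine v))%E ->
  (\int[P]_w (\esum_(j in [set: nat]) h (X [::] j w)) = \int[law HX]_x atom_sum f x)%E.
Proof.
move=> mf f0 hE; rewrite integral_law; last 2 first.
- exact: measurable_atom_sum_id.
- by move=> x; exact: atom_sum_ge0.
apply: eq_integral => w _; rewrite esum_nat_series; last first.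
  by move=> i; rewrite hE mule_ge0 ?wgt_ge0.
by apply: eq_eseriesr => i _; rewrite hE.
Qed.

Lemma gsum_1 (h : R -> \bar R) w : (forall y, 0 <= h y)%E ->
  gsum X 1 h w = atom_sum h (offspring X [::] w).
Proof.
move=> h0; rewrite gsumS// /gen_sum.
rewrite (_ : [set u : vertex | size u == 0%N] = [set [::]]); last first.
  by apply/seteqP; split => u /=; [case: u|move=> ->].
have e : atom_sum (fun y => h (fine (V X [::] w) + y)) (offspring X [::] w) =
    atom_sum h (offspring X [::] w).
  by apply: eq_eseriesr => i _; rewrite /= add0r.
rewrite esum_set1 e; last by rewrite mule_ge0 ?wgt_ge0 ?atom_sum_ge0.
by rewrite /= oppr0 expR0 mul1e.
Qed.

Lemma integral_gsum_1_powR (h : R -> \bar R) (s : R) : measurable_fun setT h ->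
  (forall y, 0 <= h y)%E ->
  (\int[P]_w (gsum X 1 h w) `^ s = \int[law HX]_x (atom_sum h x) `^ s)%E.
Proof.
move=> mh h0; rewrite integral_law; last 2 first.
- exact: (measurableT_comp (measurable_poweR s) (measurable_atom_sum_id mh h0)).
- by move=> x; exact: poweR_ge0.
by apply: eq_integral => w _; rewrite gsum_1.
Qed.

Lemma law_mass : Defs.mfun P X 1 = 1%E -> (\int[law HX]_x atom_sum (fun=> 1%E) x = 1)%E.
Proof.
move=> mE; have m1 : measurable_fun setT (fun _ : R => 1%E : \bar R) by exact: measurable_cst.
have hE (v : \bar R) : (wgt v = wgt v * (fun=> 1) (fine v))%E by rewrite mule1.
rewrite -[RHS]mE -(integral_root_law m1 (fun=> lee01) hE).
by apply: eq_integral => w _; apply: eq_esum => j _; case: (X _ _ _) => [x||] //=; rewrite mul1r.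
Qed.

Hypothesis law1 : (\int[law HX]_x atom_sum (fun=> 1%E) x = 1)%E.
Local Notation F := (step_prob law1).
Local Notation c := (rmean F).

Lemma integral_root_step (h : \bar R -> \bar R) (f : R -> \bar R) :
  measurable_fun setT f -> (forall y, 0 <= f y)%E ->
  (forall v, h v = wgt v * f (fine v))%E ->
  (\int[P]_w (\esum_(j in [set: nat]) h (X [::] j w)) = \int[F]_y f y)%E.
Proof. by move=> mf f0 hE; rewrite (integral_root_law mf f0 hE) integral_step_prob. Qed.

Lemma mfunE theta : Defs.mfun P X theta = (\int[F]_y (expR (- ((theta - 1) * y)))%:E)%E.
Proof.
pose h (v : \bar R) : \bar R := match v with x%:E => (expR (- (theta * x)))%:E | _ => 0%E end.
have me : measurable_fun setT (fun y : R => (expR (- ((theta - 1) * y)))%:E).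
  apply/measurable_EFinP; apply: measurableT_comp => //.
  by apply: measurable_funN; exact: measurable_funM.
apply: (integral_root_step (h := h) me) => [y|[x||]] /=; rewrite ?mul0e ?lee_fin ?expR_ge0//.
by rewrite -EFinM -expRD; congr (expR _)%:E; ring.
Qed.

Lemma mder_posE : mder_pos P X = (\int[F]_y (Num.max y 0)%:E)%E.
Proof.
pose h (v : \bar R) : \bar R := match v with x%:E => (Num.max x 0 * expR (- x))%:E | _ => 0%E end.
apply: (integral_root_step (h := h)) => [|y|[x||]] /=; rewrite ?mul0e//.
- by apply/measurable_EFinP; exact: measurable_maxr.
- by rewrite lee_fin le_max lexx orbT.
- by rewrite -EFinM mulrC.
Qed.

Lemma mder_negE : mder_neg P X = (\int[F]_y (Num.max (- y) 0)%:E)%E.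
Proof.
pose h (v : \bar R) : \bar R := match v with x%:E => (Num.max (- x) 0 * expR (- x))%:E | _ => 0%E end.
apply: (integral_root_step (h := h)) => [|y|[x||]] /=; rewrite ?mul0e//.
- by apply/measurable_EFinP; apply: measurable_maxr => //; exact: measurable_funN.
- by rewrite lee_fin le_max lexx orbT.
- by rewrite -EFinM mulrC.
Qed.

Lemma FbarE t : Fbar P X t = tail F t.
Proof.
rewrite /Fbar /tail /Rintegral (integral_root_step (f := fun y => (t < y)%R%:R%:E))//.
- by apply/measurable_EFinP; exact: measurable_gt_ind.
- by move=> [x||] //=; rewrite ?mul0e//; case: ifP; rewrite ?mule1 ?mule0.
Qed.

Lemma A2_mean : A2 P X -> [/\ rintegrable F (fun y => y), cmean P X = c & 0 < c].
Proof.
rewrite /A2 /cmean mder_posE mder_negE => -[h1 h2 h3].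
have mp : measurable_fun setT (fun y : R => Num.max y 0) by exact: measurable_maxr.
have mn : measurable_fun setT (fun y : R => Num.max (- y) 0).
  by apply: measurable_maxr => //; exact: measurable_funN.
have ip : rintegrable F (fun y => Num.max y 0).
  by apply: rintegrable_ge0 => // y; rewrite le_max lexx orbT.
have im : rintegrable F (fun y => Num.max (- y) 0).
  by apply: rintegrable_ge0 => // y; rewrite le_max lexx orbT.
have e (y : R) : y = Num.max y 0 - Num.max (- y) 0.
  by rewrite /Num.max oppr_lt0; case: (ltgtP y 0) => // h; lra.
have fe : (fun y : R => y) = (fun y => Num.max y 0 - Num.max (- y) 0) by apply/funext.
have i1 : rintegrable F (fun y => y) by rewrite fe; exact: rintegrableB.
have cE : c = (\int[F]_y Num.max y 0 - \int[F]_y Num.max (- y) 0)%R.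
  by rewrite /rmean [in LHS]fe (rintB (mu := F)).
split; [exact: i1|by rewrite cE|].
by move: h3; rewrite !rint_EFin// lte_fin cE subr_gt0.
Qed.

Lemma sqr_rintegrable p k : 2 < p -> regvar (tail F) p -> 1 < k -> (Defs.mfun P X k < +oo)%E ->
  rintegrable F (fun y => y ^+ 2).
Proof.
move=> p2 rv k1; rewrite mfunE => mk.
have k0 : 0 < k - 1 by lra.
have me : measurable_fun setT (fun y : R => expR (- ((k - 1) * y))).
  by apply: measurableT_comp => //; apply: measurable_funN; exact: measurable_funM.
have mp : measurable_fun setT (@pos_sqr R).
  by apply: measurable_funX; exact: measurable_maxr.
apply: rintegrable_ge0 => [|y|]; [exact: measurable_funX|exact: sqr_ge0|].
apply: (@le_lt_trans _ _ (\int[F]_y ((pos_sqr y)%:E + (4 / (k - 1) ^+ 2)%:E * (expR (- ((k - 1) * y)))%:E))%E).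
  apply: ge0_le_integral => //.
  - by move=> y _; rewrite lee_fin sqr_ge0.
  - by apply/measurable_EFinP; exact: measurable_funX.
  - apply: emeasurable_funD; first exact/measurable_EFinP.
    by apply: measurable_funeM; exact/measurable_EFinP.
  - by move=> y _; rewrite -EFinM -EFinD lee_fin sqr_le_pos_sqr.
have k40 : 0 <= 4 / (k - 1) ^+ 2 by rewrite divr_ge0// sqr_ge0.
have mE : measurable_fun setT (fun y : R => (expR (- ((k - 1) * y)))%:E) by exact/measurable_EFinP.
have pE (y : R) : setT y -> (0 <= (pos_sqr y)%:E)%E by rewrite lee_fin sqr_ge0.
have eE (y : R) : setT y -> (0 <= (expR (- ((k - 1) * y)))%:E)%E by rewrite lee_fin expR_ge0.
rewrite ge0_integralD; [|exact: measurableT|exact: pE|exact/measurable_EFinP| |exact: measurable_funeM]; last first.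
  by move=> y _; rewrite -EFinM lee_fin mulr_ge0// expR_ge0.
rewrite ge0_integralZl; [|exact: measurableT|exact: mE|exact: eE|by rewrite lee_fin].
rewrite lte_add_pinfty//; first exact: (pos_sqr_integral_lty p2 rv).
by rewrite lte_mul_pinfty ?lee_fin.
Qed.

Lemma sigmaE : cmean P X = c -> rintegrable F (fun y => y) -> rintegrable F (fun y => y ^+ 2) ->
  sigma P X = Num.sqrt (rvar F).
Proof.
move=> cE i1 i2; rewrite /sigma /sigma2 cE; congr (Num.sqrt _).
rewrite /rvar /Rintegral; congr fine.
pose h (v : \bar R) : \bar R := match v with x%:E => ((x - c) ^+ 2 * expR (- x))%:E | _ => 0%E end.
apply: (integral_root_step (h := h)) => [|y|[x||]] /=; rewrite ?mul0e//.
- by apply/measurable_EFinP; apply: measurable_funX; exact: measurable_funB.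
- by rewrite lee_fin sqr_ge0.
- by rewrite -EFinM mulrC.
Qed.

Lemma A3_lower (s g : R) : 1 < s -> s <= g -> A3 P X g -> A3 P X s.
Proof.
move=> s1 sg [g1 g2 Wg mg]; have s0 : 0 < s by lra.
split; [exact: s1|by lra| |].
- have mW : measurable_fun setT (Wn X 1).
    rewrite (_ : Wn X 1 = gsum X 1 (fun=> 1%E)); last by apply/funext => w; rewrite WnE.
    exact: (measurable_gsum HX).
  apply: (@le_lt_trans _ _ (\int[P]_w (1%:E + (Wn X 1 w) `^ g))%E).
    apply: ge0_le_integral => //.
    + by move=> w _; exact: poweR_ge0.
    + exact: (measurableT_comp (measurable_poweR s) mW).
    + by apply: emeasurable_funD => //; exact: (measurableT_comp (measurable_poweR g) mW).
    + move=> w _; have w0 : (0 <= Wn X 1 w)%E by rewrite WnE gsum_ge0.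
      by have := poweR_interp w0 s0 sg ltr01; rewrite !powR1 mul1e.
  rewrite ge0_integralD//; last 2 first.
  + by move=> w _; exact: poweR_ge0.
  + exact: (measurableT_comp (measurable_poweR g) mW).
  by rewrite integral_cst// [X in (_ * X)%E]probability_setT mule1 lte_add_pinfty// ltry.
move: mg; rewrite !mfunE => mg.
set k := (s - 1) / (g - 1).
have k0 : 0 < k by rewrite divr_gt0; lra.
have k1 : k <= 1 by rewrite ler_pdivrMr; lra.
have me q : measurable_fun setT (fun y : R => (expR (- ((q - 1) * y)))%:E).
  apply/measurable_EFinP; apply: measurableT_comp => //.
  by apply: measurable_funN; exact: measurable_funM.
have k1' : 0 <= 1 - k by lra.
apply: (@le_lt_trans _ _ (\int[F]_y ((1 - k)%:E + k%:E * (expR (- ((g - 1) * y)))%:E))%E).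
  apply: ge0_le_integral => //.
  - by apply: emeasurable_funD => //; exact: measurable_funeM.
  - move=> y _; rewrite -EFinM -EFinD lee_fin.
    have -> : - ((s - 1) * y) = k * - ((g - 1) * y) by rewrite /k; field; lra.
    by apply: expR_convex0 => //; exact: ltW.
rewrite ge0_integralD//; last 2 first.
- by move=> y _; rewrite -EFinM lee_fin mulr_ge0 ?expR_ge0// ltW.
- exact: measurable_funeM.
rewrite integral_cst// [X in (_ * X)%E]probability_setT mule1.
rewrite ge0_integralZl ?lee_fin ?(ltW k0)//.
have : (0 <= \int[F]_y (expR (- ((g - 1) * y)))%:E)%E.
  by apply: integral_ge0 => y _; rewrite lee_fin expR_ge0.
case: (\int[F]_y _)%E mg => [m||]//; rewrite lte_fin => m1 _.
rewrite -EFinM -EFinD lte_fin; have := ltr_pM2l k0 m 1; rewrite m1; lra.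
Qed.

Lemma A5_tail_moment (s g : R) : 1 < s -> s <= g -> (forall t, 0 < tail F t) -> A5 P X g ->
  (forall t, \int[law HX]_x (atom_sum (fun y => (t < y)%R%:R%:E) x) `^ s = (tail_moment HX s t)%:E)%E ->
  exists CA, 0 <= CA /\ \forall t \near +oo, tail_moment HX s t <= CA * tail F t `^ s.
Proof.
move=> s1 sg Q0 [g1 [C HC]] tmE; exists (1 + `|C|); split; first by rewrite addr_ge0.
apply: filterS HC => t; rewrite FbarE => HC.
have mi : measurable_fun setT (fun y : R => ((t < y)%R%:R)%:E : \bar R).
  by apply/measurable_EFinP; exact: measurable_gt_ind.
rewrite -lee_fin -tmE -(integral_gsum_1_powR s mi)// .
have mZ : measurable_fun setT (Zbar X 1 t).
  rewrite (_ : Zbar X 1 t = gsum X 1 (fun v => (t < v)%R%:R%:E)); last by apply/funext => w; rewrite ZbarE.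
  exact: (measurable_gsum HX).
have Qt := Q0 t.
apply: (@le_trans _ _ (\int[P]_w ((tail F t `^ s)%:E + (tail F t `^ (s - g))%:E * (Zbar X 1 t w) `^ g))%E).
  apply: ge0_le_integral => //.
  - by move=> w _; exact: poweR_ge0.
  - by apply: (measurableT_comp (measurable_poweR s)); exact: (measurable_gsum HX).
  - apply: emeasurable_funD => //; apply: measurable_funeM.
    exact: (measurableT_comp (measurable_poweR g) mZ).
  - move=> w _; rewrite ZbarE; apply: poweR_interp => //; last by lra.
    exact: gsum_ge0.
rewrite ge0_integralD//; last 3 first.
- by move=> w _; rewrite lee_fin powR_ge0.
- by move=> w _; rewrite mule_ge0 ?poweR_ge0// lee_fin powR_ge0.
- by apply: measurable_funeM; exact: (measurableT_comp (measurable_poweR g) mZ).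
rewrite integral_cst// [X in (_ * X)%E]probability_setT mule1 mulrDl mul1r EFinD leeD2l//.
rewrite ge0_integralZl ?lee_fin ?powR_ge0//; last 2 first.
- exact: (measurableT_comp (measurable_poweR g) mZ).
- by move=> w _; exact: poweR_ge0.
apply: (@le_trans _ _ ((tail F t `^ (s - g))%:E * (C * tail F t `^ g)%:E)%E).
  by rewrite lee_wpmul2l// lee_fin powR_ge0.
rewrite -EFinM lee_fin mulrCA -powRD; last by rewrite (gt_eqF Qt) implybT.
by rewrite subrK ler_wpM2r ?powR_ge0// ler_norm.
Qed.

(** The last condition of (I) gives e^(-k r(n)) <= B N, where k > 0 because q > 1 + delta. Taking
    logarithms, - ln N is at most k r(n) plus a constant, which is o(n) because r(n) is. *)
Lemma condI_slow (gamma delta q : R) (r t : nat -> R) : (forall x, 0 < tail F x) ->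
  condI P X gamma delta q r t -> forall eta, 0 < eta -> exists n0 : nat, forall n, (n0 <= n)%N ->
  - ln (n%:R * tail F (t n)) <= eta * n%:R.
Proof.
move=> Q0 [[d0 dg dq qg] [ro _ _ /limn_esup_lty_bound[B [n1 H1]]]] eta e0.
set k := 1 - (1 + delta) / q in H1.
have k0 : 0 < k.
  have q0 : 0 < q by lra.
  have : (1 + delta) / q < 1 by rewrite ltr_pdivrMr//; lra.
  by rewrite /k; lra.
have [n2 _ H2] : \forall n \near \oo, `|r n| <= eta / (2 * k) * `|n%:R : R|.
  by move/eqoP: ro; apply; rewrite divr_gt0// mulr_gt0.
have [n3 H3] := @nat_gt R (2 * ln (`|B| + 1) / eta).
exists (maxn (maxn n1 n2) (maxn n3 1)) => n; rewrite !geq_max => /andP[/andP[h1 h2] /andP[h3 n0]].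
have N0 : 0 < n%:R * tail F (t n) by rewrite mulr_gt0// ltr0n.
have B0 : 0 < `|B| + 1 by have := normr_ge0 B; lra.
have := H1 n h1; rewrite FbarE ler_pdivrMr// => b.
have b1 : expR (- (r n * k)) <= (`|B| + 1) * (n%:R * tail F (t n)).
  by apply: (le_trans b); rewrite ler_pM2r//; have := ler_norm B; lra.
have b2 : - (r n * k) <= ln (`|B| + 1) + ln (n%:R * tail F (t n)).
  by rewrite -lnM ?posrE// -[leLHS]expRK ler_ln ?posrE ?expR_gt0// mulr_gt0.
have := H2 n h2; rewrite /= [X in _ * X]ger0_norm// => b3.
have b4 : r n <= eta / (2 * k) * n%:R by exact: le_trans (ler_norm _) b3.
have b5 : r n * k <= eta / 2 * n%:R.
  have := ler_wpM2r (ltW k0) b4.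
  by rewrite (_ : eta / (2 * k) * n%:R * k = eta / 2 * n%:R)//; field; rewrite gt_eqF.
have b6 : 2 * ln (`|B| + 1) <= n%:R * eta by rewrite -ler_pdivrMr// ltW// H3.
lra.
Qed.

Lemma Zbar_walk_mart n (t : R) w : Zbar X n (n%:R * c + t) w = walk_mart law1 c n t n w.
Proof.
rewrite ZbarE /walk_mart subnn; apply: eq_gsum => v.
by rewrite /walk_tail /= subr_lt0.
Qed.

(** [fine] changes nothing where W_n is finite, since W_n dominates M_n; this holds almost
    surely. *)
Lemma normZ_ae (W : T -> R) t n : cmean P X = c -> {ae P, forall w,
  (`|normZ P X t n w - (W w)%:E| =
   (`|fine (walk_mart law1 c n (t n) n w) / (n%:R * tail F (t n)) - W w|)%:E)%E}.
Proof.
move=> cE; apply: (filterS _ (gsum1_fin HE law1 n)) => w fw.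
rewrite /normZ cE FbarE Zbar_walk_mart.
have : walk_mart law1 c n (t n) n w \is a fin_num.
  rewrite ge0_fin_numE; last by apply: gsum_ge0 => v; rewrite lee_fin walk_tail_ge0.
  apply: (@le_lt_trans _ _ (gsum X n (fun=> 1%E) w)).
    by apply: gsum_le => v; rewrite ?lee_fin ?walk_tail_ge0 ?walk_tail_le1.
  by rewrite -ge0_fin_numE// gsum_ge0.
by case: (walk_mart _ _ _ _ _ _).
Qed.

Lemma Lq_conv_of_bound (q : R) (W : T -> R) (t : nat -> R) : 0 < q -> cmean P X = c ->
  measurable_fun setT W ->
  (forall eta, 0 < eta -> exists n0 : nat, forall n, (n0 <= n)%N ->
    (\int[P]_w (`|fine (walk_mart law1 c n (t n) n w) / (n%:R * tail F (t n)) - W w| `^ q)%:E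
      <= eta%:E)%E) ->
  Lq_conv P q (normZ P X t) W.
Proof.
move=> q0 cE mW H.
have mM n : measurable_fun setT (walk_mart law1 c n (t n) n) by exact: measurable_walk_mart.
have mZ n : measurable_fun setT (normZ P X t n).
  rewrite (_ : normZ P X t n = fun w => (walk_mart law1 c n (t n) n w * ((n%:R * tail F (t n))^-1)%:E)%E).
    by under eq_fun do rewrite muleC; exact: measurable_funeM.
  by apply/funext => w; rewrite /normZ cE FbarE Zbar_walk_mart.
have E n : (\int[P]_w (`| normZ P X t n w - (W w)%:E |) `^ q =
    \int[P]_w (`|fine (walk_mart law1 c n (t n) n w) / (n%:R * tail F (t n)) - W w| `^ q)%:E)%E.
  apply: ge0_ae_eq_integral => //.
  - apply: (measurableT_comp (measurable_poweR q)); apply: measurableT_comp => //.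
    by apply: emeasurable_funB => //; exact/measurable_EFinP.
  - apply/measurable_EFinP; apply: measurable_powR_comp; apply: measurableT_comp => //.
    apply: measurable_funB => //; apply: measurable_funM => //.
    exact: (measurableT_comp (@fine_measurable R setT measurableT) (mM n)).
  - by move=> w _; exact: poweR_ge0.
  - by apply: (filterS _ (normZ_ae W t n cE)) => w -> _; rewrite poweR_EFin.
rewrite /Lq_conv; under eq_fun do rewrite E.
have ge0 n : (0 <= \int[P]_w (`|fine (walk_mart law1 c n (t n) n w) / (n%:R * tail F (t n)) - W w| `^ q)%:E)%E.
  by apply: integral_ge0 => w _; rewrite lee_fin powR_ge0.
apply/fine_cvgP; split.
  have [n0 H0] := H 1 ltr01; exists n0 => // n /= /H0 h.
  by rewrite ge0_fin_numE// (le_lt_trans h)// ltry.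
apply/cvgrPdist_le => e e0; have [n0 H0] := H e e0; exists n0 => // n /= /H0 h.
rewrite sub0r normrN ger0_norm ?fine_ge0//.
by rewrite -lee_fin fineK// ge0_fin_numE// (le_lt_trans h)// ltry.
Qed.

End hypotheses_translation.

Theorem theorem2p5 (d : measure_display) (T : measurableType d) (R : realType)
  (P : probability T R) (X : vertex -> nat -> T -> \bar R) (W : T -> R)
  (p a : R) (t : nat -> R) :
  iid_copies P X ->
  point_process_encoding X ->
  as_locally_finite P X ->
  A1 P X -> A2 P X -> (exists gamma, A3 P X gamma) -> A4 P X p -> 2 < p ->
  measurable_fun setT W ->
  {ae P, forall w, Wn X n w @[n --> \oo] --> (W w)%:E} ->
  Num.sqrt (p - 2) < a ->
  (forall n : nat, (0 < n)%N ->
     a * sigma P X * Num.sqrt (n%:R * ln n%:R) <= t n) ->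
  ( ((exists gamma delta q (r : nat -> R),
        A3 P X gamma /\ condI P X gamma delta q r t)
     \/ (exists gamma, A5 P X gamma)) ->
    Lq_conv P 1 (normZ P X t) W )
  /\
  (forall gamma, A3 P X gamma -> A5 P X gamma ->
     forall q, 0 < q -> q < 2 - gamma^-1 -> Lq_conv P q (normZ P X t) W).
Proof.
move=> HX HE _ [m1 _] a2 [g0 a30] [p0 [l [sl Fl]]] p2 mW cW ap ht.
have law1 := law_mass HX m1.
set F := step_prob law1; set c := rmean F.
have [i1 cE c0] := A2_mean law1 a2.
have rv : regvar (tail F) p.
  have FE : Fbar P X = tail F by apply/funext => x; exact: FbarE.
  by rewrite FE in Fl; exact: (regvar_of_slowly_varying (fun x y => @tail_le _ F y x) (tail_ge0 F) sl Fl).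
have Q0 x : 0 < tail F x by have [h _] := rv; exact: h.
have i2 : rintegrable F (fun y => y ^+ 2).
  have [g1 _ _ mg] := a30; apply: (sqr_rintegrable p2 rv g1).
  by rewrite (lt_trans mg)// ltry.
have sE := sigmaE cE i1 i2.
have a0 : 0 < a by apply: le_lt_trans ap; exact: sqrtr_ge0.
have ap2 : p - 2 < a ^+ 2.
  have p20 : 0 <= p - 2 by lra.
  by rewrite -[ltLHS](sqr_sqrtr p20) ltr_sqr ?nnegrE ?sqrtr_ge0// ltW.
have ht' n : (0 < n)%N -> ldscale F a n <= t n by move=> /ht; rewrite sE.
have moments g : A3 P X g -> exists mg KW, [/\ 1 < g, g < 2, mg < 1,
    (\int[F]_y (expR (- ((g - 1) * y)))%:E = mg%:E)%E &
    (\int[law HX]_x (atom_sum (fun=> 1%E) x) `^ g = KW%:E)%E].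
  move=> [g1 g2 Wg mg].
  have m1' : measurable_fun setT (fun _ : R => 1%E : \bar R) by exact: measurable_cst.
  exists (fine (Defs.mfun P X g)), (fine (\int[P]_w (Wn X 1 w) `^ g)%E).
  have mg0 : (0 <= Defs.mfun P X g)%E.
    by rewrite (mfunE law1); apply: integral_ge0 => y _; rewrite lee_fin expR_ge0.
  have mgf : Defs.mfun P X g \is a fin_num by rewrite ge0_fin_numE// (lt_trans mg)// ltry.
  have Wf : (\int[P]_w (Wn X 1 w) `^ g)%E \is a fin_num.
    by rewrite ge0_fin_numE//; apply: integral_ge0 => w _; exact: poweR_ge0.
  split => //; first by rewrite -lte_fin fineK.
    by rewrite fineK// -(mfunE law1).
  rewrite fineK// -(integral_gsum_1_powR HX HE g m1')//.
  by apply: eq_integral => w _; rewrite WnE.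
pose D n w := fine (walk_mart law1 c n (t n) n w) / (n%:R * tail F (t n)) - W w.
have mD n : measurable_fun setT (D n).
  apply: measurable_funB => //; apply: measurable_funM => //.
  by apply: measurable_fine_walk_mart.
split=> [[[g [del [q [r [a3 cI]]]]]|[g a5]]|g a3 a5 q q0 qg].
- have [mg [KW [g1 g2 mg1 mgE KWE]]] := moments g a3.
  have slow := condI_slow Q0 cI.
  have ms := mart_small_slow HE g1 g2 mgE mg1 KWE i1 i2 p2 rv c0 a0 ap2 ht' slow.
  apply: (Lq_conv_of_bound HE ltr01 cE mW) => eta e0.
  have [n0 H] := mart_L1_limit HE g1 g2 mgE mg1 KWE i1 i2 p2 rv c0 a0 ap2 ht' mW cW ms e0.
  by exists n0 => n /H h; under eq_integral do rewrite powRr1//.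
(* (A3) and (A5) may come with different exponents; the moment bounds drawn from them hold for the
   smaller one, and any exponent above 1 gives L^1 convergence. *)
- have min_l_le : Num.min g0 g <= g0 by rewrite ge_min lexx.
  have min_r_le : Num.min g0 g <= g by rewrite ge_min lexx orbT.
  have s1 : 1 < Num.min g0 g by rewrite lt_min; case: a30 => -> _ _ _; case: a5 => ->.
  have a3s := A3_lower law1 s1 min_l_le a30.
  have [mg [KW [g1 g2 mg1 mgE KWE]]] := moments _ a3s.
  have tmE x := proj1 (tail_moment_spec (HX := HX) g1 KWE x).
  have heavy := A5_tail_moment HE s1 min_r_le Q0 a5 tmE.
  have ms := mart_small_heavy HE g1 g2 mgE mg1 KWE i1 i2 p2 rv c0 a0 ap2 ht' heavy.
  apply: (Lq_conv_of_bound HE ltr01 cE mW) => eta e0.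
  have [n0 H] := mart_L1_limit HE g1 g2 mgE mg1 KWE i1 i2 p2 rv c0 a0 ap2 ht' mW cW ms e0.
  by exists n0 => n /H h; under eq_integral do rewrite powRr1//.
have [mg [KW [g1 g2 mg1 mgE KWE]]] := moments g a3.
have tmE x := proj1 (tail_moment_spec (HX := HX) g1 KWE x).
have heavy := A5_tail_moment HE g1 (lexx _) Q0 a5 tmE.
have ms := mart_small_heavy HE g1 g2 mgE mg1 KWE i1 i2 p2 rv c0 a0 ap2 ht' heavy.
(* q < 2 - 1/g is stronger than q < g, the gap being (g - 1)^2 / g. *)
have qg' : q < g.
  have : (g - 1) ^+ 2 / g > 0 by rewrite divr_gt0 ?exprn_gt0//; lra.
  rewrite (_ : (g - 1) ^+ 2 / g = g - (2 - g^-1)); last by field; rewrite gt_eqF//; lra.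
  lra.
have [C LG] := mart_Lg_bound HE g1 g2 mgE mg1 KWE i1 i2 p2 rv c0 a0 ap2 ht' mW cW heavy.
apply: (Lq_conv_of_bound HE q0 cE mW).
apply: (Lq_of_L1_Lg q0 qg' mD _ LG) => eta e0.
exact: (mart_L1_limit HE g1 g2 mgE mg1 KWE i1 i2 p2 rv c0 a0 ap2 ht' mW cW ms e0).
Qed.
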